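(* Fix an integer $n\geq 1$ and an open subset $U\subset\mathbb{R}^n$ containing the closed unit ball $\overline{B(0,1)}$. Let $(f_\lambda)_{\lambda\geq 1}$ be a family of continuous centered Gaussian fields on $U$ satisfying the following properties. (1) There exists $a<+\infty$ such that for all $x,y\in U$ and $\lambda\geq 1$, $$\left|\mathbb{E}[f_\lambda(x)f_\lambda(y)]-\ln(\lambda)+\ln_+(\lambda|x-y|)\right|\leq a .$$ (2) There exist $\alpha\in(0,2]$ and $b<+\infty$ such that for all $x,y\in U$ and all $\lambda\geq 1$ satisfying $\lambda|x-y|\leq 1$, $$\mathbb{E}\left[(f_\lambda(x)-f_\lambda(y))^2\right]\leq b^2\lambda^\alpha|x-y|^\alpha .$$ Then there exist $\rho>0$, $\kappa>0$ and $\lambda_0\in[1,+\infty)$, depending only on $a,b,\alpha,n$, such that the following holds. Let $\mathcal{C}^\lambda$ be the event that $f_\lambda^{-1}(0)$ has a connected component included in the ball $B(0,\rho/\lambda)$. Then, for each $\lambda\geq\lambda_0$, $$\mathbb{P}[\mathcal{C}^\lambda]\geq\kappa\,\ln(\lambda)^{-1/2} .$$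
   Context: Here $\ln_+(t)=\max(\ln t,0)$ for $t>0$ and $\ln_+(0)=0$; $|\cdot|$ is the Euclidean norm and $B(x,r)$ the Euclidean ball of center $x$ and radius $r$. *)

(* Defs.v *)
From HB Require Import structures.
From mathcomp Require Import all_boot all_order all_algebra.
From mathcomp Require Import all_classical all_reals all_analysis.
Set Implicit Arguments.
Unset Strict Implicit.
Unset Printing Implicit Defensive.
Import Order.TTheory GRing.Theory Num.Theory.
Import numFieldNormedType.Exports.
Local Open Scope classical_set_scope.
Local Open Scope ring_scope.

(* The norm [`|x|] that the library puts on ['rV[R]_n] is the sup norm, so the
   Euclidean norm and balls are defined here. The library's topology on
   ['rV[R]_n] is the usual one and is used as is. *)
Definition enorm (R : realType) (n : nat) (x : 'rV[R]_n) : R :=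
  Num.sqrt (\sum_(i < n) x 0 i ^+ 2).

Definition eball (R : realType) (n : nat) (x : 'rV[R]_n) (r : R) :
    set 'rV[R]_n :=
  [set y | enorm (y - x) < r].

Definition closed_eball (R : realType) (n : nat) (x : 'rV[R]_n) (r : R) :
    set 'rV[R]_n :=
  [set y | enorm (y - x) <= r].

Definition ln_plus (R : realType) (t : R) : R :=
  if 0 < t then Num.max (ln t) 0 else 0.

(* [normal_prob m 0] is not the Dirac mass at [m] in the library, whereas
   degenerate Gaussian variables have to be allowed. *)
Definition gaussian_law (R : realType) (m s : R) :
    set (measurableTypeR R) -> \bar R :=
  if s == 0 then dirac m else normal_prob m s.

Definition is_gaussian (R : realType) (d : measure_display)
    (T : measurableType d) (P : probability T R) (X : T -> R) : Prop :=
  measurable_fun setT X /\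
  exists m s : R, 0 <= s /\
    forall A : set R, measurable A -> P (X @^-1` A) = gaussian_law m s A.

(* A field on [U] is a function on the whole space whose values outside [U]
   are unconstrained and unused. *)
Definition gaussian_field (R : realType) (d : measure_display)
    (T : measurableType d) (P : probability T R) (n : nat)
    (U : set 'rV[R]_n) (g : 'rV[R]_n -> T -> R) : Prop :=
  forall (k : nat) (x : 'I_k -> 'rV[R]_n) (c : 'I_k -> R),
    (forall i, U (x i)) ->
    is_gaussian P (fun w => \sum_(i < k) c i * g (x i) w).

Definition centered_field (R : realType) (d : measure_display)
    (T : measurableType d) (P : probability T R) (n : nat)
    (U : set 'rV[R]_n) (g : 'rV[R]_n -> T -> R) : Prop :=
  forall x, U x -> ('E_P[g x] = 0)%E.

Definition continuous_field (R : realType) (d : measure_display)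
    (T : measurableType d) (n : nat)
    (U : set 'rV[R]_n) (g : 'rV[R]_n -> T -> R) : Prop :=
  forall w, {within U, continuous (fun x => g x w)}.

Definition zero_set (R : realType) (d : measure_display)
    (T : measurableType d) (n : nat)
    (U : set 'rV[R]_n) (g : 'rV[R]_n -> T -> R) (w : T) : set 'rV[R]_n :=
  [set x | U x /\ g x w = 0].

Definition component_event (R : realType) (d : measure_display)
    (T : measurableType d) (n : nat)
    (U : set 'rV[R]_n) (g : 'rV[R]_n -> T -> R) (r : R) : set T :=
  [set w | exists x, zero_set U g w x /\
           connected_component (zero_set U g w) x `<=` eball 0 r].

(* Main.v *)
(* Put A = f 0, let z be a point of norm e^r / lambda with r a large constant, and
   let X be minus the part of f z uncorrelated with A. Since the covariance is
   logarithmic, for r large and lambda larger cov (f y) X <= - 1/2 on the whole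
   sphere |y| = |z|, while var X is bounded and var A is about ln lambda. Write
     f y = (cov (f y) A / var A) A + (cov (f y) X / var X) X + h y,
   where h is uncorrelated with A and X and vanishes at 0. If A lies in [1, 3], X is
   close to a large constant s, and |h| <= 2 M near 0, then f 0 > 0 and f < 0 on the
   sphere, so f has a zero on a radius and the component of this zero cannot cross
   the sphere. A window for A has probability of order (ln lambda)^(-1/2), one for X
   a probability bounded below, and |h| <= 2 M is likely by Kolmogorov chaining,
   uniformly in lambda by hypothesis (2).

   Independence of A, X and h is not used: the windows are replaced by smooth weights
   sinc^4 of A and X. Being entire, such a weight factorises against exponentials of
   an uncorrelated Gaussian variable by differentiating Laplace transforms, hence it
   also factorises in the moment bounds that chaining needs. *)
Require Import Defs.
From HB Require Import structures.
From mathcomp Require Import all_boot all_order all_algebra.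
From mathcomp Require Import all_classical all_reals all_analysis.
From mathcomp Require Import measurable_realfun zify ring lra.
Import Order.TTheory GRing.Theory Num.Theory.
Import numFieldNormedType.Exports.
Local Open Scope classical_set_scope.
Local Open Scope ring_scope.
Set Implicit Arguments.
Unset Strict Implicit.
Unset Printing Implicit Defensive.

(** * Gaussian variables and exponential moments *)

(** The hypotheses only give the laws of single linear combinations, so all joint information has to
    pass through Laplace transforms of such combinations, and a cut-off compatible with them cannot
    have compact support. Its tails are paid for by scaling: outside a window of half-width 1 the
    squared bump of scale [e] is at most [e ^+ 2] times the bump, so the tail costs order e^3/s
    against a main term of order e/s, with s the standard deviation, and a small fixed [e] suffices.
    The target probability tends to 0 with lambda, so a plain bound on the probability that h is
    large could not be subtracted from it. Chaining is therefore run under the weight, and its bad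
    set is compared with the mass of the weight. The constants are fixed in this order: the radius
    from [a], then M, then the level s of X, then the scales of the bumps; none depends on lambda.
    Measurability of the event is a separate matter, settled by separating a component from the rest
    of a compact zero set by finitely many rational boxes. *)

Section normal_integral.
Variable R : realType.
Implicit Types (m s t : R) (h : R -> R).
Local Notation mu := (@lebesgue_measure R).

Lemma ge0_integral_normal m s h : measurable_fun [set: R] h -> (forall x, 0 <= h x) ->
  (\int[normal_prob m s]_x (h x)%:E = \int[mu]_x (h x * normal_pdf m s x)%:E)%E.
Proof.
move=> mh h0.
have dom := normal_prob_dominates m s.
rewrite -(Radon_Nikodym_SigmaFinite.change_of_variables dom)//; last exact/measurable_EFinP.
apply: ae_eq_integral => //.
- apply: emeasurable_funM => //; first exact/measurable_EFinP.
  exact: measurable_int (Radon_Nikodym_SigmaFinite.f_integrable dom).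
- apply/measurable_EFinP; apply: measurable_funM => //.
  exact: measurable_normal_pdf.
- under [X in ae_eq _ _ _ X]eq_fun do rewrite EFinM.
  apply: ae_eqe_mul2l; apply: integral_ae_eq => //.
  + exact: Radon_Nikodym_SigmaFinite.f_integrable.
  + by apply/measurable_EFinP; exact: measurable_normal_pdf.
  + by move=> E _ mE; rewrite -Radon_Nikodym_SigmaFinite.f_integral.
Qed.

Lemma measurable_expRM t : measurable_fun [set: R] (fun x => expR (t * x)).
Proof.
apply: continuous_measurable_fun => x; apply: continuous_comp; last exact: continuous_expR.
exact: mulrl_continuous.
Qed.

(** Completing the square turns the integrand into a constant times the density of mean
    [m + t * s ^+ 2], whose integral is 1. *)
Lemma normal_mgf m s t : s != 0 ->
  (\int[normal_prob m s]_x (expR (t * x))%:E =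
   (expR (t * m + t ^+ 2 * s ^+ 2 / 2))%:E)%E.
Proof.
move=> s0; rewrite ge0_integral_normal//; last exact: measurable_expRM.
have -> : (expR (t * m + t ^+ 2 * s ^+ 2 / 2))%:E
    = ((expR (t * m + t ^+ 2 * s ^+ 2 / 2))%:E *
       \int[mu]_x (normal_pdf (m + t * s ^+ 2) s x)%:E)%E.
  by rewrite integral_normal_pdf mule1.
rewrite -ge0_integralZl.
- apply: eq_integral => x _; rewrite -EFinM !normal_pdfE//; congr EFin.
  rewrite mulrCA [RHS]mulrCA; congr (_ * _).
  rewrite /normal_fun -!expRD; congr expR.
  by field; rewrite s0.
- exact: measurableT.
- by apply/measurable_EFinP; exact: measurable_normal_pdf.
- by move=> x _; rewrite lee_fin normal_pdf_ge0.
- by rewrite lee_fin expR_ge0.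
Qed.

End normal_integral.

Section centered_gaussian.
Context (R : realType) (d : measure_display) (T : measurableType d)
  (P : probability T R).
Implicit Types (X : T -> R) (m s t : R).

Definition has_gaussian_law X m s :=
  [/\ measurable_fun setT X, 0 <= s &
      forall A : set R, measurable A -> P (X @^-1` A) = gaussian_law m s A].

Definition centered_gaussian X s := has_gaussian_law X 0 s.

Lemma gaussian_ge0_integral X m s (h : R -> R) : has_gaussian_law X m s -> s != 0 ->
  measurable_fun [set: R] h -> (forall x, 0 <= h x) ->
  (\int[P]_w (h (X w))%:E
   = \int[lebesgue_measure]_x (h x * normal_pdf m s x)%:E)%E.
Proof.
move=> [mX _ lawX] s0 mh h0; rewrite -ge0_integral_normal//.
pose mX' := isMeasurableFun.Build _ _ T (measurableTypeR R) X mX.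
pose X' : {mfun T >-> measurableTypeR R} := HB.pack X mX'.
transitivity (\int[pushforward P X']_x (h x)%:E)%E.
  rewrite ge0_integral_pushforward//; first exact/measurable_EFinP.
  by move=> x _; rewrite lee_fin.
apply: eq_measure_integral => A mA _.
by rewrite /pushforward [LHS]lawX// /gaussian_law (negbTE s0).
Qed.

Lemma gaussian_degenerate X m (h : R -> R) : has_gaussian_law X m 0 ->
  measurable_fun [set: R] h -> (forall x, 0 <= h x) ->
  (\int[P]_w (h (X w))%:E = (h m)%:E)%E.
Proof.
move=> [mX _ lawX] mh h0.
pose mX' := isMeasurableFun.Build _ _ T (measurableTypeR R) X mX.
pose X' : {mfun T >-> measurableTypeR R} := HB.pack X mX'.
transitivity (\int[pushforward P X']_x (h x)%:E)%E.
  rewrite ge0_integral_pushforward//; first exact/measurable_EFinP.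
  by move=> x _; rewrite lee_fin.
transitivity (\int[\d_(m : measurableTypeR R)]_x (h x)%:E)%E.
  apply: eq_measure_integral => A mA _.
  by rewrite /pushforward [LHS]lawX// /gaussian_law eqxx.
rewrite integral_dirac//; last exact/measurable_EFinP.
by rewrite diracT mul1e.
Qed.

Lemma gaussian_mgf X m s t : has_gaussian_law X m s ->
  (\int[P]_w (expR (t * X w))%:E = (expR (t * m + t ^+ 2 * s ^+ 2 / 2))%:E)%E.
Proof.
move=> GX; have mh := measurable_expRM t.
have h0 x : 0 <= expR (t * x) by exact: expR_ge0.
have [s0|s0] := eqVneq s 0.
  subst s; rewrite (gaussian_degenerate GX mh h0).
  by rewrite expr0n/= mulr0 mul0r addr0.
by rewrite (gaussian_ge0_integral GX s0 mh h0) -ge0_integral_normal// normal_mgf.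
Qed.

End centered_gaussian.

Section exp_difference_quotient.
Variable R : realType.
Implicit Types x y : R.

(** The difference quotient of e^(hx) in h at 0, with h = 1/(n+1). It tends to [x] under an
    exponential domination, so moments come from Laplace transforms by dominated convergence. *)
Definition expR_quotient (n : nat) x : R := n.+1%:R * (expR (x / n.+1%:R) - 1).

Let expR_sub1_le y : expR y - 1 <= y * expR y.
Proof.
have := expR_ge1Dx (- y); rewrite expRN => h.
have e0 := expR_gt0 y.
have : (1 - y) * expR y <= (expR y)^-1 * expR y by rewrite ler_pM2r.
by rewrite mulVf ?gt_eqF// mulrBl mul1r lerBlDr addrC -lerBlDr.
Qed.

Lemma expR_quotient_ge n x : x <= expR_quotient n x.
Proof.
rewrite /expR_quotient mulrC -ler_pdivrMr ?ltr0n//.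
by rewrite lerBrDl expR_ge1Dx.
Qed.

Lemma expR_quotient_le n x : expR_quotient n x <= x * expR (x / n.+1%:R).
Proof.
have := expR_sub1_le (x / n.+1%:R).
by rewrite mulrAC ler_pdivlMr ?ltr0n// mulrC.
Qed.

Lemma expR_quotient_cvg x : expR_quotient n x @[n --> \oo] --> x.
Proof.
apply: (@squeeze_cvgr _ _ _ _ (fun=> x) (fun n => x * expR (x / n.+1%:R))).
- by near=> n; rewrite expR_quotient_ge expR_quotient_le.
- exact: cvg_cst.
- have -> : nbhs x = nbhs (x * expR (x * 0)) by rewrite mulr0 expR0 mulr1.
  apply: cvgM; first exact: cvg_cst.
  apply: (cvg_comp _ expR); last exact: continuous_expR.
  apply: cvgM; first exact: cvg_cst.
  exact: cvg_harmonic.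
Unshelve. all: by end_near. Qed.

Lemma expR_quotient_norm n x : `|expR_quotient n x| <= `|x| * expR `|x|.
Proof.
have h1 := expR_quotient_ge n x; have h2 := expR_quotient_le n x.
have e1 : 1 <= expR `|x| by rewrite -expR0 ler_expR normr_ge0.
have [x0|x0] := leP 0 x.
  rewrite ger0_norm ?(le_trans x0)// (le_trans h2)// ger0_norm//.
  rewrite ler_wpM2l// ler_expR ler_pdivrMr ?ltr0n// ler_peMr//.
  by rewrite ler1n.
have : expR_quotient n x <= 0.
  apply: le_trans h2 _; rewrite mulr_le0_ge0 ?expR_ge0//; exact: ltW.
move=> h3; rewrite ler0_norm// (ltr0_norm x0).
by rewrite (@le_trans _ _ (- x))// ?lerN2// ler_peMr ?oppr_ge0 ?(ltW x0)// -(ltr0_norm x0).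
Qed.

End exp_difference_quotient.

Section expectation.
Context (R : realType) (d : measure_display) (T : measurableType d)
  (P : probability T R).
Implicit Types (F G : T -> R).

Definition Lone F := P.-integrable [set: T] (EFin \o F).
Definition Ex F : R := \int[P]_w F w.

Lemma Lone_dom F G : measurable_fun setT F -> (forall w, `|F w| <= G w) ->
  Lone G -> Lone F.
Proof.
move=> mF FG iG; apply: (le_integrable _ _ _ iG) => //; first exact/measurable_EFinP.
by move=> w _ /=; rewrite lee_fin (le_trans (FG w))// ler_norm.
Qed.

Lemma Lone_cst c : Lone (fun=> c).
Proof. by apply: finite_measure_integrable_cst. Qed.

Lemma Lone_bounded F c : measurable_fun setT F -> (forall w, `|F w| <= c) -> Lone F.
Proof. by move=> mF Fc; apply: (Lone_dom mF Fc); exact: Lone_cst. Qed.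

Lemma LoneD F G : Lone F -> Lone G -> Lone (fun w => F w + G w).
Proof. by move=> iF iG; have := integrableD measurableT iF iG. Qed.

Lemma LoneB F G : Lone F -> Lone G -> Lone (fun w => F w - G w).
Proof. by move=> iF iG; have := integrableB measurableT iF iG. Qed.

Lemma LoneZ c F : Lone F -> Lone (fun w => c * F w).
Proof. by move=> iF; have := integrableZl measurableT c iF. Qed.

Lemma ExD F G : Lone F -> Lone G -> Ex (fun w => F w + G w) = Ex F + Ex G.
Proof. by move=> iF iG; rewrite /Ex RintegralD. Qed.

Lemma ExB F G : Lone F -> Lone G -> Ex (fun w => F w - G w) = Ex F - Ex G.
Proof. by move=> iF iG; rewrite /Ex RintegralB. Qed.

Lemma ExZ c F : Lone F -> Ex (fun w => c * F w) = c * Ex F.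
Proof. by move=> iF; rewrite /Ex RintegralZl. Qed.

Lemma Ex_le F G : Lone F -> Lone G -> (forall w, F w <= G w) -> Ex F <= Ex G.
Proof. by move=> iF iG FG; apply: le_Rintegral. Qed.

Lemma Ex_ge0 F : (forall w, 0 <= F w) -> 0 <= Ex F.
Proof. by move=> F0; apply: Rintegral_ge0. Qed.

Lemma EFin_Ex F : Lone F -> (\int[P]_w (F w)%:E = (Ex F)%:E)%E.
Proof. by move=> iF; rewrite /Ex /Rintegral fineK//; exact: integrable_fin_num. Qed.

Lemma Ex_cst c : Ex (fun=> c) = c.
Proof.
rewrite /Ex Rintegral_cst; last exact: measurableT.
by rewrite [X in _ * fine X](@probability_setT _ _ _ P) mulr1.
Qed.

Lemma Lone_ge0 F c : measurable_fun setT F -> (forall w, 0 <= F w) ->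
  (\int[P]_w (F w)%:E = c%:E)%E -> Lone F /\ Ex F = c.
Proof.
move=> mF F0 Fc; split; last by rewrite /Ex /Rintegral Fc.
apply/integrableP; split; first exact/measurable_EFinP.
by under eq_integral do rewrite /= ger0_norm//; rewrite Fc ltry.
Qed.

Lemma Ex_dct (F_ : nat -> T -> R) F G : (forall n, measurable_fun setT (F_ n)) ->
  (forall w, F_ n w @[n --> \oo] --> F w) ->
  (forall n w, `|F_ n w| <= G w) -> Lone G ->
  Lone F /\ Ex (F_ n) @[n --> \oo] --> Ex F.
Proof.
move=> mF_ F_F F_G iG.
have mF : measurable_fun setT F.
  by apply: (@measurable_fun_cvg _ _ _ _ F_) => // w _; exact: F_F.
have [|||||iF _ cvgF] := @dominated_convergence _ _ _ P setT measurableT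
  (fun n => EFin \o F_ n) (EFin \o F) (EFin \o G).
- by move=> n; exact/measurable_EFinP.
- exact/measurable_EFinP.
- by apply: aeW => w _; apply/cvg_EFin; [near=> n|exact: F_F].
- exact: iG.
- by apply: aeW => w n _; rewrite lee_fin.
split; first exact: iF.
have : (fun n => \int[P]_w (F_ n w)%:E)%E n @[n --> \oo] --> (Ex F)%:E.
  by rewrite -EFin_Ex.
by move/fine_cvgP => [_].
Unshelve. all: by end_near. Qed.

Lemma continuous_comp_measurable (phi : R -> R) F : continuous phi ->
  measurable_fun setT F -> measurable_fun setT (fun w => phi (F w)).
Proof.
by move=> cphi mF; exact: (measurableT_comp (continuous_measurable_fun cphi) mF).
Qed.

End expectation.

Section gaussian_moments.
Context (R : realType) (d : measure_display) (T : measurableType d)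
  (P : probability T R).
Implicit Types (X Y : T -> R) (s t p q : R).

Local Notation Lone := (@Lone R d T P).
Local Notation Ex := (@Ex R d T P).
Local Notation centered_gaussian := (@centered_gaussian R d T P).

Lemma measurable_exp t X : measurable_fun setT X ->
  measurable_fun setT (fun w => expR (t * X w)).
Proof. by move=> mX; apply: (measurableT_comp (measurable_expRM t) mX). Qed.

Lemma measurable_norm X : measurable_fun setT X ->
  measurable_fun setT (fun w => `|X w|).
Proof. by move=> mX; apply: (continuous_comp_measurable _ mX) => x; exact: norm_continuous. Qed.

Lemma measurable_window X c : measurable_fun setT X ->
  measurable [set w | `|X w - c| <= 1].
Proof.
move=> mX; rewrite -[X in measurable X]setTI.
rewrite (_ : [set w | _] = (fun w => `|X w - c|) @^-1` `]-oo, 1]); last first.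
  by apply/seteqP; split => w /=; rewrite in_itv.
exact: (measurable_norm (measurable_funB mX (measurable_cst c))).
Qed.

Lemma gaussian_law_exp X m s t : has_gaussian_law P X m s ->
  Lone (fun w => expR (t * X w)) /\
  Ex (fun w => expR (t * X w)) = expR (t * m + t ^+ 2 * s ^+ 2 / 2).
Proof.
move=> GX; have [mX _ _] := GX; apply: Lone_ge0.
- exact: measurable_exp.
- by move=> w; exact: expR_ge0.
- exact: gaussian_mgf.
Qed.

Lemma gaussian_exp X s t : centered_gaussian X s ->
  Lone (fun w => expR (t * X w)) /\
  Ex (fun w => expR (t * X w)) = expR (t ^+ 2 * s ^+ 2 / 2).
Proof. by move=> /(gaussian_law_exp t); rewrite mulr0 add0r. Qed.

(** From e^(t|x|) <= e^(tx) + e^(-tx). This supplies the dominating functions for the limits that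
    follow. *)
Lemma gaussian_law_exp_norm X m s t : has_gaussian_law P X m s ->
  Lone (fun w => expR (t * `|X w|)).
Proof.
move=> GX; have [mX _ _] := GX.
have [i1 _] := gaussian_law_exp t GX; have [i2 _] := gaussian_law_exp (- t) GX.
apply: (Lone_dom _ _ (LoneD i1 i2)).
  by apply: measurable_exp; exact: measurable_norm.
move=> w; rewrite ger0_norm ?expR_ge0//.
by case: (ler0P (X w)) => _; rewrite ?mulrN ?mulNr ?lerDl ?lerDr expR_ge0.
Qed.

Lemma gaussian_exp_norm X s t : centered_gaussian X s ->
  Lone (fun w => expR (t * `|X w|)).
Proof. exact: gaussian_law_exp_norm. Qed.

Lemma norm_le_exp (x : R) : `|x| <= expR `|x|.
Proof. by have := expR_ge1Dx `|x|; lra. Qed.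

Lemma gaussian_law_Lone X m s : has_gaussian_law P X m s -> Lone X.
Proof.
move=> GX; have [mX _ _] := GX.
apply: (Lone_dom mX _ (gaussian_law_exp_norm 1 GX)) => w.
by rewrite mul1r norm_le_exp.
Qed.

(** The derivative of the Laplace transform at 0: the expectation of the quotient of [X] is again a
    quotient, taken at a point [y n] that tends to [m]. *)
Lemma gaussian_mean X m s : has_gaussian_law P X m s -> Ex X = m.
Proof.
move=> GX; have [mX _ _] := GX.
pose F n w := expR_quotient n (X w).
have FE n : F n = (fun w => n.+1%:R * expR (n.+1%:R^-1 * X w) - n.+1%:R).
  by apply/funext => w; rewrite /F /expR_quotient mulrBr mulr1 (mulrC (X w)).
have mF n : measurable_fun setT (F n).
  rewrite FE; apply: measurable_funB => //; apply: measurable_funM => //.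
  exact: measurable_exp.
have FX w : F n w @[n --> \oo] --> X w by exact: expR_quotient_cvg.
have FG n w : `|F n w| <= expR (2 * `|X w|).
  apply: le_trans (expR_quotient_norm _ _) _.
  have -> : 2 * `|X w| = `|X w| + `|X w| by ring.
  by rewrite expRD ler_wpM2r ?expR_ge0// norm_le_exp.
have [_ cF] := Ex_dct mF FX FG (gaussian_law_exp_norm 2 GX).
pose y n : R := m + s ^+ 2 / 2 / n.+1%:R.
have exF n : Ex (F n) = expR_quotient n (y n).
  have [i1 e1] := gaussian_law_exp n.+1%:R^-1 GX.
  rewrite FE (ExB (LoneZ _ i1) (Lone_cst _ _)) (ExZ _ i1) Ex_cst e1.
  rewrite /expR_quotient mulrBr mulr1; congr (_ * expR _ - _).
  rewrite /y; have : n.+1%:R != 0 :> R by rewrite pnatr_eq0.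
  by move: (n.+1%:R : R) => k k0; field.
have cy : y n @[n --> \oo] --> m.
  have -> : nbhs m = nbhs (m + s ^+ 2 / 2 * 0) by rewrite mulr0 addr0.
  apply: cvgD; first exact: cvg_cst.
  by apply: cvgM; [exact: cvg_cst|exact: cvg_harmonic].
have cF' : Ex (F n) @[n --> \oo] --> m.
  rewrite (_ : (fun n => Ex (F n)) = (fun n => expR_quotient n (y n))); last exact/funext.
  apply: (@squeeze_cvgr _ _ _ _ y (fun n => y n * expR (y n / n.+1%:R))) => //.
    by near=> n; rewrite expR_quotient_ge expR_quotient_le.
  have -> : nbhs m = nbhs (m * expR (m * 0)) by rewrite mulr0 expR0 mulr1.
  apply: cvgM => //; apply: (cvg_comp _ expR); last exact: continuous_expR.
  by apply: cvgM => //; exact: cvg_harmonic.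
exact: (cvg_unique _ cF cF').
Unshelve. all: by end_near. Qed.

Lemma gaussian_sqr X s : centered_gaussian X s -> Ex (fun w => X w ^+ 2) = s ^+ 2.
Proof.
move=> GX; have [mX _ _] := GX.
(* A symmetric difference at half step: its square involves only the exponentials of X/(n+1) and
   -X/(n+1) and a constant. *)
pose D n w := expR_quotient n (X w / 2) - expR_quotient n (- (X w / 2)).
pose F n w := D n w ^+ 2.
have FE n w : F n w = n.+1%:R ^+ 2 * (expR (n.+1%:R^-1 * X w)
    + expR ((- n.+1%:R^-1) * X w)) - 2 * n.+1%:R ^+ 2.
  rewrite /F /D /expR_quotient.
  have : n.+1%:R != 0 :> R by rewrite pnatr_eq0.
  move: (n.+1%:R : R) => m m0.
  have -> : m^-1 * X w = X w / 2 / m + X w / 2 / m by field.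
  have -> : (- m^-1) * X w = (- (X w / 2)) / m + (- (X w / 2)) / m by field.
  rewrite !expRD mulNr expRN.
  have := expR_gt0 (X w / 2 / m).
  move: (expR (X w / 2 / m)) => e e0.
  by field; rewrite gt_eqF.
have mF n : measurable_fun setT (F n).
  rewrite (_ : F n = (fun w => n.+1%:R ^+ 2 * (expR (n.+1%:R^-1 * X w)
    + expR ((- n.+1%:R^-1) * X w)) - 2 * n.+1%:R ^+ 2)); last exact/funext.
  apply: measurable_funB => //; apply: measurable_funM => //.
  by apply: measurable_funD; exact: measurable_exp.
have FX w : F n w @[n --> \oo] --> X w ^+ 2.
  have -> : X w ^+ 2 = (X w / 2 - (- (X w / 2))) * (X w / 2 - (- (X w / 2))).
    by field.
  rewrite /F /D; under eq_fun do rewrite expr2.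
  by apply: cvgM; apply: cvgB; exact: expR_quotient_cvg.
have FG n w : `|F n w| <= 4 * expR (2 * `|X w|).
  rewrite normrX.
  have q1 (y : R) : `|expR_quotient n y| <= expR (2 * `|y|).
    apply: le_trans (expR_quotient_norm _ _) _.
    have -> : 2 * `|y| = `|y| + `|y| by ring.
    by rewrite expRD ler_wpM2r ?expR_ge0// norm_le_exp.
  have nD : `|D n w| <= 2 * expR `|X w|.
    apply: le_trans (ler_normB _ _) _.
    have := q1 (X w / 2); have := q1 (- (X w / 2)).
    have -> : 2 * `|- (X w / 2)| = `|X w|.
      by rewrite normrN normrM (@ger0_norm _ 2^-1) ?invr_ge0//; field.
    have -> : 2 * `|X w / 2| = `|X w|.
      by rewrite normrM (@ger0_norm _ 2^-1) ?invr_ge0//; field.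
    by move=> h1 h2; rewrite mulrDl mul1r lerD.
  have -> : 4 * expR (2 * `|X w|) = (2 * expR `|X w|) ^+ 2.
    have -> : 2 * `|X w| = `|X w| + `|X w| by ring.
    by rewrite expRD; ring.
  by rewrite lerXn2r// nnegrE ?mulr_ge0 ?expR_ge0.
have [_ cF] := Ex_dct mF FX FG (LoneZ 4 (gaussian_exp_norm 2 GX)).
(* The Laplace transforms produce a quotient of step (n+1)^-2, whose index is n(n+2) because n(n+2)
   + 1 = (n+1)^2. *)
have exF n : Ex (F n) = 2 * expR_quotient (n * n.+2) (s ^+ 2 / 2).
  have -> : F n = (fun w => n.+1%:R ^+ 2 * (expR (n.+1%:R^-1 * X w)
    + expR ((- n.+1%:R^-1) * X w)) - 2 * n.+1%:R ^+ 2) by exact/funext.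
  have [i1 e1] := gaussian_exp n.+1%:R^-1 GX.
  have [i2 e2] := gaussian_exp (- n.+1%:R^-1) GX.
  have iE := LoneD i1 i2.
  rewrite (ExB (LoneZ _ iE) (Lone_cst _ _)) (ExZ _ iE) (ExD i1 i2) Ex_cst.
  rewrite e1 e2 sqrrN /expR_quotient.
  have -> : ((n * n.+2).+1%:R : R) = n.+1%:R ^+ 2.
    by rewrite -natrX; congr (_%:R); rewrite -mulnn; lia.
  have -> : n.+1%:R^-1 ^+ 2 * s ^+ 2 / 2 = s ^+ 2 / 2 / n.+1%:R ^+ 2.
    have : n.+1%:R != 0 :> R by rewrite pnatr_eq0.
    by move: (n.+1%:R : R) => m m0; field.
  by ring.
have : Ex (F n) @[n --> \oo] --> 2 * (s ^+ 2 / 2).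
  under eq_fun do rewrite exF.
  apply: cvgM; first exact: cvg_cst.
  apply: (cvg_comp (fun n => (n * n.+2)%N) (fun n => expR_quotient n (s ^+ 2 / 2))).
    apply/cvgnyPge => A; near=> n.
    rewrite (@leq_trans n)//; first by near: n; exact: nbhs_infty_ge.
    by rewrite leq_pmulr.
  exact: expR_quotient_cvg.
move=> cF'; rewrite mulrCA divff// mulr1 in cF'.
exact: (cvg_unique _ cF cF').
Unshelve. all: by end_near. Qed.

End gaussian_moments.

(** * Weights that factorise against uncorrelated variables *)

Section exponential_annihilator.
Context (R : realType) (d : measure_display) (T : measurableType d)
  (P : probability T R).
Implicit Types (A u v : T -> R) (p q c : R).

Local Notation Lone := (@Lone R d T P).
Local Notation Ex := (@Ex R d T P).

(* The Laplace transform form of [E(u | A) = 0]: it is preserved when [u] is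
   multiplied by an entire function of [A], which replaces conditioning on [A]. *)
Definition exp_null A u :=
  [/\ measurable_fun setT A, measurable_fun setT u,
      forall p, Lone (fun w => u w * expR (p * `|A w|)) &
      forall p, Ex (fun w => u w * expR (p * A w)) = 0].

Lemma Lone_norm u : Lone u -> Lone (fun w => `|u w|).
Proof. by move=> iu; have := integrable_norm iu. Qed.

Lemma exp_null_dom A u v q : exp_null A u -> measurable_fun setT v ->
  (forall w, `|v w| <= `|u w| * expR (q * `|A w|)) -> Lone v.
Proof.
move=> [_ _ iu _] mv vu; apply: (Lone_dom mv _ (Lone_norm (iu q))) => w.
by rewrite normrM (@ger0_norm _ (expR _)) ?expR_ge0.
Qed.

Lemma measurable_mulexp A u p : measurable_fun setT A -> measurable_fun setT u ->
  measurable_fun setT (fun w => u w * expR (p * A w)).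
Proof. by move=> mA mu; apply: measurable_funM => //; exact: measurable_exp. Qed.

Lemma exp_null_Lone A u p : exp_null A u -> Lone (fun w => u w * expR (p * A w)).
Proof.
move=> nu; have [mA mu _ _] := nu.
apply: (exp_null_dom (q := `|p|) nu) => [|w]; first exact: measurable_mulexp.
rewrite normrM (@ger0_norm _ (expR _)) ?expR_ge0//.
rewrite ler_wpM2l// ler_expR -normrM; exact: ler_norm.
Qed.

Lemma exp_null_ext A u v : u = v -> exp_null A u -> exp_null A v.
Proof. by move=> ->. Qed.

Lemma exp_nullD A u v : exp_null A u -> exp_null A v ->
  exp_null A (fun w => u w + v w).
Proof.
move=> nu nv; have [mA mu iu eu] := nu; have [_ mv iv ev] := nv; split => //.
- exact: measurable_funD.
- move=> p; rewrite (_ : (fun w => _) = (fun w => u w * expR (p * `|A w|)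
    + v w * expR (p * `|A w|))); first exact: LoneD.
  by apply/funext => w; rewrite mulrDl.
- move=> p; rewrite (_ : (fun w => _) = (fun w => u w * expR (p * A w)
    + v w * expR (p * A w))).
    by rewrite ExD ?eu ?ev ?addr0//; exact: exp_null_Lone.
  by apply/funext => w; rewrite mulrDl.
Qed.

Lemma exp_nullZ A u c : exp_null A u -> exp_null A (fun w => c * u w).
Proof.
move=> nu; have [mA mu iu eu] := nu; split => //.
- exact: measurable_funM.
- move=> p; rewrite (_ : (fun w => _) = (fun w => c * (u w * expR (p * `|A w|)))).
    exact: LoneZ.
  by apply/funext => w; rewrite mulrA.
- move=> p; rewrite (_ : (fun w => _) = (fun w => c * (u w * expR (p * A w)))).
    by rewrite ExZ ?eu ?mulr0//; exact: exp_null_Lone.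
  by apply/funext => w; rewrite mulrA.
Qed.

(* Differentiation in [p] of [E (u * exp (p A)) = 0]. *)
Lemma exp_nullM A u : exp_null A u -> exp_null A (fun w => u w * A w).
Proof.
move=> nu; have [mA mu iu eu] := nu.
have mnA := measurable_norm mA.
split => //; first exact: measurable_funM.
- move=> p; apply: (exp_null_dom (q := p + 1) nu) => [|w].
    apply: measurable_mulexp => //; exact: measurable_funM.
  rewrite !normrM (@ger0_norm _ (expR _)) ?expR_ge0// -mulrA ler_wpM2l//.
  by rewrite mulrDl mul1r expRD mulrC ler_wpM2l ?expR_ge0// norm_le_exp.
- move=> p.
  pose F n w := u w * expR (p * A w) * expR_quotient n (A w).
  have mq n : measurable_fun setT (fun w => expR_quotient n (A w)).
    apply: measurable_funM => //; apply: measurable_funB => //.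
    rewrite (_ : (fun w => _) = (fun w => expR (n.+1%:R^-1 * A w))).
      exact: measurable_exp.
    by apply/funext => w; rewrite mulrC.
  have mF n : measurable_fun setT (F n).
    by apply: measurable_funM => //; exact: measurable_mulexp.
  have FF w : F n w @[n --> \oo] --> u w * expR (p * A w) * A w.
    by apply: cvgM; [exact: cvg_cst|exact: expR_quotient_cvg].
  (* The 2 pays once for |A| <= e^|A| and once for the factor e^|A| in the bound on the quotient. *)
  have FG n w : `|F n w| <= `|u w * expR ((`|p| + 2) * `|A w|)|.
    have -> : `|F n w| = `|u w| * (expR (p * A w) * `|expR_quotient n (A w)|).
      by rewrite mulrA /F 2![in LHS]normrM (@ger0_norm _ (expR _)) ?expR_ge0.
    rewrite [leRHS]normrM ler_wpM2l// (@ger0_norm _ (expR _)) ?expR_ge0//.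
    rewrite mulrDl expRD ler_pM ?expR_ge0//.
      by rewrite ler_expR -normrM ler_norm.
    apply: (le_trans (expR_quotient_norm _ _)).
    have -> : 2 * `|A w| = `|A w| + `|A w| by ring.
    by rewrite expRD ler_wpM2r ?expR_ge0// norm_le_exp.
  have [_ cF] := Ex_dct mF FF FG (Lone_norm (iu (`|p| + 2))).
  have F0 n : Ex (F n) = 0.
    rewrite (_ : F n = (fun w => n.+1%:R * (u w * expR ((p + n.+1%:R^-1) * A w))
      - n.+1%:R * (u w * expR (p * A w)))).
      rewrite ExB ?ExZ ?eu ?mulr0 ?subr0//; try exact: exp_null_Lone.
      + by apply: LoneZ; exact: exp_null_Lone.
      + by apply: LoneZ; exact: exp_null_Lone.
    apply/funext => w; rewrite /F /expR_quotient mulrDl expRD (mulrC (A w)).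
    by move: (n.+1%:R : R) => m; ring.
  rewrite (_ : (fun w => _) = (fun w => u w * expR (p * A w) * A w)); last first.
    by apply/funext => w; rewrite mulrAC.
  have cF0 : Ex (F n) @[n --> \oo] --> (0 : R).
    by rewrite (_ : (fun n => Ex (F n)) = fun=> 0); [exact: cvg_cst|exact/funext].
  exact: (cvg_unique _ cF cF0).
Qed.

Lemma exp_null_poly A u (f : {poly R}) : exp_null A u ->
  exp_null A (fun w => u w * f.[A w]).
Proof.
move=> nu; elim/poly_ind: f => [|f c IH].
  apply: (exp_null_ext _ (exp_nullZ 0 nu)).
  by apply/funext => w; rewrite horner0 mulr0 mul0r.
apply: (exp_null_ext _ (exp_nullD (exp_nullM IH) (exp_nullZ c nu))).
by apply/funext => w; rewrite hornerMXaddC; ring.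
Qed.

(** The bound [expR |x|] on the approximants is absorbed by raising the rate [p] by 1, so dominated
    convergence applies thanks to the integrability clause of [exp_null], which holds for every
    rate. *)
Lemma exp_null_lim A u (f : nat -> {poly R}) (h : R -> R) :
  (forall N x, `|(f N).[x]| <= expR `|x|) ->
  (forall x, (f N).[x] @[N --> \oo] --> h x) ->
  exp_null A u -> exp_null A (fun w => u w * h (A w)).
Proof.
move=> fb fh nu; have [mA mu iu eu] := nu.
have mnA := measurable_norm mA.
have mf N : measurable_fun setT (fun w => (f N).[A w]).
  by apply: continuous_comp_measurable => // x; exact: continuous_horner.
have hb x : `|h x| <= expR `|x|.
  have /cvg_norm c1 := fh x.
  by apply: (cvgr_to_le c1); near=> N; exact: fb.
have mhA : measurable_fun setT (fun w => h (A w)).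
  by apply: (@measurable_fun_cvg _ _ _ _ (fun N w => (f N).[A w])) => // w _; exact: fh.
split => //; first exact: measurable_funM.
- move=> p; apply: (exp_null_dom (q := p + 1) nu) => [|w].
    by apply: measurable_mulexp => //; exact: measurable_funM.
  rewrite !normrM (@ger0_norm _ (expR _)) ?expR_ge0// -mulrA ler_wpM2l//.
  by rewrite mulrDl mul1r expRD mulrC ler_wpM2l ?expR_ge0.
- move=> p.
  pose F n w := u w * (f n).[A w] * expR (p * A w).
  have nF n : exp_null A (fun w => u w * (f n).[A w]) by exact: exp_null_poly.
  have mF n : measurable_fun setT (F n).
    by apply: measurable_mulexp => //; exact: measurable_funM.
  have FF w : F n w @[n --> \oo] --> u w * h (A w) * expR (p * A w).
    apply: cvgM; last exact: cvg_cst.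
    by apply: cvgM; [exact: cvg_cst|exact: fh].
  have FG n w : `|F n w| <= `|u w * expR ((`|p| + 1) * `|A w|)|.
    rewrite /F !normrM -mulrA ler_wpM2l// !(@ger0_norm _ (expR _)) ?expR_ge0//.
    rewrite mulrDl mul1r expRD mulrC ler_pM ?expR_ge0//.
    by rewrite ler_expR -normrM ler_norm.
  have [_ cF] := Ex_dct mF FF FG (Lone_norm (iu (`|p| + 1))).
  have F0 n : Ex (F n) = 0 by have [_ _ _] := nF n; exact.
  have cF0 : Ex (F n) @[n --> \oo] --> (0 : R).
    by rewrite (_ : (fun n => Ex (F n)) = fun=> 0); [exact: cvg_cst|exact/funext].
  exact: (cvg_unique _ cF cF0).
Unshelve. all: by end_near. Qed.

Lemma exp_null_affine A u p c : exp_null A u -> exp_null (fun w => p * (A w - c)) u.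
Proof.
move=> nu; have [mA mu iu eu] := nu.
have mA' : measurable_fun setT (fun w => p * (A w - c)).
  by apply: measurable_funM => //; exact: measurable_funB.
split => //.
- move=> q.
  (* A constant factor is split off to pay for the shift by [c]; what remains is dominated at rate
     [|q * p|]. *)
  rewrite (_ : (fun w => _) = (fun w => expR (`|q * p| * `|c|) *
    (expR (- (`|q * p| * `|c|)) * (u w * expR (q * `|p * (A w - c)|))))); last first.
    by apply/funext => w; rewrite mulrA -expRD subrr expR0 mul1r.
  apply: LoneZ; apply: (exp_null_dom (q := `|q * p|) nu) => [|w].
    apply: measurable_funM => //; apply: measurable_mulexp => //.
    exact: measurable_norm.
  rewrite !normrM !(@ger0_norm _ (expR _)) ?expR_ge0// mulrCA ler_wpM2l//.
  rewrite -expRD ler_expR addrC lerBlDl -!normrM.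
  apply: (@le_trans _ _ (`|q| * (`|p| * (`|c| + `|A w|)))); last first.
    by rewrite mulrDr mulrDr !normrM !mulrA.
  apply: (@le_trans _ _ (`|q| * `|p * (A w - c)|)).
    by rewrite ler_wpM2r// ler_norm.
  by rewrite normrM !ler_wpM2l// [leRHS]addrC ler_normB.
- move=> q.
  rewrite (_ : (fun w => _) = (fun w => expR (- (q * p * c)) * (u w * expR (q * p * A w)))).
    by rewrite ExZ ?eu ?mulr0//; exact: exp_null_Lone.
  apply/funext => w; rewrite [RHS]mulrCA -expRD; congr (_ * expR _); ring.
Qed.

End exponential_annihilator.

Section sinc.
Variable R : realType.
Implicit Types x : R.

Definition sinc x : R := if x == 0 then 1 else sin x / x.

Lemma sinc_mulx x : x * sinc x = sin x.
Proof.
rewrite /sinc; have [->|x0] := eqVneq x 0; first by rewrite mul0r sin0.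
by rewrite mulrC divfK.
Qed.

Lemma norm_sinc_le1 x : `|sinc x| <= 1.
Proof.
rewrite /sinc; have [_|x0] := eqVneq x 0; first by rewrite normr1.
have pos (y : R) : 0 < y -> `|sin y / y| <= 1.
  move=> y0; have [|c _] := @MVT R (@sin R) (@cos R) 0 y y0.
    by apply: continuous_subspaceT => z; exact: continuous_sin.
  rewrite sin0 !subr0 => ->; rewrite mulfK ?gt_eqF//; exact: cos_max.
have [x_lt0|x_gt0] := ltP x 0; last by apply: pos; rewrite lt_neqAle eq_sym x0.
have := pos (- x); rewrite sinN invrN mulrNN; apply.
by rewrite oppr_gt0.
Qed.

Definition sinc_poly (N : nat) : {poly R} :=
  \sum_(k < N) ((-1) ^+ k / k.*2.+1`!%:R) *: 'X^(k.*2).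

Lemma horner_sinc_poly N x :
  (sinc_poly N).[x] = \sum_(k < N) (-1) ^+ k / k.*2.+1`!%:R * x ^+ k.*2.
Proof.
rewrite /sinc_poly horner_sum; apply: eq_bigr => k _.
by rewrite hornerZ hornerXn.
Qed.

Lemma sinc_poly_cvg x : (sinc_poly N).[x] @[N --> \oo] --> sinc x.
Proof.
rewrite /sinc; have [->|x0] := eqVneq x 0.
  rewrite -(@cvg_shiftS _ (fun N => (sinc_poly N).[0])) /=.
  rewrite (_ : (fun n => _) = fun=> 1); first exact: cvg_cst.
  apply/funext => N; rewrite horner_sinc_poly big_ord_recl /= expr0 mulr1 divr1.
  by rewrite big1 ?addr0// => k _; rewrite doubleS expr0n/= mulr0.
rewrite (_ : (fun N => _) = (fun N => series (sin_coeff' x) N / x)).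
  by apply: cvgM; [exact: cvg_sin_coeff'|exact: cvg_cst].
apply/funext => N; rewrite horner_sinc_poly /series/= big_mkord mulr_suml.
apply: eq_bigr => k _.
have -> : sin_coeff' x k = (-1 : R) ^+ k * x ^+ k.*2.+1 / k.*2.+1`!%:R by [].
rewrite exprS.
have : k.*2.+1`!%:R != 0 :> R by rewrite pnatr_eq0 -lt0n fact_gt0.
move: (k.*2.+1`!%:R : R) (x ^+ k.*2) ((-1 : R) ^+ k) => F y a F0.
by field; rewrite F0 x0.
Qed.

(** Termwise: since (2k)! <= (2k+1)!, each term is at most the even term of degree 2k in the series
    of [expR |x|]. *)
Lemma norm_sinc_poly_le N x : `|(sinc_poly N).[x]| <= expR `|x|.
Proof.
have h : `|(sinc_poly N).[x]| <= \sum_(0 <= k < N.*2) `|x| ^+ k / k`!%:R.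
  rewrite horner_sinc_poly; elim: N => [|N IH]; first by rewrite big_ord0 normr0 big_geq.
  rewrite big_ord_recr/= doubleS !big_nat_recr//= -addrA.
  apply: (le_trans (ler_normD _ _)); rewrite lerD//.
  rewrite normrM normrX.
  rewrite normrM normrX normrN1 expr1n mul1r ger0_norm ?invr_ge0// mulrC.
  apply: (@le_trans _ _ (`|x| ^+ N.*2 / N.*2`!%:R)); last first.
    by rewrite lerDl divr_ge0// exprn_ge0.
  rewrite ler_wpM2l ?exprn_ge0// lef_pV2 ?posrE ?ltr0n ?fact_gt0// ler_nat.
  by rewrite factS leq_pmull.
apply: (le_trans h).
have -> : expR `|x| = limn (series (exp_coeff `|x|)) by [].
apply: (@nondecreasing_cvgn_le R (series (exp_coeff `|x|))).
- by apply: nondecreasing_series => k _ _; rewrite /exp_coeff/= divr_ge0// exprn_ge0.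
- exact: is_cvg_series_exp_coeff.
Qed.

(** Since (2k+1)! >= 4^k, the terms after the first sum to at most 1/3 in absolute value, which
    leaves 2/3. The induction carries the remaining geometric tail 4^(-N)/3 explicitly. *)
Lemma sinc_ge x : `|x| <= 1 -> 1 / 2 <= sinc x.
Proof.
move=> x1.
have fact4 k : (4 ^ k <= k.*2.+1`!)%N.
  elim: k => [//|k IH]; rewrite expnS doubleS !factS mulnA leq_mul//.
  by rewrite (@leq_trans (2 * 2)%N)// leq_mul.
have h N : 2 / 3 + 1 / 3 * (4^-1) ^+ N <= (sinc_poly N.+1).[x].
  elim: N => [|N IH].
    rewrite horner_sinc_poly big_ord_recr big_ord0/= !expr0 add0r divr1 !mulr1.
    by lra.
  rewrite horner_sinc_poly big_ord_recr/= -horner_sinc_poly.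
  set t := _ * x ^+ _.
  have : `|t| <= (4^-1) ^+ N.+1.
    rewrite /t normrM normrX normrM normrX normrN1 expr1n mul1r.
    rewrite ger0_norm ?invr_ge0// -[leRHS]mulr1 ler_pM ?invr_ge0 ?exprn_ge0//.
      rewrite exprVn lef_pV2 ?posrE ?exprn_gt0 ?ltr0n ?fact_gt0// -natrX ler_nat.
      exact: fact4.
    by rewrite exprn_ile1.
  rewrite exprS ler_norml => /andP[+ _].
  by move: IH; set q := 4^-1 ^+ N; lra.
apply: (@le_trans _ _ (2 / 3)); first by lra.
have c := @sinc_poly_cvg x; rewrite -(@cvg_shiftS _ (fun N => (sinc_poly N).[x])) in c.
apply: (cvgr_to_ge c); near=> N; apply: le_trans (h N).
by rewrite lerDl mulr_ge0// ?divr_ge0// exprn_ge0// invr_ge0.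
Unshelve. all: by end_near. Qed.

(* An integrable approximate indicator of a neighbourhood of [0] which, unlike a
   compactly supported one, is a limit of polynomials dominated by [expR `|x|]. *)
Definition bump x : R := sinc x ^+ 2.

Lemma bump_ge0 x : 0 <= bump x. Proof. exact: sqr_ge0. Qed.

Lemma bump_le1 x : bump x <= 1.
Proof. by rewrite /bump -real_normK ?num_real// exprn_ile1// norm_sinc_le1. Qed.

Lemma bump_sqr_le1 x : x ^+ 2 * bump x <= 1.
Proof. by rewrite /bump -exprMn sinc_mulx -real_normK ?num_real// exprn_ile1// sin_max. Qed.

Lemma bump_ge x : `|x| <= 1 -> 1 / 4 <= bump x.
Proof.
move=> /sinc_ge h; have -> : 1 / 4 = (1 / 2) ^+ 2 :> R by field.
by rewrite /bump lerXn2r// nnegrE; lra.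
Qed.

(** The sum of the two preceding bounds. The Cauchy profile has an explicit integral at every scale,
    which bounds Gaussian expectations of the bump uniformly in its centre. *)
Lemma bump_le_cauchy x : bump x <= 2 / (1 + x ^+ 2).
Proof.
rewrite ler_pdivlMr ?(lt_le_trans ltr01) ?lerDl ?sqr_ge0//.
have := bump_le1 x; have := bump_sqr_le1 x.
by rewrite mulrDr mulr1 mulrC; lra.
Qed.

Lemma measurable_sinc : measurable_fun [set: R] sinc.
Proof.
apply: (@measurable_fun_cvg _ _ _ _ (fun N x => (sinc_poly N).[x])) => [N|x _].
  by apply: continuous_measurable_fun; exact: continuous_horner.
exact: sinc_poly_cvg.
Qed.

Lemma measurable_bump : measurable_fun [set: R] bump.
Proof. by apply: measurable_funX; exact: measurable_sinc. Qed.

End sinc.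

Section bump_annihilator.
Context (R : realType) (d : measure_display) (T : measurableType d)
  (P : probability T R).

(** Two rounds with [sinc] instead of one with its square: the squared Taylor polynomials would be
    controlled by [expR (2 * |x|)], more than [exp_null_lim] accepts. *)
Lemma exp_null_bump (A u : T -> R) : exp_null P A u ->
  exp_null P A (fun w => u w * bump (A w)).
Proof.
have step v : exp_null P A v -> exp_null P A (fun w => v w * sinc (A w)).
  by apply: (@exp_null_lim _ _ _ _ _ _ (@sinc_poly R));
    [exact: norm_sinc_poly_le|exact: sinc_poly_cvg].
move=> /step /step; apply: exp_null_ext; apply/funext => w.
by rewrite /bump expr2 mulrA.
Qed.

End bump_annihilator.

Section gaussian_bump.
Context (R : realType) (d : measure_display) (T : measurableType d)
  (P : probability T R).
Implicit Types (X : T -> R) (s c e : R).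
Local Notation mu := (@lebesgue_measure R).
Local Notation Lone := (@Lone R d T P).
Local Notation Ex := (@Ex R d T P).
Local Notation centered_gaussian := (@centered_gaussian R d T P).

Let sqrt_ge s : 0 < s -> s <= Num.sqrt (s ^+ 2 * pi *+ 2).
Proof.
move=> s0; rewrite -[leLHS](ger0_norm (ltW s0)) -sqrtr_sqr ler_wsqrtr//.
by rewrite -mulrnAr ler_peMr ?sqr_ge0//; have := pi_ge2 R; lra.
Qed.

Let sqrt_le s : 0 < s -> Num.sqrt (s ^+ 2 * pi *+ 2) <= 3 * s.
Proof.
move=> s0; have s3 : 0 <= 3 * s by rewrite mulr_ge0// ltW.
rewrite -[leRHS](ger0_norm s3) -sqrtr_sqr ler_wsqrtr//.
rewrite -mulrnAr exprMn mulrC ler_wpM2r ?sqr_ge0//.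
by have := pihalf_lt2 R; lra.
Qed.

Lemma normal_peak_le s : 0 < s -> normal_peak s <= s^-1.
Proof.
move=> s0; have h := sqrt_ge s0.
by rewrite /normal_peak lef_pV2 ?posrE// (lt_le_trans s0).
Qed.

Lemma normal_peak_ge s : 0 < s -> (3 * s)^-1 <= normal_peak s.
Proof.
move=> s0; have h := sqrt_le s0; have h' := sqrt_ge s0.
by rewrite /normal_peak lef_pV2 ?posrE ?mulr_gt0// (lt_le_trans s0).
Qed.

Lemma integral_cauchy e c : 0 < e ->
  (\int[mu]_x ((1 + (e^-1 * (x - c)) ^+ 2)^-1 * e^-1)%:E = pi%:E)%E.
Proof.
move=> e0; pose F (x : R^o) := (x - c) / e.
have F'E : F^`()%classic = cst e^-1.
  apply/funext => x; rewrite /F derive1E deriveM// deriveD// derive_cst scaler0.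
  by rewrite add0r derive_id derive_cst addr0 scaler1.
transitivity (\int[mu]_x ((((fun x : R => (oneDsqr x)^-1) \o F) * F^`()%classic) x)%:E)%E.
  by apply: eq_integral => x _; rewrite F'E !fctE /= /oneDsqr /F (mulrC (x - c)).
rewrite -increasing_ge0_integration_by_substitutionT.
- rewrite ge0_symfun_integralT/=.
  + rewrite (_ : [set x : R | _] = `[0, +oo[%classic); last first.
      by apply/seteqP; split => x/=; rewrite in_itv/= andbT.
    by rewrite integral0y_oneDsqr -EFinM mulrCA divff// mulr1.
  + by move=> x; rewrite invr_ge0.
  + exact: continuous_oneDsqrV.
  + by move=> x /=; rewrite /oneDsqr sqrrN.
- by move=> x y xy; rewrite /F ltr_pM2r ?invr_gt0// ltrD2r.
- by rewrite F'E => ?; exact: cvg_cst.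
- by rewrite F'E; exact: is_cvg_cst.
- by rewrite F'E; exact: is_cvg_cst.
- by [].
- by apply/gt0_cvgMlNy; [rewrite invr_gt0|exact: cvg_addrr_Ny].
- by apply/gt0_cvgMly; [rewrite invr_gt0|exact: cvg_addrr].
- exact: continuous_oneDsqrV.
- by move=> x; rewrite invr_ge0.
Qed.


Let scaled_bump_measurable e c k :
  measurable_fun [set: R] (fun x : R => bump (e^-1 * (x - c)) ^+ k).
Proof.
apply: measurable_funX; apply: (measurableT_comp (@measurable_bump R)).
by apply: measurable_funM => //; exact: measurable_funB.
Qed.

Lemma measurable_scaled_bump X e c k : measurable_fun setT X ->
  measurable_fun setT (fun w => bump (e^-1 * (X w - c)) ^+ k).
Proof. by move=> mX; apply: (measurableT_comp (scaled_bump_measurable e c k) mX). Qed.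

Lemma Lone_scaled_bump X e c k : measurable_fun setT X ->
  Lone (fun w => bump (e^-1 * (X w - c)) ^+ k).
Proof.
move=> mX; apply: (@Lone_bounded _ _ _ _ _ 1); first exact: measurable_scaled_bump.
move=> w; rewrite ger0_norm; last by rewrite exprn_ge0// bump_ge0.
by apply: exprn_ile1; [exact: bump_ge0|exact: bump_le1].
Qed.

(** The density is at most 1/s and the bump is below twice a Cauchy profile of width [e], hence 2 pi
    e / s with pi <= 4. *)
Lemma gaussian_bump_le X s c e : centered_gaussian X s -> 0 < s -> 0 < e ->
  Ex (fun w => bump (e^-1 * (X w - c))) <= 8 * e / s.
Proof.
move=> GX s0 e0; have [mX _ _] := GX.
have i1 := Lone_scaled_bump e c 1 mX.
rewrite -lee_fin -(EFin_Ex i1).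
have mb := scaled_bump_measurable e c 1.
have sn0 : s != 0 by rewrite gt_eqF.
rewrite (gaussian_ge0_integral GX sn0 mb); last by move=> x; exact: bump_ge0.
apply: (@le_trans _ _ (\int[mu]_x ((2 * e / s)%:E * ((1 + (e^-1 * (x - c)) ^+ 2)^-1 * e^-1)%:E))%E).
  apply: ge0_le_integral => //.
  - by move=> x _; rewrite lee_fin mulr_ge0 ?bump_ge0 ?normal_pdf_ge0.
  - apply/measurable_EFinP; apply: measurable_funM; first exact: mb.
    exact: measurable_normal_pdf.
  - apply/measurable_EFinP; apply: measurable_funM => //; apply: measurable_funM => //.
    apply: continuous_measurable_fun => x.
    apply: (@continuous_comp _ _ _ (fun x : R => e^-1 * (x - c)) (fun x => (oneDsqr x)^-1)).
      apply: continuous_comp; last exact: mulrl_continuous.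
      by apply: cvgB; [exact: cvg_id|exact: cvg_cst].
    exact: continuous_oneDsqrV.
  - move=> x _; rewrite -EFinM lee_fin.
    have -> : 2 * e / s * ((1 + (e^-1 * (x - c)) ^+ 2)^-1 / e)
      = 2 / (1 + (e^-1 * (x - c)) ^+ 2) * s^-1.
      by move: ((1 + _)^-1) => z; field; rewrite !gt_eqF.
    rewrite ler_pM ?bump_ge0 ?normal_pdf_ge0 ?bump_le_cauchy//.
    by rewrite (le_trans (normal_pdf_ub _ _ sn0))// normal_peak_le.
rewrite ge0_integralZl//.
- rewrite integral_cauchy// -EFinM lee_fin.
  have -> : 8 * e / s = 2 * e / s * 4 by ring.
  rewrite ler_wpM2l ?divr_ge0 ?mulr_ge0 ?ltW//.
  by have := pihalf_lt2 R; lra.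
- apply/measurable_EFinP; apply: measurable_funM => //.
  apply: continuous_measurable_fun => x.
  apply: (@continuous_comp _ _ _ (fun x : R => e^-1 * (x - c)) (fun x => (oneDsqr x)^-1)).
    apply: continuous_comp; last exact: mulrl_continuous.
    by apply: cvgB; [exact: cvg_id|exact: cvg_cst].
  exact: continuous_oneDsqrV.
- move=> x _; rewrite lee_fin mulr_ge0// ?invr_ge0 ?(ltW e0)//.
  by rewrite addr_ge0 ?sqr_ge0.
- by rewrite lee_fin divr_ge0 ?mulr_ge0 ?ltW.
Qed.

(** On the interval of length 2e around [c], the squared bump is at least 1/16 and the density at
    least (3s)^-1 times the exponential, because |x| <= |c| + 1 there. *)
Lemma gaussian_bump_ge X s c e : centered_gaussian X s -> 0 < s -> 0 < e <= 1 ->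
  e / (24 * s) * expR (- ((`|c| + 1) ^+ 2 / (2 * s ^+ 2))) <=
  Ex (fun w => bump (e^-1 * (X w - c)) ^+ 2).
Proof.
move=> GX s0 /andP[e0 e1]; have [mX _ _] := GX.
have i1 := Lone_scaled_bump e c 2 mX.
rewrite -lee_fin -(EFin_Ex i1).
have mb := scaled_bump_measurable e c 2.
have sn0 : s != 0 by rewrite gt_eqF.
rewrite (gaussian_ge0_integral GX sn0 mb); last by move=> x; exact: sqr_ge0.
set E0 := expR _.
have ce : c - e < c + e by lra.
apply: (@le_trans _ _ (\int[mu]_(x in `[(c - e)%R, (c + e)%R]) (1 / 16 * ((3 * s)^-1 * E0))%:E)%E).
  rewrite integral_cst//= lebesgue_measure_itv/= lte_fin ce -EFinB -EFinM lee_fin.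
  rewrite le_eqVlt; apply/orP; left; apply/eqP.
  by field; rewrite gt_eqF.
apply: (@le_trans _ _ (\int[mu]_(x in `[(c - e)%R, (c + e)%R])
    (bump (e^-1 * (x - c)) ^+ 2 * normal_pdf 0 s x)%:E)%E); last first.
  apply: ge0_subset_integral => //.
    apply/measurable_EFinP; apply: measurable_funM; first exact: mb.
    exact: measurable_normal_pdf.
  by move=> x _; rewrite lee_fin mulr_ge0 ?sqr_ge0 ?normal_pdf_ge0.
apply: ge0_le_integral => //.
- by move=> x _; rewrite lee_fin !mulr_ge0 ?expR_ge0// invr_ge0 mulr_ge0// ltW.
- apply/measurable_EFinP; apply: measurable_funTS; apply: measurable_funM; first exact: mb.
  exact: measurable_normal_pdf.
move=> x /=; rewrite in_itv/= => /andP[xl xr]; rewrite lee_fin ler_pM//.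
- by rewrite mulr_ge0 ?expR_ge0// invr_ge0 mulr_ge0// ltW.
- have -> : 1 / 16 = (1 / 4) ^+ 2 :> R by field.
  rewrite lerXn2r ?nnegrE ?bump_ge0//.
  apply: bump_ge; rewrite normrM gtr0_norm ?invr_gt0// mulrC ler_pdivrMr// mul1r.
  by rewrite ler_norml; apply/andP; split; lra.
- rewrite normal_pdfE// ler_pM ?expR_ge0 ?normal_peak_ge//.
    by rewrite invr_ge0 mulr_ge0// ltW.
  rewrite /E0 /normal_fun ler_expR subr0 mulNr lerN2 -mulr_natl.
  rewrite ler_wpM2r ?invr_ge0 ?mulr_ge0 ?(ltW s0) ?sqr_ge0//.
  rewrite -(real_normK (num_real x)) lerXn2r ?nnegrE ?addr_ge0//.
  have : `|x - c| <= 1 by rewrite ler_norml; apply/andP; split; lra.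
  move=> h; apply: (@le_trans _ _ (`|c| + `|x - c|)); last by rewrite lerD2l.
  by rewrite (le_trans _ (ler_normD _ _))// addrC subrK.
Qed.

End gaussian_bump.

(** * Covariances in a Gaussian space, and factorisation of the weights *)

Section gaussian_space.
Context (R : realType) (d : measure_display) (T : measurableType d)
  (P : probability T R).
Implicit Types (A B X Y : T -> R) (p q r c e : R) (k l m : nat).

Local Notation Lone := (@Lone R d T P).
Local Notation Ex := (@Ex R d T P).

Definition gaussian_space (S : set (T -> R)) :=
  (forall X, S X -> exists s, centered_gaussian P X s) /\
  (forall X Y p q, S X -> S Y -> S (fun w => p * X w + q * Y w)).

Definition cov X Y : R := Ex (fun w => X w * Y w).

Lemma covC X Y : cov X Y = cov Y X.
Proof. by congr Ex; apply/funext => w; rewrite mulrC. Qed.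

Variable S : set (T -> R).
Hypothesis GS : gaussian_space S.

Lemma space_lin X Y p q : S X -> S Y -> S (fun w => p * X w + q * Y w).
Proof. by have [_] := GS; exact. Qed.

Lemma space_measurable X : S X -> measurable_fun setT X.
Proof. by have [+ _] := GS => /[apply] -[s [mX _ _]]. Qed.

Lemma space_exp_norm X r : S X -> Lone (fun w => expR (r * `|X w|)).
Proof. by have [+ _] := GS => /[apply] -[s GX]; exact: gaussian_exp_norm GX. Qed.

Lemma space_exp X r : S X -> Lone (fun w => expR (r * X w)) /\
  Ex (fun w => expR (r * X w)) = expR (r ^+ 2 * cov X X / 2).
Proof.
have [+ _] := GS => /[apply] -[s GX]; have [i e] := gaussian_exp r GX.
have -> : cov X X = s ^+ 2.
  rewrite -(gaussian_sqr GX) /cov; apply: congr1.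
  by apply/funext => w; rewrite expr2.
by split.
Qed.

Lemma space_LoneM X Y : S X -> S Y -> Lone (fun w => X w * Y w).
Proof.
move=> SX SY; have i1 := space_exp_norm 2 SX; have i2 := space_exp_norm 2 SY.
apply: (Lone_dom _ _ (LoneD i1 i2)).
  by apply: measurable_funM; exact: space_measurable.
move=> w; rewrite normrM.
have h (x : R) : `|x| ^+ 2 <= expR (2 * `|x|).
  rewrite (_ : 2 * `|x| = `|x| + `|x|); last by ring.
  by rewrite expRD -expr2 lerXn2r ?nnegrE ?expR_ge0// norm_le_exp.
have := h (X w); have := h (Y w).
have := sqr_ge0 (`|X w| - `|Y w|); rewrite sqrrB.
have : 0 <= `|X w| * `|Y w| by rewrite mulr_ge0.
by move=> *; lra.
Qed.

Lemma cov_linl X Y Z p q : S X -> S Y -> S Z ->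
  cov (fun w => p * X w + q * Y w) Z = p * cov X Z + q * cov Y Z.
Proof.
move=> SX SY SZ; rewrite /cov.
rewrite (_ : (fun w => _) = (fun w => p * (X w * Z w) + q * (Y w * Z w))).
  by rewrite ExD ?ExZ//; try apply: LoneZ; exact: space_LoneM.
by apply/funext => w; ring.
Qed.

Lemma cov_linr X Y Z p q : S X -> S Y -> S Z ->
  cov Z (fun w => p * X w + q * Y w) = p * cov Z X + q * cov Z Y.
Proof. by move=> SX SY SZ; rewrite covC cov_linl// (covC X) (covC Y). Qed.

Lemma cov_ge0 X : 0 <= cov X X.
Proof. by apply: Ex_ge0 => w; rewrite -expr2 sqr_ge0. Qed.

(** The point where absence of correlation becomes factorisation: the variance of the combination
    has no cross term, so its Laplace transform is a product. *)
Lemma space_exp_lin X Y p q : S X -> S Y -> cov X Y = 0 ->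
  Lone (fun w => expR (p * X w + q * Y w)) /\
  Ex (fun w => expR (p * X w + q * Y w)) =
  expR (p ^+ 2 * cov X X / 2) * expR (q ^+ 2 * cov Y Y / 2).
Proof.
move=> SX SY XY; have SZ := space_lin p q SX SY.
have [i e] := space_exp 1 SZ.
rewrite (_ : (fun w => expR (p * X w + q * Y w)) = (fun w => expR (1 * (p * X w + q * Y w)))).
  split=> //; rewrite e -expRD; congr expR.
  rewrite cov_linl// !cov_linr// XY (covC Y) XY; ring.
by apply/funext => w; rewrite mul1r.
Qed.

Section bump_weights.
Variables A X : T -> R.
Hypotheses (SA : S A) (SX : S X) (AX0 : cov A X = 0).
Variables (e c e' c' : R).

Let bA w := bump (e^-1 * (A w - c)).
Let bX w := bump (e'^-1 * (X w - c')).

Lemma exp_null_bumpX Y u k p q : exp_null P Y u ->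
  exp_null P (fun w => p * (Y w - q)) (fun w => u w * bump (p * (Y w - q)) ^+ k).
Proof.
move=> /exp_null_affine-/(_ p q) h; elim: k => [|k IH].
  by apply: (exp_null_ext _ h); apply/funext => w; rewrite expr0 mulr1.
apply: (exp_null_ext _ (exp_null_bump IH)); apply/funext => w.
by rewrite exprSr mulrA.
Qed.

Lemma exp_null_Ex Y u : exp_null P Y u -> Lone u /\ Ex u = 0.
Proof.
move=> nu; have [_ _ /(_ 0) iu /(_ 0) eu] := nu.
have h : u = (fun w => u w * expR (0 * `|Y w|)).
  by apply/funext => w; rewrite mul0r expR0 mulr1.
have h' : u = (fun w => u w * expR (0 * Y w)).
  by apply/funext => w; rewrite mul0r expR0 mulr1.
by split; [rewrite h|rewrite h'].
Qed.

(** The Laplace form of E(e^Z | Y) = E e^Z. *)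
Lemma exp_null_exp Y Z : S Y -> S Z -> cov Y Z = 0 ->
  exp_null P Y (fun w => expR (Z w) - expR (cov Z Z / 2)).
Proof.
move=> SY SZ YZ; have mY := space_measurable SY; have mZ := space_measurable SZ.
have mE : measurable_fun setT (fun w => expR (Z w)).
  by apply: (continuous_comp_measurable _ mZ); exact: continuous_expR.
split => //.
- exact: measurable_funB.
- move=> p.
  have i1 := space_exp_norm (2 * p) SY; have i2 := space_exp_norm 2 SZ.
  have i3 := space_exp_norm p SY.
  apply: (Lone_dom _ _ (LoneD (LoneD i1 i2) (LoneZ (expR (cov Z Z / 2)) i3))).
    apply: measurable_mulexp; first exact: measurable_norm.
    exact: measurable_funB.
  move=> w; rewrite normrM (@ger0_norm _ (expR (p * _))) ?expR_ge0//.
  rewrite (_ : 2 * p * `|Y w| = p * `|Y w| + p * `|Y w|); last by ring.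
  rewrite (_ : 2 * `|Z w| = `|Z w| + `|Z w|); last by ring.
  rewrite !expRD.
  have zz : expR (Z w) <= expR `|Z w| by rewrite ler_expR ler_norm.
  have := ler_normB (expR (Z w)) (expR (cov Z Z / 2)).
  rewrite !(@ger0_norm _ (expR _)) ?expR_ge0//.
  have := expR_ge0 (Z w); have := expR_ge0 (p * `|Y w|); have := expR_ge0 (cov Z Z / 2).
  move: (expR (cov Z Z / 2)) (expR (p * `|Y w|)) (expR (Z w)) (expR `|Z w|) zz.
  move=> a y z z' zz' a0 y0 z0 h.
  have h1 : z * y <= y * y + z' * z'.
    have := sqr_ge0 (y - z'); rewrite sqrrB.
    have : z * y <= z' * y by rewrite ler_wpM2r.
    have : 0 <= z' * y by rewrite mulr_ge0// (le_trans z0).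
    by move=> *; lra.
  by apply: (le_trans (ler_wpM2r y0 h)); rewrite mulrDl lerD.
- move=> p; have [i1 e1] := space_exp_lin p 1 SY SZ YZ.
  have [i2 e2] := space_exp p SY.
  rewrite (_ : (fun w => _) = (fun w => expR (p * Y w + 1 * Z w) -
     expR (cov Z Z / 2) * expR (p * Y w))).
    rewrite ExB//; last exact: LoneZ.
    by rewrite ExZ// e1 e2 expr1n mul1r mulrC subrr.
  by apply/funext => w; rewrite mul1r expRD mulrBl mulrC.
Qed.

Lemma bump_exp Y k : S Y -> cov A Y = 0 ->
  Ex (fun w => bA w ^+ k * expR (Y w)) = Ex (fun w => bA w ^+ k) * expR (cov Y Y / 2).
Proof.
move=> SY AY.
have [i0 e0] := exp_null_Ex (exp_null_bumpX k e^-1 c (exp_null_exp SA SY AY)).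
have ib := @Lone_scaled_bump _ _ _ P A e c k (space_measurable SA).
have ib' := LoneZ (expR (cov Y Y / 2)) ib.
rewrite mulrC -ExZ// -[RHS]add0r -[X in X + _]e0 -ExD//.
by congr Ex; apply/funext => w; rewrite /bA; ring.
Qed.

(** The two weights are removed one after the other. Removing that of [A] against exponentials of
    all [r * B + p * X] shows that the error is annihilated by exponentials of [X], hence also by
    the weight of [X]. *)
Lemma bump2_exp B r k l : S B -> cov A B = 0 -> cov X B = 0 ->
  Ex (fun w => bA w ^+ k * bX w ^+ l * expR (r * B w)) =
  Ex (fun w => bA w ^+ k) * Ex (fun w => bX w ^+ l) * expR (r ^+ 2 * cov B B / 2).
Proof.
move=> SB AB XB.
have mX := space_measurable SX; have mA := space_measurable SA.
have mB := space_measurable SB.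
have mbA k' := @measurable_scaled_bump _ _ _ A e c k' mA.
have bA1 w k' : `|bA w ^+ k'| <= 1.
  by rewrite normrX ger0_norm ?bump_ge0// exprn_ile1 ?bump_ge0 ?bump_le1.
(* The null term puts [r * B] in the shape of a combination of two variables, to which [space_lin]
   and the bilinearity lemmas apply. *)
set rB := fun w => r * B w + 0 * X w.
have SrB : S rB by exact: space_lin.
have ArB : cov A rB = 0 by rewrite cov_linr// AB AX0 !mulr0 addr0.
have erB : Ex (fun w => bA w ^+ k * expR (rB w)) =
    Ex (fun w => bA w ^+ k) * expR (cov rB rB / 2) by exact: bump_exp.
have crB : cov rB rB = r ^+ 2 * cov B B.
  by rewrite /rB cov_linl// !cov_linr// XB covC XB; ring.
have mE : measurable_fun setT (fun w => expR (rB w)).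
  by apply: (continuous_comp_measurable (@continuous_expR R)); exact: space_measurable.
have nu : exp_null P X (fun w => bA w ^+ k * expR (rB w) -
    Ex (fun w => bA w ^+ k) * expR (cov rB rB / 2)).
  have XrB : cov X rB = 0 by rewrite /rB cov_linr// XB; ring.
  have [_ _ iu _] := exp_null_exp SX SrB XrB.
  set K := Ex _.
  have mu : measurable_fun setT (fun w => bA w ^+ k * expR (rB w) - K * expR (cov rB rB / 2)).
    by apply: measurable_funB => //; apply: measurable_funM => //; exact: mbA.
  have i1 p : Lone (fun w => expR (p * `|X w|)) by exact: space_exp_norm.
  split => //.
  - move=> p.
    have i2 := LoneD (iu p) (LoneZ (expR (cov rB rB / 2)) (i1 p)).
    have i3 : Lone (fun w => expR (rB w) * expR (p * `|X w|)).
      by rewrite (_ : (fun w => _) = (fun w => (expR (rB w) - expR (cov rB rB / 2)) *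
          expR (p * `|X w|) + expR (cov rB rB / 2) * expR (p * `|X w|)))//;
        apply/funext => w; ring.
    apply: (Lone_dom _ _ (LoneD i3 (LoneZ (`|K| * expR (cov rB rB / 2)) (i1 p)))).
      by apply: measurable_mulexp => //; exact: measurable_norm.
    move=> w; rewrite normrM (@ger0_norm _ (expR (p * _))) ?expR_ge0//.
    rewrite -mulrDl ler_wpM2r ?expR_ge0//.
    apply: (le_trans (ler_normB _ _)); rewrite !normrM.
    rewrite !(@ger0_norm _ (expR _)) ?expR_ge0// lerD2r.
    by rewrite ler_piMl ?expR_ge0.
  - move=> p.
    have SY : S (fun w => 1 * rB w + p * X w) by exact: space_lin.
    have AY : cov A (fun w => 1 * rB w + p * X w) = 0.
      by rewrite cov_linr// ArB AX0 !mulr0 addr0.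
    have eY := bump_exp k SY AY.
    have rBX : cov rB X = 0 by rewrite covC.
    have cY : cov (fun w => 1 * rB w + p * X w) (fun w => 1 * rB w + p * X w)
        = cov rB rB + p ^+ 2 * cov X X.
      rewrite (cov_linl 1 p SrB SX SY) (cov_linr 1 p SrB SX SrB).
      by rewrite (cov_linr 1 p SrB SX SX) XrB rBX; ring.
    rewrite cY in eY.
    have [iX eX] := space_exp p SX.
    have [iY _] := space_exp 1 SY.
    rewrite (_ : (fun w => _) = (fun w => bA w ^+ k * expR (1 * rB w + p * X w) -
       (K * expR (cov rB rB / 2)) * expR (p * X w))); last first.
      by apply/funext => w; rewrite mul1r (expRD (rB w) (p * X w)); ring.
    rewrite ExB; last 2 first.
    + apply: (Lone_dom _ _ iY).
        apply: measurable_funM; first exact: mbA.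
        by apply: (continuous_comp_measurable (@continuous_expR R)); exact: space_measurable.
      move=> w; rewrite normrM (@ger0_norm _ (expR _)) ?expR_ge0//.
      by rewrite [leRHS](_ : _ = expR (1 * rB w + p * X w)) ?ler_piMl ?expR_ge0// mul1r.
    + exact: LoneZ.
    by rewrite ExZ// eX eY mulrDl expRD -/K mulrA subrr.
have [i0 e0] := exp_null_Ex (exp_null_bumpX l e'^-1 c' nu).
have ibX := @Lone_scaled_bump _ _ _ P X e' c' l mX.
rewrite -crB mulrAC -ExZ// -[RHS]add0r -[X in X + _]e0 -ExD//; last exact: LoneZ.
by congr Ex; apply/funext => w; rewrite /rB mul0r addr0 /bX; ring.
Qed.

End bump_weights.

End gaussian_space.

Section weighted_estimates.
Context (R : realType) (d : measure_display) (T : measurableType d)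
  (P : probability T R).
Implicit Types (A B X Y : T -> R) (p q r c e t : R) (k l m : nat).

Local Notation Lone := (@Lone R d T P).
Local Notation Ex := (@Ex R d T P).

(** One term of the exponential series at |y|/t, then e^|z| <= e^z + e^(-z): moments are reduced to
    Laplace transforms, where the weights factorise. *)
Lemma even_pow_le_exp m (y t : R) : 0 < t ->
  y ^+ m.*2 <= m.*2`!%:R * t ^+ m.*2 * (expR (t^-1 * y) + expR (- t^-1 * y)).
Proof.
move=> t0; pose z := t^-1 * y.
have yz : y ^+ m.*2 = t ^+ m.*2 * z ^+ m.*2.
  by rewrite -exprMn /z mulrA divff ?mul1r ?gt_eqF.
rewrite yz mulNr -/z [X in _ <= X * _]mulrC -mulrA ler_wpM2l ?exprn_ge0 ?(ltW t0)//.
rewrite mulrC -ler_pdivrMr ?ltr0n ?fact_gt0//.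
have ez : expR `|z| <= expR z + expR (- z).
  by case: (ler0P z) => _; rewrite ?lerDl ?lerDr expR_ge0.
apply: le_trans ez.
have -> : z ^+ m.*2 = `|z| ^+ m.*2.
  by rewrite -!mul2n !exprM real_normK ?num_real.
case: m {yz} => [|m]; first by rewrite expr0 divr1 -expR0 ler_expR.
by apply: le_trans (expR_ge1Dxn m.*2.+1 (normr_ge0 z)); rewrite doubleS lerDr.
Qed.

Variable S : set (T -> R).
Hypothesis GS : gaussian_space P S.
Variables A X : T -> R.
Hypotheses (SA : S A) (SX : S X) (AX0 : cov P A X = 0).
Variables (e c e' c' : R).

Let bA w := bump (e^-1 * (A w - c)).
Let bX w := bump (e'^-1 * (X w - c')).

Let mA := space_measurable GS SA.
Let mX := space_measurable GS SX.

Definition weight w := bA w ^+ 2 * bX w ^+ 2.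

Let bA01 k w : 0 <= bA w ^+ k <= 1.
Proof. by rewrite exprn_ge0 ?bump_ge0//= exprn_ile1 ?bump_ge0 ?bump_le1. Qed.

Let bX01 k w : 0 <= bX w ^+ k <= 1.
Proof. by rewrite exprn_ge0 ?bump_ge0//= exprn_ile1 ?bump_ge0 ?bump_le1. Qed.

Let bAX01 k l w : 0 <= bA w ^+ k * bX w ^+ l <= 1.
Proof.
have /andP[a0 a1] := bA01 k w; have /andP[b0 b1] := bX01 l w.
by rewrite mulr_ge0//= mulr_ile1.
Qed.

Let mbAX k l : measurable_fun setT (fun w => bA w ^+ k * bX w ^+ l).
Proof. by apply: measurable_funM; exact: measurable_scaled_bump. Qed.

Lemma weight_ge0 w : 0 <= weight w. Proof. by have /andP[] := bAX01 2 2 w. Qed.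
Lemma weight_le1 w : weight w <= 1. Proof. by have /andP[] := bAX01 2 2 w. Qed.
Lemma measurable_weight : measurable_fun setT weight. Proof. exact: mbAX. Qed.

Let Lone_bAX k l : Lone (fun w => bA w ^+ k * bX w ^+ l).
Proof.
apply: (@Lone_bounded _ _ _ _ _ 1); first exact: mbAX.
by move=> w; have /andP[a0 a1] := bAX01 k l w; rewrite ger0_norm.
Qed.

Lemma Ex_bumpM k l : Ex (fun w => bA w ^+ k * bX w ^+ l) =
  Ex (fun w => bA w ^+ k) * Ex (fun w => bX w ^+ l).
Proof.
have S0 : S (fun w => 0 * A w + 0 * A w) by exact: (space_lin GS).
have h Y : S Y -> cov P Y (fun w => 0 * A w + 0 * A w) = 0.
  by move=> SY; rewrite (cov_linr GS)// !mul0r addr0.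
have := bump2_exp GS SA SX AX0 e c e' c' 0 k l S0 (h _ SA) (h _ SX).
rewrite expr0n/= !mul0r expR0 mulr1 => <-.
by congr Ex; apply/funext => w; rewrite mul0r expR0 mulr1.
Qed.

Lemma Ex_weight : Ex weight = Ex (fun w => bA w ^+ 2) * Ex (fun w => bX w ^+ 2).
Proof. exact: Ex_bumpM. Qed.

(** At rates 1/t and -1/t the Laplace transform of [B] is at most e^(1/2) <= 2. The bound is
    proportional to [Ex weight], however small that is, which is what makes the weighted chaining
    uniform in lambda. *)
Lemma weight_moment B m t : S B -> cov P A B = 0 -> cov P X B = 0 ->
  0 < t -> cov P B B <= t ^+ 2 ->
  Lone (fun w => weight w * B w ^+ m.*2) /\
  Ex (fun w => weight w * B w ^+ m.*2) <= 4 * m.*2`!%:R * t ^+ m.*2 * Ex weight.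
Proof.
move=> SB AB XB t0 Bt; have mB := space_measurable GS SB.
have b1 r : Lone (fun w => weight w * expR (r * B w)).
  have [iB _] := space_exp GS r SB.
  apply: (Lone_dom _ _ iB).
    by apply: measurable_funM; [exact: measurable_weight|exact: measurable_exp].
  move=> w; rewrite normrM (@ger0_norm _ (expR _)) ?expR_ge0// ler_piMl ?expR_ge0//.
  by rewrite ger0_norm ?weight_ge0 ?weight_le1.
have t1 : t^-1 ^+ 2 * cov P B B / 2 <= 1 / 2.
  by rewrite ler_wpM2r// exprVn mulrC ler_pdivrMr ?mul1r// exprn_gt0.
have e2 : expR (1 / 2) <= 2 :> R.
  have := expR_ge1Dx (- (1 / 2) : R); rewrite expRN.
  have := expR_gt0 (1 / 2 : R); move: (expR (1 / 2)) => z z0 h.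
  have h2 : 2^-1 <= z^-1 by apply: le_trans h; lra.
  by rewrite -(invrK z) -(invrK 2) lef_pV2 ?posrE ?invr_gt0.
have eb r : r = t^-1 \/ r = - t^-1 ->
    Ex (fun w => weight w * expR (r * B w)) <= 2 * Ex weight.
  move=> rt; rewrite (bump2_exp GS SA SX AX0 e c e' c' r 2 2 SB AB XB) Ex_weight.
  rewrite mulrC ler_wpM2r//.
    by rewrite mulr_ge0// Ex_ge0// => w; rewrite sqr_ge0.
  apply: le_trans e2; rewrite ler_expR.
  by case: rt => ->; rewrite ?sqrrN.
pose C : R := m.*2`!%:R * t ^+ m.*2.
have C0 : 0 <= C by rewrite mulr_ge0// exprn_ge0// ltW.
pose G w := C * (weight w * expR (t^-1 * B w) + weight w * expR (- t^-1 * B w)).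
have iG : Lone G by apply: LoneZ; apply: LoneD; exact: b1.
have FG w : weight w * B w ^+ m.*2 <= G w.
  rewrite /G -mulrDr mulrCA ler_wpM2l ?weight_ge0//.
  exact: even_pow_le_exp.
have iF : Lone (fun w => weight w * B w ^+ m.*2).
  apply: (Lone_dom _ _ iG).
    by apply: measurable_funM; [exact: measurable_weight|exact: measurable_funX].
  move=> w; rewrite ger0_norm//.
  by rewrite mulr_ge0 ?weight_ge0// -mul2n exprM exprn_ge0// sqr_ge0.
split => //; apply: (le_trans (Ex_le iF iG FG)).
rewrite /G ExZ; last by apply: LoneD; exact: b1.
rewrite ExD//.
have -> : 4 * m.*2`!%:R * t ^+ m.*2 * Ex weight = C * (2 * Ex weight + 2 * Ex weight).
  by rewrite /C; ring.
by rewrite ler_wpM2l// lerD// eb; [|left| |right].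
Qed.

(** Pointwise, the indicator of the event is at least the weight minus three terms: the two tails
    outside the windows and the weight on [Bad]. Each has expectation at most a quarter of
    [Ex weight], so a quarter survives. *)
Lemma weight_lower_bound (Bad : set T) : 0 < e -> 0 < e' ->
  e ^+ 2 * Ex bA <= Ex (fun w => bA w ^+ 2) / 4 ->
  e' ^+ 2 * Ex bX <= Ex (fun w => bX w ^+ 2) / 4 ->
  measurable Bad -> Ex (fun w => weight w * \1_Bad w) <= Ex weight / 4 ->
  ((Ex weight / 4)%:E <= P (([set w | (`|A w - c| <= 1)%R] `&`
      [set w | (`|X w - c'| <= 1)%R]) `\` Bad))%E.
Proof.
move=> e0 e'0 hA hX mBad hBad.
set E := (X in P X).
have mE : measurable E.
  by apply: measurableD => //; apply: measurableI; exact: measurable_window.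
(* Outside the window the argument of the bump exceeds 1/eps, so one factor is at most [eps ^+ 2] by
   [bump_sqr_le1]. *)
have tail Y (eps q : R) w : 0 < eps -> ~~ (`|Y w - q| <= 1) ->
    bump (eps^-1 * (Y w - q)) ^+ 2 <= eps ^+ 2 * bump (eps^-1 * (Y w - q)).
  move=> eps0; rewrite -ltNge => y1.
  rewrite expr2 ler_wpM2r ?bump_ge0//.
  have h := bump_sqr_le1 (eps^-1 * (Y w - q)); move: h (bump_ge0 (eps^-1 * (Y w - q))).
  move: (bump _) => b h b0.
  have y2 : 1 <= (Y w - q) ^+ 2.
    by rewrite -(real_normK (num_real _)) exprn_ege1// ltW.
  rewrite exprMn exprVn in h.
  have : eps ^+ 2 * ((eps ^+ 2)^-1 * (Y w - q) ^+ 2 * b) <= eps ^+ 2 * 1.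
    by rewrite ler_wpM2l ?sqr_ge0.
  rewrite !mulrA mulfV ?expf_neq0 ?gt_eqF// mul1r mulr1.
  by apply: le_trans; rewrite ler_peMl.
have iI D : measurable D -> Lone (\1_D : T -> R).
  move=> mD; apply: (@Lone_bounded _ _ _ _ _ 1); first exact: measurable_indic.
  by move=> w; rewrite indicE; case: (_ \in _); rewrite ?normr1 ?normr0.
have iw : Lone weight by exact: Lone_bAX.
have iwB : Lone (fun w => weight w * \1_Bad w).
  apply: (Lone_dom _ _ iw).
    by apply: measurable_funM; [exact: measurable_weight|exact: measurable_indic].
  move=> w; rewrite normrM ger0_norm ?weight_ge0//.
  by rewrite indicE; case: (_ \in _); rewrite ?normr1 ?normr0 ?mulr1 ?mulr0 ?weight_ge0.
have point w : weight w - e ^+ 2 * (bA w ^+ 1 * bX w ^+ 2)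
   - e' ^+ 2 * (bA w ^+ 2 * bX w ^+ 1) - weight w * \1_Bad w <= \1_E w.
  have /andP[a0 a1] := bAX01 1 2 w; have /andP[c0 c1] := bAX01 2 1 w.
  have w0 := weight_ge0 w; have w1 := weight_le1 w.
  have ea : 0 <= e ^+ 2 * (bA w ^+ 1 * bX w ^+ 2) by rewrite mulr_ge0 ?sqr_ge0.
  have eb : 0 <= e' ^+ 2 * (bA w ^+ 2 * bX w ^+ 1) by rewrite mulr_ge0 ?sqr_ge0.
  have i0 (D : set T) : 0 <= (\1_D w : R) by rewrite indicE.
  have wB : 0 <= weight w * \1_Bad w by rewrite mulr_ge0.
  have [hAw|hAw] := boolP (`|A w - c| <= 1); last first.
    have : weight w <= e ^+ 2 * (bA w ^+ 1 * bX w ^+ 2).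
      rewrite /weight mulrA ler_wpM2r ?sqr_ge0// expr1; exact: tail.
    by have := i0 E; lra.
  have [hXw|hXw] := boolP (`|X w - c'| <= 1); last first.
    have : weight w <= e' ^+ 2 * (bA w ^+ 2 * bX w ^+ 1).
      rewrite /weight [leRHS]mulrCA ler_wpM2l ?sqr_ge0// expr1; exact: tail.
    by have := i0 E; lra.
  have [hB|hB] := pselect (Bad w).
    have -> : \1_Bad w = 1 :> R by rewrite indicE mem_set.
    by have := i0 E; lra.
  have -> : \1_E w = 1 :> R by rewrite indicE mem_set.
  by lra.
have := Ex_le _ (iI _ mE) point.
have iA := LoneZ (e ^+ 2) (Lone_bAX 1 2); have iX := LoneZ (e' ^+ 2) (Lone_bAX 2 1).
move=> /(_ (LoneB (LoneB (LoneB iw iA) iX) iwB)).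
rewrite (ExB (LoneB (LoneB iw iA) iX) iwB) (ExB (LoneB iw iA) iX) (ExB iw iA).
rewrite (ExZ _ (Lone_bAX 1 2)) (ExZ _ (Lone_bAX 2 1)) !Ex_bumpM => h.
have -> : P E = (Ex (\1_E))%:E by rewrite -(EFin_Ex (iI _ mE)) integral_indic// setIT.
rewrite lee_fin; apply: le_trans h.
have -> : Ex (fun w => bA w ^+ 1) = Ex bA.
  by congr Ex; apply/funext => w; rewrite expr1.
have -> : Ex (fun w => bX w ^+ 1) = Ex bX.
  by congr Ex; apply/funext => w; rewrite expr1.
move: hBad; rewrite Ex_weight.
have : 0 <= Ex (fun w => bA w ^+ 2) by apply: Ex_ge0 => w; rewrite sqr_ge0.
have : 0 <= Ex (fun w => bX w ^+ 2) by apply: Ex_ge0 => w; rewrite sqr_ge0.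
move: (Ex (fun w => bA w ^+ 2)) (Ex (fun w => bX w ^+ 2)) hA hX => a x hA hX x0 a0.
have := ler_wpM2r x0 hA; have := ler_wpM2l a0 hX.
move: (Ex bA) (Ex bX) (Ex _) => u v z h1 h2 h3.
by nra.
Qed.

End weighted_estimates.

(** * Regression on two uncorrelated variables *)

Section residual.
Context (R : realType) (d : measure_display) (T : measurableType d)
  (P : probability T R).
Implicit Types (Y Z : T -> R).
Variable S : set (T -> R).
Hypothesis GS : gaussian_space P S.

Lemma spaceZ Y p : S Y -> S (fun w => p * Y w).
Proof.
move=> SY; have := space_lin GS p 0 SY SY; congr S.
by apply/funext => w; rewrite mul0r addr0.
Qed.

Lemma spaceB Y Z : S Y -> S Z -> S (fun w => Y w - Z w).
Proof.
move=> SY SZ; have := space_lin GS 1 (-1) SY SZ; congr S.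
by apply/funext => w; rewrite mul1r mulN1r.
Qed.

Lemma covBl Y Z W : S Y -> S Z -> S W ->
  cov P (fun w => Y w - Z w) W = cov P Y W - cov P Z W.
Proof.
move=> SY SZ SW; have := cov_linl GS 1 (-1) SY SZ SW.
rewrite mul1r mulN1r => <-; congr (cov P _ W).
by apply/funext => w; rewrite mul1r mulN1r.
Qed.

Lemma covZl Y W p : S Y -> S W -> cov P (fun w => p * Y w) W = p * cov P Y W.
Proof.
move=> SY SW; have := cov_linl GS p 0 SY SY SW.
rewrite mul0r addr0 => <-; congr (cov P _ W).
by apply/funext => w; rewrite mul0r addr0.
Qed.

Lemma cov_sqrB Y Z : S Y -> S Z ->
  cov P (fun w => Y w - Z w) (fun w => Y w - Z w) =
  cov P Y Y - 2 * cov P Y Z + cov P Z Z.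
Proof.
move=> SY SZ; have SB := spaceB SY SZ.
rewrite (covBl SY SZ SB) (covC P Y) (covC P Z) !covBl// (covC P Z Y); ring.
Qed.

Lemma cov_cauchy_schwarz Y Z : S Y -> S Z -> 0 < cov P Z Z ->
  cov P Y Z ^+ 2 <= cov P Y Y * cov P Z Z.
Proof.
move=> SY SZ z0; pose c := cov P Y Z / cov P Z Z; have SZ' := spaceZ c SZ.
have e1 : cov P Y (fun w => c * Z w) = c * cov P Y Z by rewrite covC covZl// covC.
have e2 : cov P (fun w => c * Z w) (fun w => c * Z w) = c * (c * cov P Z Z).
  by rewrite covZl// covC covZl.
have := cov_ge0 P (fun w => Y w - c * Z w).
rewrite (cov_sqrB SY SZ') e1 e2 => h.
rewrite -ler_pdivrMr// -subr_ge0; apply: le_trans h _.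
rewrite le_eqVlt; apply/orP; left; apply/eqP; rewrite /c; field.
by rewrite gt_eqF.
Qed.

Variables A X : T -> R.
Hypotheses (SA : S A) (SX : S X) (AX0 : cov P A X = 0).
Hypotheses (vA : 0 < cov P A A) (vX : 0 < cov P X X).

Definition residual Y w : R :=
  Y w - cov P Y A / cov P A A * A w - cov P Y X / cov P X X * X w.

Lemma space_residual Y : S Y -> S (residual Y).
Proof. by move=> SY; apply: spaceB; [apply: spaceB => //|]; exact: spaceZ. Qed.

Lemma cov_residual Y Z : S Y -> S Z -> cov P (residual Y) Z =
  cov P Y Z - cov P Y A / cov P A A * cov P A Z - cov P Y X / cov P X X * cov P X Z.
Proof.
move=> SY SZ; have h1 := spaceZ (cov P Y A / cov P A A) SA.
have h2 := spaceZ (cov P Y X / cov P X X) SX.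
have h3 := spaceB SY h1.
rewrite /residual (covBl h3 h2 SZ) (covBl SY h1 SZ).
by rewrite (covZl _ SA SZ) (covZl _ SX SZ).
Qed.

Lemma residual_orthA Y : S Y -> cov P A (residual Y) = 0.
Proof.
move=> SY; rewrite covC cov_residual// (covC P X A) AX0 mulr0 subr0 divfK ?gt_eqF//.
by rewrite subrr.
Qed.

Lemma residual_orthX Y : S Y -> cov P X (residual Y) = 0.
Proof.
move=> SY; rewrite covC cov_residual// AX0 mulr0 subr0 divfK ?gt_eqF//.
by rewrite subrr.
Qed.

(** An orthogonal projection does not increase variance. Together with [residualB], the residual
    field inherits the increment bounds of the original field. *)
Lemma cov_residual_le Y : S Y -> cov P (residual Y) (residual Y) <= cov P Y Y.
Proof.
move=> SY; have SR := space_residual SY.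
rewrite cov_residual// residual_orthA// residual_orthX// !mulr0 !subr0.
rewrite covC cov_residual// (covC P A Y) (covC P X Y) -addrA gerDl -opprD oppr_le0.
by rewrite addr_ge0// mulrAC -expr2 divr_ge0 ?sqr_ge0// ltW.
Qed.

Lemma residualB Y Z w : S Y -> S Z ->
  residual Y w - residual Z w = residual (fun w => Y w - Z w) w.
Proof. by move=> SY SZ; rewrite /residual !covBl//; ring. Qed.

Lemma residual_self : residual A = fun=> 0.
Proof.
apply/funext => w; rewrite /residual AX0 mul0r mul0r divff ?gt_eqF//.
by rewrite mul1r subrr subr0.
Qed.

End residual.

Section scaled_bump_constants.
Context (R : realType) (d : measure_display) (T : measurableType d)
  (P : probability T R).

(** A lower bound for the exponential factor in [gaussian_bump_ge], valid once the variance is at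
    least 1/2. *)
Definition bump_peak (c : R) : R := expR (- (`|c| + 1) ^+ 2).
(** Chosen so that the tail 8 e^3 / s is at most a quarter of the main term
    [e * bump_peak c / (24 * s)]. As e <= 1, it suffices that [e <= bump_peak c / 768]. *)
Definition bump_scale (c : R) : R := bump_peak c / 32 / 32.

Lemma bump_peak_itv c : 0 < bump_peak c <= 1.
Proof. by rewrite expR_gt0/= -expR0 ler_expR oppr_le0 sqr_ge0. Qed.

Lemma gaussian_bump_window (X : T -> R) s c : centered_gaussian P X s -> 0 < s ->
  1 / 2 <= s ^+ 2 -> let e := bump_scale c in
  e ^+ 2 * Ex P (fun w => bump (e^-1 * (X w - c))) <=
    Ex P (fun w => bump (e^-1 * (X w - c)) ^+ 2) / 4 /\
  e * bump_peak c / (24 * s) <= Ex P (fun w => bump (e^-1 * (X w - c)) ^+ 2).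
Proof.
move=> GX s0 s2 e; have /andP[E0 E1] := bump_peak_itv c.
have e0 : 0 < e by rewrite /e /bump_scale; lra.
have e1 : e <= 1 by rewrite /e /bump_scale; lra.
have e01 : 0 < e <= 1 by rewrite e0.
have low : e * bump_peak c / (24 * s) <= Ex P (fun w => bump (e^-1 * (X w - c)) ^+ 2).
  apply: le_trans (gaussian_bump_ge c GX s0 e01).
  rewrite mulrAC; apply: ler_wpM2l.
    by apply: divr_ge0; [exact: ltW|apply: mulr_ge0 => //; exact: ltW].
  rewrite /bump_peak ler_expR lerN2 ler_pdivrMr ?mulr_gt0 ?exprn_gt0//.
  by rewrite ler_peMr ?sqr_ge0//; lra.
split=> //; apply: (@le_trans _ _ (e * bump_peak c / (24 * s) / 4)); last first.
  by rewrite ler_wpM2r.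
apply: (@le_trans _ _ (e ^+ 2 * (8 * e / s))).
  by rewrite ler_wpM2l ?sqr_ge0//; exact: gaussian_bump_le.
have -> : e ^+ 2 * (8 * e / s) = e / s * (8 * e ^+ 2) by ring.
have -> : e * bump_peak c / (24 * s) / 4 = e / s * (bump_peak c / 96).
  by field; rewrite gt_eqF.
apply: ler_wpM2l; first by apply: divr_ge0; exact: ltW.
have e2 : e ^+ 2 <= e by rewrite expr2 ler_piMl// ltW.
have eE : e = bump_peak c / 32 / 32 by [].
by lra.
Qed.

End scaled_bump_constants.

(** * Chaining on the unit cube *)

Section dyadic_grid.
Variable R : realType.
Implicit Types x y : R.

Lemma truncn_half y : 0 <= y -> (Num.truncn (2 * y))./2 = Num.truncn y.
Proof.
move=> y0; apply/esym/truncn_def.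
have /andP[h1 h2] := truncn_itv (mulr_ge0 (ler0n R 2) y0).
set a := Num.truncn _ in h1 h2 *.
have ea : a = (odd a + a./2.*2)%N by rewrite odd_double_half.
have h3 : (a./2.*2)%:R <= (a%:R : R) by rewrite ler_nat [leqRHS]ea leq_addl.
have h4 : (a.+1%:R : R) <= (a./2.+1.*2)%:R.
  rewrite ler_nat doubleS [X in (X < _)%N]ea ltnS -[leqRHS]add1n leq_add2r.
  by case: odd.
move: h3 h4; rewrite -!muln2 !natrM => h3 h4.
by apply/andP; split; lra.
Qed.

Definition dyadic_point n (j : nat) (k : 'I_n -> nat) : 'rV[R]_n :=
  \row_i ((k i)%:R / 2 ^+ j).

Definition dyadic_floor n (j : nat) (x : 'rV[R]_n) (i : 'I_n) : nat :=
  Num.truncn (2 ^+ j * x 0 i).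

(** Halving the index gives the parent cell, so the successive dyadic floors of one point form a
    chain whose links come from a finite list at each level. *)
Lemma dyadic_floor_half n j (x : 'rV[R]_n) i : 0 <= x 0 i ->
  (dyadic_floor j.+1 x i)./2 = dyadic_floor j x i.
Proof.
move=> x0; rewrite /dyadic_floor exprS -mulrA truncn_half//.
by rewrite mulr_ge0// exprn_ge0.
Qed.

Lemma dyadic_point_floor n j (x : 'rV[R]_n) i : 0 <= x 0 i ->
  0 <= x 0 i - dyadic_point j (dyadic_floor j x) 0 i <= (2 ^+ j)^-1.
Proof.
move=> x0; rewrite mxE /dyadic_floor.
have e0 : 0 < 2 ^+ j :> R by rewrite exprn_gt0.
have /andP[h1 h2] := truncn_itv (mulr_ge0 (ltW e0) x0).
rewrite subr_ge0 ler_pdivrMr// [x 0 i * _]mulrC h1/= lerBlDr.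
rewrite -(ler_pM2l e0) mulrDr mulfV ?gt_eqF// mulrCA mulfV ?gt_eqF// mulr1.
by rewrite addrC natr1 ltW.
Qed.

Lemma dyadic_point_half n j (k : 'I_n -> nat) i :
  `|dyadic_point j.+1 k 0 i - dyadic_point j (fun i => (k i)./2) 0 i| <= (2 ^+ j.+1)^-1.
Proof.
rewrite !mxE.
have -> : (k i)%:R / 2 ^+ j.+1 - (k i)./2%:R / 2 ^+ j = (odd (k i))%:R / 2 ^+ j.+1 :> R.
  have : 2 ^+ j != 0 :> R by rewrite expf_neq0.
  have : (k i)%:R = (odd (k i))%:R + (k i)./2%:R * 2 :> R.
    by rewrite -natrM muln2 -natrD odd_double_half.
  move=> ->; rewrite exprS.
  move: (2 ^+ j : R) ((odd (k i))%:R : R) ((k i)./2%:R : R) => z u v z0.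
  by field.
rewrite ger0_norm ?divr_ge0 ?exprn_ge0//.
rewrite -[leRHS]mul1r ler_wpM2r ?invr_ge0 ?exprn_ge0//.
by case: odd.
Qed.

End dyadic_grid.

Definition unit_cube (R : realType) n : set 'rV[R]_n :=
  [set x | forall i, 0 <= x 0 i <= 1].

Section finite_sums.
Context (R : realType) (d : measure_display) (T : measurableType d)
  (P : probability T R).

Lemma Ex_sum (I : Type) (s : seq I) (F : I -> T -> R) (c : I -> R) :
  (forall i, Lone P (F i) /\ Ex P (F i) <= c i) ->
  Lone P (fun w => \sum_(i <- s) F i w) /\
  Ex P (fun w => \sum_(i <- s) F i w) <= \sum_(i <- s) c i.
Proof.
move=> h; elim: s => [|i s [IH1 IH2]].
  rewrite big_nil (_ : (fun w => _) = fun=> 0); last by apply/funext => w; rewrite big_nil.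
  by split; [exact: Lone_cst|rewrite Ex_cst].
rewrite (_ : (fun w => _) = (fun w => F i w + \sum_(i <- s) F i w)); last first.
  by apply/funext => w; rewrite big_cons.
have [h1 h2] := h i; split; first exact: LoneD.
by rewrite ExD// big_cons lerD.
Qed.

End finite_sums.

Section chaining.
Context (R : realType) (d : measure_display) (T : measurableType d)
  (P : probability T R).
Variables (n m : nat) (G : 'rV[R]_n -> T -> R) (wt : T -> R) (K : R).

Local Notation cube := (@unit_cube R n).
Local Notation Lone := (@Lone R d T P).
Local Notation Ex := (@Ex R d T P).

Hypothesis m_gt0 : (0 < m)%N.
Hypothesis K_ge0 : 0 <= K.
Hypothesis mwt : measurable_fun setT wt.
Hypothesis wt01 : forall w, 0 <= wt w <= 1.
Hypothesis mG : forall x, cube x -> measurable_fun setT (G x).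
(** There are 2^(n(j+1)) links at level j, so the exponent n + 2 leaves 2^(-2(j+1)) after the union
    bound: one power of 2^(-j) pays for the shrinking thresholds, the other makes the levels
    summable. *)
Hypothesis GE : forall x y (delta : R), cube x -> cube y -> 0 < delta -> delta <= 1 ->
  (forall i, `|x 0 i - y 0 i| <= delta) ->
  Lone (fun w => wt w * (G x w - G y w) ^+ m.*2) /\
  Ex (fun w => wt w * (G x w - G y w) ^+ m.*2) <= K * delta ^+ n.+2.
Hypothesis cG : forall w x, cube x -> {for x, continuous (fun y => G y w)}.

(** With 1 - q = 1/(4m), Bernoulli's inequality gives q^(2m) >= 1/2, so the powers 2m of the
    thresholds below shrink at most by half from one level to the next. *)
Let q : R := 1 - (m.*2.*2%:R)^-1.

Let m4_gt0 : 0 < m.*2.*2%:R :> R.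
Proof. by rewrite ltr0n !double_gt0. Qed.

Let q_gt0 : 0 < q.
Proof.
rewrite subr_gt0 invf_lt1// ltr1n.
by case: m m_gt0.
Qed.

Let q_lt1 : q < 1.
Proof. by rewrite /q ltrBlDr ltrDl invr_gt0. Qed.

Let qp_ge : 1 / 2 <= q ^+ m.*2.
Proof.
have bern (x : R) k : 0 <= x -> x <= 1 -> 1 - k%:R * x <= (1 - x) ^+ k.
  move=> x0 x1; elim: k => [|k IH]; first by rewrite mul0r subr0 expr0.
  rewrite exprS; apply: (@le_trans _ _ ((1 - x) * (1 - k%:R * x))).
    rewrite -natr1; have : 0 <= k%:R * (x * x) by rewrite !mulr_ge0.
    by lra.
  by rewrite ler_wpM2l// subr_ge0.
apply: le_trans (bern _ _ _ _); last 2 first.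
- by rewrite invr_ge0 ltW.
- by rewrite invf_le1// ler1n !double_gt0.
rewrite -(muln2 m.*2) natrM invfM mulrA mulfV ?mul1r; first by lra.
by rewrite pnatr_eq0 double_eq0 -lt0n.
Qed.

Variable M : R.
Hypothesis M_gt0 : 0 < M.

(** The allowed increment along a link of level [j]; these sum to [M] over all levels. *)
Let t j : R := M * (1 - q) * q ^+ j.

Let t_gt0 j : 0 < t j.
Proof. by rewrite !mulr_gt0 ?exprn_gt0// subr_gt0. Qed.

Let pt j (k : {ffun 'I_n -> 'I_(2 ^ j.+1)}) : 'rV[R]_n := dyadic_point R j.+1 (fun i => k i).
Let par j (k : {ffun 'I_n -> 'I_(2 ^ j.+1)}) : 'rV[R]_n :=
  dyadic_point R j (fun i => (k i)./2).

Let pt_cube j (k : {ffun 'I_n -> 'I_(2 ^ j.+1)}) : cube (pt k).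
Proof.
move=> i; rewrite mxE divr_ge0 ?exprn_ge0//= ler_pdivrMr ?exprn_gt0// mul1r.
by rewrite -natrX ler_nat ltnW.
Qed.

Let par_cube j (k : {ffun 'I_n -> 'I_(2 ^ j.+1)}) : cube (par k).
Proof.
move=> i; rewrite mxE divr_ge0 ?exprn_ge0//= ler_pdivrMr ?exprn_gt0// mul1r.
rewrite -natrX ler_nat -leq_double -(mul2n (2 ^ j)) -expnS.
apply: leq_trans (ltnW (ltn_ord (k i))).
by rewrite -[leqRHS]odd_double_half leq_addl.
Qed.

Let D j (k : {ffun 'I_n -> 'I_(2 ^ j.+1)}) w := G (pt k) w - G (par k) w.

Let mD j (k : {ffun 'I_n -> 'I_(2 ^ j.+1)}) : measurable_fun setT (D k).
Proof. by apply: measurable_funB; exact: mG. Qed.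

Let DE j (k : {ffun 'I_n -> 'I_(2 ^ j.+1)}) : Lone (fun w => wt w * D k w ^+ m.*2 / t j ^+ m.*2) /\
  Ex (fun w => wt w * D k w ^+ m.*2 / t j ^+ m.*2) <=
  K * ((2 ^+ j.+1)^-1) ^+ n.+2 / t j ^+ m.*2.
Proof.
have [] := GE (delta := (2 ^+ j.+1)^-1) (pt_cube k) (par_cube k).
- by rewrite invr_gt0 exprn_gt0.
- by rewrite invf_le1 ?exprn_gt0// exprn_ege1// ler1n.
- by move=> i; exact: dyadic_point_half.
move=> h1 h2; rewrite (_ : (fun w => _) =
  (fun w => (t j ^+ m.*2)^-1 * (wt w * D k w ^+ m.*2))); last first.
  by apply/funext => w; rewrite mulrC.
split; first exact: LoneZ.
by rewrite ExZ// mulrC ler_wpM2r// invr_ge0 exprn_ge0// ltW.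
Qed.

Let c : R := K * (m.*2.*2%:R / M) ^+ m.*2.

Let c_ge0 : 0 <= c.
Proof. by rewrite mulr_ge0// exprn_ge0// divr_ge0// ltW. Qed.

Let level_bound j :
  \sum_(k <- index_enum {ffun 'I_n -> 'I_(2 ^ j.+1)})
     K * ((2 ^+ j.+1)^-1) ^+ n.+2 / t j ^+ m.*2 <= c * (2^-1) ^+ j.+1.
Proof.
rewrite sumr_const card_ffun !card_ord -[leLHS]mulr_natl natrX natrX.
have tE : (t j ^+ m.*2)^-1 = (m.*2.*2%:R / M) ^+ m.*2 * ((q ^+ m.*2) ^+ j)^-1.
  have q1 : 1 - q = (m.*2.*2%:R)^-1 by rewrite /q opprB addrC subrK.
  rewrite /t q1 exprMn invfM exprAC; congr (_ * _).
  by rewrite -exprVn invfM invrK mulrC.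
rewrite tE /c.
have q2 : ((q ^+ m.*2) ^+ j)^-1 <= 2 ^+ j.
  rewrite -exprVn lerXn2r ?nnegrE ?invr_ge0 ?exprn_ge0 ?(ltW q_gt0)//.
  rewrite -[leRHS]invrK lef_pV2 ?posrE ?invr_gt0 ?exprn_gt0//.
  by apply: le_trans qp_ge; lra.
set C := (_ / M) ^+ _; have C0 : 0 <= C by rewrite exprn_ge0// divr_ge0// ltW.
have e2 : 2 ^+ j.+1 != 0 :> R by rewrite expf_neq0.
have -> : (2 ^+ j.+1) ^+ n * (K * (2 ^+ j.+1)^-1 ^+ n.+2 * (C * ((q ^+ m.*2) ^+ j)^-1))
   = K * C * ((2 ^+ j.+1)^-1 ^+ 2 * ((q ^+ m.*2) ^+ j)^-1).
  rewrite -[n.+2]addn2 exprD [X in X * _ ^+ 2]exprVn.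
  have : (2 ^+ j.+1) ^+ n != 0 :> R by rewrite !expf_neq0.
  move: ((2 ^+ j.+1) ^+ n : R) ((2 ^+ j.+1)^-1 ^+ 2 : R) (((q ^+ m.*2) ^+ j)^-1) => x y z x0.
  by field.
rewrite ler_wpM2l ?mulr_ge0//.
apply: (@le_trans _ _ ((2 ^+ j.+1)^-1 ^+ 2 * 2 ^+ j)).
  by rewrite ler_wpM2l// exprn_ge0// invr_ge0 exprn_ge0.
rewrite expr2 -mulrA exprVn -[leRHS]mulr1 ler_wpM2l ?invr_ge0 ?exprn_ge0//.
rewrite mulrC ler_pdivrMr ?exprn_gt0// mul1r exprS.
by rewrite ler_peMl ?exprn_ge0// ler1n.
Qed.

Let bad_level j : set T :=
  \big[setU/set0]_(k : {ffun 'I_n -> 'I_(2 ^ j.+1)}) [set w | t j < `|D k w|].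

Let bad_levelP j w : bad_level j w <->
  exists k : {ffun 'I_n -> 'I_(2 ^ j.+1)}, t j < `|D k w|.
Proof.
rewrite /bad_level -bigcup_seq; split=> [[k _ h]|[k h]]; exists k => //.
by rewrite /= mem_index_enum.
Qed.

Let measurable_bad_level j : measurable (bad_level j).
Proof.
apply: bigsetU_measurable => k _.
rewrite -[X in measurable X]setTI.
rewrite (_ : [set w | _] = (fun w => `|D k w|) @^-1` `]t j, +oo[); last first.
  by apply/seteqP; split => w /=; rewrite in_itv/= andbT.
exact: (measurable_norm (mD k)).
Qed.

Let bad : set T := \bigcup_j bad_level j.

Let measurable_bad : measurable bad.
Proof. exact: bigcupT_measurable. Qed.

Let H N w : R := \sum_(0 <= j < N) \sum_(k <- index_enum {ffun 'I_n -> 'I_(2 ^ j.+1)})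
  wt w * D k w ^+ m.*2 / t j ^+ m.*2.

Let H_bound N : Lone (H N) /\ Ex (H N) <= c.
Proof.
have [h1 h2] := @Ex_sum _ _ _ P nat (index_iota 0 N)
  (fun j w => \sum_(k <- index_enum {ffun 'I_n -> 'I_(2 ^ j.+1)})
    wt w * D k w ^+ m.*2 / t j ^+ m.*2)
  (fun j => \sum_(k <- index_enum {ffun 'I_n -> 'I_(2 ^ j.+1)})
     K * ((2 ^+ j.+1)^-1) ^+ n.+2 / t j ^+ m.*2)
  (fun j => Ex_sum _ (@DE j)).
split => //; apply: (le_trans h2).
apply: (@le_trans _ _ (\sum_(0 <= j < N) c * (2^-1) ^+ j.+1)).
  by apply: ler_sum => j _; exact: level_bound.
rewrite -mulr_sumr -[leRHS]mulr1 ler_wpM2l//.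
suff -> : \sum_(0 <= j < N) (2^-1) ^+ j.+1 = 1 - (2^-1) ^+ N :> R.
  by rewrite lerBlDr lerDl exprn_ge0.
elim: N {h1 h2} => [|N IH]; first by rewrite big_geq// expr0 subrr.
by rewrite big_nat_recr//= IH exprS; field.
Qed.

Let D_ge0 j (k : {ffun 'I_n -> 'I_(2 ^ j.+1)}) w :
  0 <= wt w * D k w ^+ m.*2 / t j ^+ m.*2.
Proof.
have /andP[w0 _] := wt01 w.
by rewrite divr_ge0 ?mulr_ge0 ?(exprn_ge0 _ (ltW (t_gt0 j)))// -mul2n exprM exprn_ge0// sqr_ge0.
Qed.

(** Markov's inequality and the union bound in pointwise form: on a bad level one of the nonnegative
    terms of [H] already exceeds the weight. *)
Let wt_le_H N j w : (j < N)%N -> bad_level j w -> wt w <= H N w.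
Proof.
move=> jN /bad_levelP[k tk]; have /andP[w0 _] := wt01 w.
rewrite /H big_mkord (bigD1 (Ordinal jN))//= (bigD1_seq k)/= ?mem_index_enum ?index_enum_uniq//.
rewrite -addrA; apply: (@le_trans _ _ (wt w * D k w ^+ m.*2 / t j ^+ m.*2)); last first.
  rewrite lerDl addr_ge0 ?sumr_ge0// => i _.
  by apply: sumr_ge0 => ? _; exact: D_ge0.
rewrite -mulrA ler_peMr// ler_pdivlMr ?exprn_gt0// mul1r.
have -> : D k w ^+ m.*2 = `|D k w| ^+ m.*2 by rewrite -!mul2n !exprM real_normK ?num_real.
by rewrite lerXn2r ?nnegrE ?(ltW tk)// ltW.
Qed.

Let Ex_bad : Ex (fun w => wt w * \1_bad w) <= c.
Proof.
pose F N w := wt w * \1_(\big[setU/set0]_(j < N) bad_level j) w.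
have ind01 (A : set T) w : 0 <= (\1_A w : R) <= 1.
  by rewrite indicE; case: (_ \in _); rewrite lexx ler01.
have mF N : measurable_fun setT (F N).
  apply: measurable_funM => //; apply: measurable_indic.
  by apply: bigsetU_measurable => j _.
have FF w : F N w @[N --> \oo] --> wt w * \1_bad w.
  apply: cvgM; first exact: cvg_cst.
  have [[j _ hj]|hb] := pselect (bad w).
    have hb : w \in bad by apply/mem_set; exists j.
    apply: cvg_near_cst; near=> N.
    rewrite !indicE hb mem_set// -bigcup_mkord; exists j => //=.
    by near: N; exact: nbhs_infty_gt.
  apply: cvg_near_cst; near=> N; rewrite !indicE !memNset//.
  by rewrite -bigcup_mkord => -[j _ hj]; apply: hb; exists j.
have FG N w : `|F N w| <= 1.
  have /andP[w0 w1] := wt01 w.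
  have /andP[i0 i1] := ind01 (\big[setU/set0]_(j < N) bad_level j) w.
  by rewrite ger0_norm ?mulr_ge0// mulr_ile1.
have [_ cF] := Ex_dct mF FF FG (Lone_cst P 1).
apply: (cvgr_to_le cF); near=> N.
have [iH Hc] := H_bound N; apply: le_trans Hc.
apply: Ex_le => // [|w]; first by apply: (Lone_dom (mF N) (FG N)); exact: Lone_cst.
rewrite /F indicE; case: (boolP (w \in _)) => [|_]; last first.
  by rewrite mulr0 sumr_ge0// => j _; apply: sumr_ge0 => k _; exact: D_ge0.
move/set_mem; rewrite mulr1 -bigcup_mkord => -[j jN hj]; exact: (wt_le_H jN hj).
Unshelve. all: by end_near. Qed.

(** The dyadic floors of [x] start at the corner 0, because the coordinates are strictly below 1,
    and tend to [x]. The increments telescope to at most [M], and continuity at [x] passes to the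
    limit. *)
Let good_bound w (x : 'rV[R]_n) : ~ bad w -> (forall i, 0 <= x 0 i < 1) ->
  `|G x w - G 0 w| <= M.
Proof.
move=> ngood x01; have x0 i : 0 <= x 0 i by have /andP[] := x01 i.
pose xj j := dyadic_point R j (dyadic_floor j x).
have fl j i : (dyadic_floor j x i < 2 ^ j)%N.
  have /andP[xi0 xi1] := x01 i.
  rewrite /dyadic_floor truncn_lt_nat ?mulr_ge0 ?exprn_ge0// natrX.
  by rewrite -[ltRHS]mulr1 ltr_pM2l ?exprn_gt0.
have xj0 : xj 0%N = 0.
  apply/rowP => i; rewrite !mxE; have := fl 0%N i.
  by rewrite expn0 ltnS leqn0 => /eqP ->; rewrite mul0r.
have step j : `|G (xj j.+1) w - G (xj j) w| <= t j.
  pose k : {ffun 'I_n -> 'I_(2 ^ j.+1)} := [ffun i => Ordinal (fl j.+1 i)].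
  have -> : xj j.+1 = pt k by apply/rowP => i; rewrite !mxE ffunE.
  have -> : xj j = par k.
    by apply/rowP => i; rewrite !mxE ffunE/= dyadic_floor_half.
  rewrite leNgt; apply/negP => h; apply: ngood; exists j => //.
  by apply/bad_levelP; exists k.
have tot j : `|G (xj j) w - G 0 w| <= M * (1 - q ^+ j).
  elim: j => [|j IH]; first by rewrite xj0 subrr normr0 expr0 subrr mulr0.
  rewrite -(subrKA (G (xj j) w)); apply: (le_trans (ler_normD _ _)).
  apply: (le_trans (lerD (step j) IH)); rewrite /t exprS.
  by apply/eqP/eqP; rewrite le_eqVlt; apply/orP; left; apply/eqP; ring.
have cx : cube x by move=> i; have /andP[? /ltW ?] := x01 i; apply/andP.
have xjx : xj j @[j --> \oo] --> x.
  apply/cvg_ballP => e e0; near=> j; split=> // i0 i; rewrite ord1.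
  rewrite /ball/= /ball_/=.
  have /andP[h1 h2] := @dyadic_point_floor R n j x i (x0 i).
  rewrite ger0_norm//; apply: le_lt_trans h2 _.
  rewrite -exprVn; near: j.
  have hc : (2^-1 : R) ^+ j @[j --> \oo] --> (0 : R) by apply: cvg_expr; rewrite ger0_norm; lra.
  move/cvgrPdist_lt : hc => /(_ e e0); apply: filterS => j.
  by rewrite sub0r normrN ger0_norm ?exprn_ge0.
have cG' : `|G (xj j) w - G 0 w| @[j --> \oo] --> `|G x w - G 0 w|.
  apply: cvg_norm; apply: cvgB; last exact: cvg_cst.
  exact: (cvg_comp _ (fun y => G y w) xjx (@cG w x cx)).
apply: (cvgr_to_le cG'); near=> j; apply: (le_trans (tot j)).
rewrite -[leRHS]mulr1 ler_wpM2l ?(ltW M_gt0)// lerBlDr lerDl exprn_ge0//.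
exact: ltW.
Unshelve. all: by end_near. Qed.

Lemma chaining : exists Bad : set T,
  [/\ measurable Bad, Ex (fun w => wt w * \1_Bad w) <= K * (m.*2.*2%:R / M) ^+ m.*2 &
   forall w (x : 'rV[R]_n), ~ Bad w -> (forall i, 0 <= x 0 i < 1) -> `|G x w - G 0 w| <= M].
Proof. by exists bad; split => // w x; exact: good_bound. Qed.

End chaining.

(** * Measurability of the event *)

Section component_separation.

(** If every member of [D] left [O], the sets [A] minus [O] would generate a proper filter on the
    compact [Y]. Its cluster point would lie in every [A] but not in [O]. *)
Lemma directed_compact_subset (T : topologicalType) (Y O : set T)
    (D : set (set T)) :
  compact Y -> D !=set0 -> (forall A B, D A -> D B -> D (A `&` B)) ->
  (forall A, D A -> closed A /\ A `<=` Y) -> open O ->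
  \bigcap_(A in D) A `<=` O -> exists2 A, D A & A `<=` O.
Proof.
move=> cY [A0 DA0] DI Dc oO DO; apply: contrapT => noA.
have ne A : D A -> (A `\` O) !=set0.
  move=> DA; apply/set0P/eqP; rewrite setD_eq0 => AO.
  by apply: noA; exists A.
pose F := filter_from D (fun A => A `\` O).
have FF : ProperFilter F.
  apply: filter_from_proper; last exact: ne.
  apply: filter_from_filter; first by exists A0.
  move=> A B DA DB; exists (A `&` B); first exact: DI.
  by move=> x [[Ax Bx] Ox].
have FY : F Y by exists A0 => // x [A0x _]; exact: (Dc _ DA0).2.
have [p [Yp clp]] := cY F FF FY.
have clD A : D A -> (A `\` O) p.
  move=> DA; have cl : closed (A `\` O).
    by apply: closedI; [exact: (Dc _ DA).1|exact: open_closedC].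
  rewrite ((closure_id _).1 cl) => B pB.
  by apply: clp => //; exists A.
by have [_] := clD _ DA0; apply; apply: DO => A /clD[].
Qed.

(* Sura-Bura: in a compact set, components are intersections of clopen sets. *)
Lemma component_separation (R : realType) (T : pseudoMetricType R)
    (Y O : set T) (x : T) :
  closed Y -> compact Y -> Y x -> open O -> connected_component Y x `<=` O ->
  exists A, [/\ A `<=` Y, closed A, closed (Y `\` A), A x & A `<=` O].
Proof.
move=> clY cY Yx oO KO.
pose D := [set A | [/\ A `<=` Y, closed A, closed (Y `\` A) & A x]].
have DY : D Y by split => //; rewrite setDv; exact: closed0.
have DI A B : D A -> D B -> D (A `&` B).
  move=> [AY cA cA' Ax] [BY cB cB' Bx]; split => //.
  - by move=> z [/AY].
  - exact: closedI.
  - by rewrite setDIr; exact: closedU.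
have Dc A : D A -> closed A /\ A `<=` Y by move=> [].
have D0 : D !=set0 by exists Y.
pose Q := \bigcap_(A in D) A.
have Qx : Q x by move=> A [].
have QY : Q `<=` Y by move=> z; apply.
have clQ : closed Q by apply: closed_bigI => A [].
suff cQ : connected Q.
  have QO : Q `<=` O by apply: subset_trans KO; exact: connected_component_max.
  have [A [AY cA cA' Ax] AO] := directed_compact_subset cY D0 DI Dc oO QO.
  by exists A.
apply: contrapT => /connectedPn[E [E0 EU [sep1 sep2]]].
wlog E0x : E E0 EU sep1 sep2 / E false x.
  move=> wl; have := Qx; rewrite EU => -[Ex|Ex]; first exact: (wl E).
  apply: (wl (fun b => E (~~ b))) => //=.
  - by rewrite setUC.
  - by rewrite setIC.
  - by rewrite setIC.
have clE b : closed (E b).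
  rewrite closure_id; apply/seteqP; split; first exact: subset_closure.
  move=> z cz; have : Q z.
    rewrite (closure_id Q).1//; apply: closure_subset cz.
    by rewrite EU; case: b => ? ?; [right|left].
  rewrite EU; case: b cz => cz [] // Ez; exfalso.
  - by have : (E false `&` closure (E true)) z by []; rewrite sep2.
  - by have : (closure (E false) `&` E true) z by []; rewrite sep1.
have E01 : E false `&` E true = set0.
  by rewrite -sep1; congr (_ `&` _); apply: (closure_id _).1.
have [U [V [oU oV EU' EV UV]]] : exists U V, [/\ open U, open V, E false `<=` U,
    E true `<=` V & U `&` V = set0].
  have := (@normal_openP R T).1 (@pseudometric_normal R T) _ _ (clE false) (clE true) E01.
  by move=> [U [V [*]]]; exists U, V.
have QUV : Q `<=` U `|` V by rewrite EU; move=> z [/EU'|/EV]; [left|right].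
have [A [AY cA cA' Ax] AUV] := directed_compact_subset cY D0 DI Dc (openU oU oV) QUV.
(* Cutting the clopen set [A] by [U] is the same as removing [V], so the result is again clopen and
   contains [x]. Hence it contains [Q], which contradicts the nonempty part of [Q] lying in [V]. *)
have AU : A `&` U = A `&` ~` V.
  apply/seteqP; split=> z [Az h]; split=> //.
  - by move=> Vz; have : (U `&` V) z by []; rewrite UV.
  - by case: (AUV _ Az).
have DAU : D (A `&` U).
  split; first by move=> z [/AY].
  - by rewrite AU; apply: closedI => //; exact: open_closedC.
  - rewrite setDIr; apply: closedU => //.
    have -> : Y `\` U = Y `&` ~` U by [].
    by apply: closedI => //; exact: open_closedC.
  - by split => //; apply: EU'.
have [z Ez] := E0 true.
have [_ Uz] : (A `&` U) z by have : Q z by [rewrite EU; right]; apply.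
by have : (U `&` V) z by [split=> //; exact: EV]; rewrite UV.
Qed.

End component_separation.

Section euclidean.
Variables (R : realType) (n : nat).
Implicit Types (x y z : 'rV[R]_n) (r e : R).

Lemma enorm_continuous : continuous (@enorm R n).
Proof.
move=> x; apply: (@continuous_comp _ _ _ (fun x : 'rV[R]_n => \sum_(i < n) x 0 i ^+ 2) Num.sqrt).
  apply: cvg_big; [exact: add_continuous|exact: nbhs_filter|move=> i _].
  apply: (@continuous_comp _ _ _ (fun x : 'rV[R]_n => x 0 i) (fun t : R => t ^+ 2)).
    exact: coord_continuous.
  exact: exprn_continuous.
exact: sqrt_continuous.
Qed.

Lemma enorm_ge0 x : 0 <= enorm x. Proof. exact: sqrtr_ge0. Qed.

Lemma enorm_sqr x : enorm x ^+ 2 = \sum_(i < n) x 0 i ^+ 2.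
Proof. by rewrite /enorm sqr_sqrtr// sumr_ge0// => i _; exact: sqr_ge0. Qed.

Lemma coord_le_enorm x i : `|x 0 i| <= enorm x.
Proof.
rewrite -(@ler_pXn2r _ 2) ?nnegrE ?enorm_ge0// enorm_sqr real_normK ?num_real//.
by rewrite (bigD1 i)//= lerDl sumr_ge0// => j _; exact: sqr_ge0.
Qed.

Lemma enormZ (c : R) x : enorm (c *: x) = `|c| * enorm x.
Proof.
rewrite /enorm -sqrtr_sqr -sqrtrM ?sqr_ge0//; congr Num.sqrt.
by rewrite mulr_sumr; apply: eq_bigr => i _; rewrite mxE exprMn.
Qed.

Lemma open_eball r : open (eball (0 : 'rV[R]_n) r).
Proof.
rewrite (_ : eball 0 r = @enorm R n @^-1` [set t | t < r]).
  by apply: open_comp; [move=> x _; exact: enorm_continuous|exact: open_lt].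
by apply/seteqP; split=> x; rewrite /eball/= subr0.
Qed.

Lemma closed_closed_eball r : closed (closed_eball (0 : 'rV[R]_n) r).
Proof.
rewrite (_ : closed_eball 0 r = @enorm R n @^-1` [set t | t <= r]).
  by apply: preimage_closed; [move=> x _; exact: enorm_continuous|exact: closed_le].
by apply/seteqP; split=> x; rewrite /closed_eball/= subr0.
Qed.

Lemma compact_closed_eball r : compact (closed_eball (0 : 'rV[R]_n) r).
Proof.
apply: bounded_closed_compact; last exact: closed_closed_eball.
exists (Num.max r 0); split; first exact: num_real.
move=> M hM x; rewrite /closed_eball/= subr0 => xr.
have M0 : 0 <= M by apply: le_trans (ltW hM); rewrite le_max lexx orbT.
change (mx_norm x <= M); rewrite mx_normrE; apply/bigmax_leP; split=> // -[i j] _ /=.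
rewrite ord1; apply: (le_trans (coord_le_enorm x j)); apply: (le_trans xr).
by apply: le_trans (ltW hM); rewrite le_max lexx.
Qed.

Definition open_box y e : set 'rV[R]_n := [set z | forall i, `|z 0 i - y 0 i| < e].
Definition closed_box y e : set 'rV[R]_n := [set z | forall i, `|z 0 i - y 0 i| <= e].

Lemma nbhs_box y (A : set 'rV[R]_n) : nbhs y A <->
  exists2 e, 0 < e & open_box y e `<=` A.
Proof.
split=> [/nbhs_ballP[e e0 eA]|[e e0 eA]].
  exists e => // z hz; apply: eA; split=> // i j; rewrite ord1.
  by rewrite /ball/= distrC.
apply/nbhs_ballP; exists e => // z [_ hz]; apply: eA => i.
by have := hz 0 i; rewrite /ball/= distrC.
Qed.

Lemma open_open_box y e : 0 < e -> open (open_box y e).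
Proof.
move=> e0; have -> : open_box y e = ball y e; last exact: ball_open.
apply/seteqP; split=> z; last by move=> [_ hz] i; have := hz 0 i; rewrite /ball/= distrC.
by move=> hz; split=> // i j; rewrite ord1 /ball/= distrC.
Qed.

Lemma closed_closed_box y e : closed (closed_box y e).
Proof.
rewrite (_ : closed_box y e = \bigcap_i [set z : 'rV[R]_n | `|z 0 i - y 0 i| <= e]).
  apply: closed_bigI => i _.
  apply: (@preimage_closed _ _ (fun z : 'rV[R]_n => `|z 0 i - y 0 i|) [set t | t <= e]);
    last exact: closed_le.
  move=> z _; apply: (@continuous_comp _ _ _ (fun z : 'rV[R]_n => z 0 i)
    (fun t : R => `|t - y 0 i|)); first exact: coord_continuous.
  by apply: cvg_norm; apply: cvgB; [exact: cvg_id|exact: cvg_cst].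
by apply/seteqP; split=> [z h i _|z h i]; [exact: h|exact: (h i I)].
Qed.

Lemma open_box_closed_box y e : open_box y e `<=` closed_box y e.
Proof. by move=> z h i; exact: ltW. Qed.

Definition ratv (q : 'rV[rat]_n) : 'rV[R]_n := map_mx ratr q.

Lemma ratv_dense y e : 0 < e -> exists q, open_box y e (ratv q).
Proof.
move=> e0.
have h i : exists q : rat, `|ratr q - y 0 i| < e.
  have /rat_in_itvoo[q] : y 0 i - e < y 0 i + e by lra.
  by rewrite in_itv/= => ?; exists q; rewrite ltr_distl.
exists (\row_i sval (cid (h i))) => i; rewrite !mxE.
exact: (svalP (cid (h i))).
Qed.

End euclidean.

Section random_zero_sets.
Context (R : realType) (d : measure_display) (T : measurableType d) (n : nat).
Variables (U : set 'rV[R]_n) (g : 'rV[R]_n -> T -> R).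
Hypothesis oU : open U.
Hypothesis mg : forall x, U x -> measurable_fun setT (g x).
Hypothesis cg : continuous_field U g.

Lemma continuous_field_at w x : U x -> {for x, continuous (fun y => g y w)}.
Proof.
by move=> Ux; have := @cg w; rewrite continuous_open_subspace// => /(_ x); apply; rewrite inE.
Qed.

Let eps k : R := k.+1%:R^-1.

Let eps_gt0 k : 0 < eps k. Proof. by rewrite invr_gt0. Qed.

Let eps_small (e : R) : 0 < e -> \forall k \near \oo, eps k < e.
Proof.
move=> e0; have /cvgrPdist_lt/(_ e e0) := @cvg_harmonic R.
by apply: filterS => k; rewrite sub0r normrN ger0_norm// invr_ge0.
Qed.

(** By compactness and continuity, absence of zeros on [C] means that for some k the field is at
    least [eps k] at all rational points of [U] within [eps k] of [C]. A neighbourhood is used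
    because [C] itself may contain no rational point. *)
Lemma measurable_zero_free (C : set 'rV[R]_n) : compact C -> C `<=` U ->
  measurable [set w | forall y, C y -> g y w != 0].
Proof.
move=> cC CU.
pose close k q := U (ratv R q) /\ exists2 y, C y & open_box y (eps k) (ratv R q).
pose N k := \bigcup_(q in close k) [set w | `|g (ratv R q) w| < eps k].
have -> : [set w | forall y, C y -> g y w != 0] = \bigcup_k ~` N k.
  apply/seteqP; split=> [w nz|w [k _ Nk] y Cy].
    have := (compact_near_coveringP C).1 cC nat \oo
      (fun k x' => forall z, open_box x' (eps k) z -> U z -> eps k <= `|g z w|) _.
    case=> [|K _ hK].
      move=> x Cx; have gx := nz _ Cx.
      have gx0 : 0 < `|g x w| / 2 by rewrite divr_gt0 ?normr_gt0.
      have /cvgrPdist_lt/(_ _ gx0)/nbhs_box[e e0 he] := @continuous_field_at w _ (CU _ Cx).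
      exists (open_box x (e / 2), [set k | eps k < Num.min (e / 2) (`|g x w| / 2)]).
        split; first by apply/nbhs_box; exists (e / 2) => //; rewrite divr_gt0.
        by apply: eps_small; rewrite lt_min gx0 divr_gt0.
      move=> [x' k] [/= hx' +] z hz Uz; rewrite lt_min => /andP[k1 k2].
      have /he/= hg : open_box x e z.
        move=> i; rewrite -(subrKA (x' 0 i)); apply: (le_lt_trans (ler_normD _ _)).
        have := hx' i; have := hz i; lra.
      have : `|g x w| <= `|g x w - g z w| + `|g z w|.
        by rewrite -{1}(subrK (g z w) (g x w)) ler_normD.
      by lra.
    exists K => // -[q [Uq [y Cy qy]] /=]; rewrite ltNge; apply/negP/negPn.
    exact: (hK K (leqnn K) y Cy _ qy Uq).
  apply/eqP => gy0.
  have /cvgrPdist_lt/(_ _ (eps_gt0 k))/nbhs_box[e e0 he] := @continuous_field_at w _ (CU _ Cy).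
  have /nbhs_box[e' e'0 he'] : nbhs y U by apply: open_nbhs_nbhs; split=> //; exact: CU.
  have m0 : 0 < Num.min (Num.min e e') (eps k) by rewrite !lt_min e0 e'0 eps_gt0.
  have [q hq] := ratv_dense y m0.
  apply: Nk; exists q; first split.
  - by apply: he' => i; have := hq i; rewrite !lt_min => /andP[/andP[]].
  - by exists y => // i; have := hq i; rewrite !lt_min => /andP[].
  - have /he/= : open_box y e (ratv R q).
      by move=> i; have := hq i; rewrite !lt_min => /andP[/andP[]].
    by rewrite gy0 sub0r normrN.
apply: bigcupT_measurable => k; apply: measurableC.
rewrite /N bigcup_mkcond; apply: countable_bigcupT_measurable => [|q]; first exact: countableP.
case: ifPn => [|_]; last exact: measurable0.
rewrite inE => -[Uq _]; rewrite -[X in measurable X]setTI.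
rewrite (_ : [set w | _] = (fun w => `|g (ratv R q) w|) @^-1` `]-oo, eps k[); last first.
  by apply/seteqP; split => w /=; rewrite in_itv.
exact: (measurable_norm (mg Uq)).
Qed.

Definition closed_boxes (F : seq 'rV[rat]_n) (e : R) : set 'rV[R]_n :=
  \big[setU/set0]_(q <- F) closed_box (ratv R q) e.

Definition open_boxes (F : seq 'rV[rat]_n) (e : R) : set 'rV[R]_n :=
  \big[setU/set0]_(q <- F) open_box (ratv R q) e.

Lemma closed_boxesP F e y : closed_boxes F e y <->
  exists2 q, q \in F & closed_box (ratv R q) e y.
Proof. by rewrite /closed_boxes -bigcup_seq; split=> [[q]|[q]]; exists q. Qed.

Lemma open_boxesP F e y : open_boxes F e y <->
  exists2 q, q \in F & open_box (ratv R q) e y.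
Proof. by rewrite /open_boxes -bigcup_seq; split=> [[q]|[q]]; exists q. Qed.

Lemma closed_closed_boxes F e : closed (closed_boxes F e).
Proof. by apply: closed_bigsetU => q _; exact: closed_closed_box. Qed.

Lemma open_open_boxes F e : 0 < e -> open (open_boxes F e).
Proof.
move=> e0; rewrite (_ : open_boxes F e = \bigcup_(q in [set` F]) open_box (ratv R q) e).
  by apply: bigcup_open => q _; exact: open_open_box.
by rewrite /open_boxes -bigcup_seq.
Qed.

Variable r : R.
Hypothesis rU : closed_eball 0 r `<=` U.

Let eballU : eball 0 r `<=` U.
Proof. by apply: subset_trans rU => x; exact: ltW. Qed.

(* A component inside the open ball is isolated from the rest of the zero set by
   a finite union of rational boxes, so the event is a countable union of events
   "no zero in the shell around the boxes, some zero in the boxes". *)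
Let shell F k := closed_boxes F (eps k *+ 2) `\` open_boxes F (eps k).

Let event F k := [set w | forall y, shell F k y -> g y w != 0] `&`
  ~` [set w | forall y, closed_boxes F (eps k) y -> g y w != 0].

Let closed_boxes_le F e e' : e <= e' -> closed_boxes F e `<=` closed_boxes F e'.
Proof.
move=> ee y /closed_boxesP[q qF hy]; apply/closed_boxesP; exists q => // i.
exact: le_trans (hy i) ee.
Qed.

Let eps2 k : eps k <= eps k *+ 2.
Proof. by rewrite mulr2n lerDl ltW. Qed.

Let open_closed_boxes F e : open_boxes F e `<=` closed_boxes F e.
Proof.
move=> y /open_boxesP[q qF hy]; apply/closed_boxesP; exists q => //.
exact: open_box_closed_box.
Qed.

Let measurable_event F k : closed_boxes F (eps k *+ 2) `<=` eball 0 r ->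
  measurable (event F k).
Proof.
move=> Fr; have FR : closed_boxes F (eps k *+ 2) `<=` closed_eball 0 r.
  by apply: subset_trans Fr _ => x; exact: ltW.
have cc C : closed C -> C `<=` closed_boxes F (eps k *+ 2) -> compact C /\ C `<=` U.
  move=> clC CF; split; last by apply: subset_trans CF _; exact: subset_trans FR _.
  apply: (subclosed_compact clC (@compact_closed_eball R n r)).
  exact: subset_trans CF _.
apply: measurableI.
  have [||h1 h2] := cc (shell F k).
  - apply: closedI; first exact: closed_closed_boxes.
    exact/open_closedC/open_open_boxes.
  - by move=> y [].
  exact: measurable_zero_free.
have [||h1 h2] := cc (closed_boxes F (eps k)).
- exact: closed_closed_boxes.
- exact: (closed_boxes_le (eps2 k)).
by apply: measurableC; exact: measurable_zero_free.
Qed.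

(** With no zero in the shell, the zeros in the large closed boxes are exactly those in the small
    open ones. The trace of the boxes on the component is thus open, closed and nonempty, hence the
    whole component. *)
Let event_component F k w : closed_boxes F (eps k *+ 2) `<=` eball 0 r ->
  event F k w -> component_event U g r w.
Proof.
move=> Fr [shell0 zero].
have [x Fx gx] : exists2 x, closed_boxes F (eps k) x & g x w = 0.
  apply: contrapT => h; apply: zero => y Fy; apply/eqP => gy.
  by apply: h; exists y.
have F2 y : zero_set U g w y -> closed_boxes F (eps k *+ 2) y -> open_boxes F (eps k) y.
  move=> [_ gy] Fy; apply: contrapT => nFy.
  by have := shell0 y (conj Fy nFy); rewrite gy eqxx.
have Zx : zero_set U g w x 
  by split=> //; apply: eballU; apply: Fr; exact: (closed_boxes_le (eps2 k)).
exists x; split => //; set K := connected_component _ _.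
have KZ : K `<=` zero_set U g w by exact: connected_component_sub.
have Kx : K x by exact: connected_component_refl.
have KF : K `&` open_boxes F (eps k) = K.
  apply: (@component_connected _ (zero_set U g w) x).
  - by exists x; split=> //; apply: F2 => //; exact: (closed_boxes_le (eps2 k)).
  - by exists (open_boxes F (eps k)) => //; exact: open_open_boxes.
  - exists (closed_boxes F (eps k *+ 2)); first exact: closed_closed_boxes.
    apply/seteqP; split=> y [Ky Fy]; split=> //.
      exact/(closed_boxes_le (eps2 k))/open_closed_boxes.
    by apply: F2 => //; exact: KZ.
move=> y; rewrite -/K -KF => -[_ Fy].
exact/Fr/(closed_boxes_le (eps2 k))/open_closed_boxes.
Qed.

(** Separation in the compact set [Y] of zeros in the closed ball gives a clopen [A] around the
    component and inside the open ball. Being compact, [A] stays away from [B], the other zeros and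
    the exterior, so small boxes covering [A] avoid [B]. *)
Let component_event_boxes w : component_event U g r w ->
  exists F k, closed_boxes F (eps k *+ 2) `<=` eball 0 r /\ event F k w.
Proof.
move=> [x [Zx Kr]].
have xr : eball 0 r x by apply: Kr; exact: connected_component_refl.
pose Y := closed_eball 0 r `&` [set y | g y w = 0].
have clY : closed Y.
  move=> p clp.
  have pr : closed_eball 0 r p.
    rewrite ((closure_id _).1 (@closed_closed_eball R n r)).
    by apply: closure_subset clp; exact: subIsetl.
  split=> //=; apply/eqP; apply: contrapT => /negP gp.
  have gp0 : 0 < `|g p w| by rewrite normr_gt0.
  have /cvgrPdist_lt/(_ _ gp0) hp := @continuous_field_at w _ (rU pr).
  have [y [[_ /= gy] /=]] := clp _ hp.
  by rewrite gy subr0 ltxx.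
have cY : compact Y.
  by apply: (subclosed_compact clY (@compact_closed_eball R n r)); exact: subIsetl.
have Yx : Y x by split; [exact: ltW|exact: Zx.2].
have KY : connected_component Y x `<=` eball 0 r.
  apply: subset_trans Kr => y [C [Cx CY cC] Cy]; exists C => //; split=> //.
  by move=> z /CY[zr gz]; split=> //; exact: rU.
have [A [AY clA clYA Ax Ar]] := component_separation clY cY Yx (@open_eball R n r) KY.
pose B := (Y `\` A) `|` ~` eball 0 r.
have oB : open (~` B).
  apply: closed_openC; apply: closedU => //; apply: open_closedC; exact: open_eball.
have AB y : A y -> (~` B) y by move=> Ay [[_]|]; [exact|apply; exact: Ar].
have cA : compact A.
  by apply: (subclosed_compact clA cY).
(* The centres of the boxes lie within [eps k] of [A] and the large boxes have half-width
   [eps k *+ 2], hence the factor 3. *)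
have [k hk] : exists k, forall y, A y -> forall z, closed_box y (eps k *+ 3) z -> ~ B z.
  have := (compact_near_coveringP A).1 cA nat \oo
    (fun k y => forall z, closed_box y (eps k *+ 3) z -> ~ B z) _.
  case=> [|K _ hK]; last by exists K => y; exact: (hK K (leqnn K)).
  move=> y Ay.
  have /nbhs_box[e e0 he] : nbhs y (~` B) by apply: open_nbhs_nbhs; split=> //; exact: AB.
  exists (open_box y (e / 2), [set k | eps k < e / 6]).
    split; first by apply/nbhs_box; exists (e / 2) => //; rewrite divr_gt0.
    by apply: eps_small; rewrite divr_gt0.
  move=> [y' k] [/= hy' hk] z hz; apply: he => i.
  rewrite -(subrKA (y' 0 i)); apply: (le_lt_trans (ler_normD _ _)).
  by have := hy' i; have := hz i; rewrite -(mulr_natl (eps k) 3); lra.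
have [F FA AF] : exists2 F : seq 'rV[rat]_n,
    (forall q, q \in F -> exists2 y, A y & open_box y (eps k) (ratv R q)) &
    A `<=` open_boxes F (eps k).
  have := cA; rewrite compact_cover => /(_ _
    [set q | exists2 y, A y & open_box y (eps k) (ratv R q)]
    (fun q => open_box (ratv R q) (eps k))) [||D' hD' AD'].
  - by move=> q _; exact: open_open_box.
  - move=> y Ay; have [q hq] := ratv_dense y (eps_gt0 k).
    exists q; first by exists y.
    by move=> i; rewrite distrC; exact: hq.
  exists (finmap.enum_fset D') => [q qD'|y /AD'[q qD' hy]].
    by have := hD' q qD'; rewrite inE.
  by apply/open_boxesP; exists q.
have hB y : closed_boxes F (eps k *+ 2) y -> ~ B y.
  move=> /closed_boxesP[q qF hy]; have [y0 Ay0 hq] := FA q qF.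
  apply: (hk y0 Ay0) => i; rewrite -(subrKA (ratv R q 0 i)).
  apply: (le_trans (ler_normD _ _)).
  by have := hy i; have := hq i; rewrite -(mulr_natl (eps k) 2) -(mulr_natl (eps k) 3); lra.
have Fr : closed_boxes F (eps k *+ 2) `<=` eball 0 r.
  by move=> y /hB nB; apply: contrapT => ny; apply: nB; right.
exists F, k; split=> //; split.
  move=> y [Fy nFy]; apply/eqP => gy; apply: nFy; apply: AF.
  apply: contrapT => nAy; apply: (hB _ Fy); left; split=> //.
  by split=> //; exact/ltW/Fr.
move=> /(_ x); rewrite Zx.2 eqxx => /(_ _)/negP; apply => //.
exact/open_closed_boxes/AF.
Qed.

Lemma measurable_component_event : measurable (component_event U g r).
Proof.
rewrite (_ : component_event U g r = \bigcup_k \bigcup_(F in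
    [set F : seq 'rV[rat]_n | closed_boxes F (eps k *+ 2) `<=` eball 0 r]) event F k).
  apply: bigcupT_measurable => k; rewrite bigcup_mkcond.
  apply: countable_bigcupT_measurable => [|F]; first exact: countableP.
  case: ifPn => [|_]; last exact: measurable0.
  by rewrite inE => hF; exact: measurable_event.
apply/seteqP; split=> [w /component_event_boxes[F [k [hF ew]]]|w [k _ [F hF ew]]].
  by exists k => //; exists F.
exact: event_component ew.
Qed.

End random_zero_sets.

(** * The field at a fixed scale *)

Section nodal_component.
Context (R : realType) (d : measure_display) (T : measurableType d) (n : nat).
Variables (U : set 'rV[R]_n) (g : 'rV[R]_n -> T -> R).
Hypothesis oU : open U.
Hypothesis cg : continuous_field U g.

Lemma enorm_delta (r : R) (i : 'I_n) : 0 <= r ->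
  enorm (r *: delta_mx 0 i : 'rV[R]_n) = r.
Proof.
move=> r0; rewrite enormZ ger0_norm// /enorm (bigD1 i)//= big1 => [|j ji].
  by rewrite mxE !eqxx addr0 expr1n sqrtr1 mulr1.
by rewrite mxE (negbTE ji) andbF expr0n.
Qed.

Lemma component_event_sphere (r r1 : R) w : (0 < n)%N -> 0 < r1 -> r1 < r ->
  closed_eball 0 r1 `<=` U -> 0 < g 0 w ->
  (forall y, enorm y = r1 -> g y w < 0) -> component_event U g r w.
Proof.
move=> n0 r10 r1r rU g0 gS.
have cgU y : enorm y <= r1 -> {for y, continuous (fun y => g y w)}.
  by move=> yr; apply: (continuous_field_at oU cg); apply: rU; rewrite /closed_eball/= subr0.
pose z : 'rV[R]_n := r1 *: delta_mx 0 (Ordinal n0).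
have zr : enorm z = r1 by apply: enorm_delta; exact: ltW.
have tz t : 0 <= t -> enorm (t *: z) = t * r1 by move=> t0; rewrite enormZ ger0_norm// zr.
have [||c] := @IVT R (fun t => g (t *: z) w) 0 1 0 ler01.
- apply: continuous_in_subspaceT => t; rewrite inE/= in_itv/= => /andP[t0 t1].
  apply: (@continuous_comp _ _ _ (fun t : R => t *: z) (fun y => g y w)).
    exact: scalel_continuous.
  by apply: cgU; rewrite tz// ler_piMl// ltW.
- rewrite scale0r scale1r; apply/andP; split.
    by rewrite ge_min; apply/orP; right; apply/ltW/gS.
  by rewrite le_max; apply/orP; left; exact: ltW.
rewrite in_itv/= => /andP[c0 c1] gc.
pose x := c *: z.
have xr : enorm x < r1.
  have : enorm x <= r1 by rewrite tz// ler_piMl// ltW.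
  rewrite le_eqVlt => /predU1P[xr|//].
  by have := gS _ xr; rewrite gc ltxx.
have Zx : zero_set U g w x.
  by split=> //; apply: rU; rewrite /closed_eball/= subr0 ltW.
exists x; split=> //; set K := connected_component _ _.
have KZ : K `<=` zero_set U g w by exact: connected_component_sub.
have Kx : K x by exact: connected_component_refl.
(* Since [g] is negative on the sphere, the open and the closed ball have the same trace on the zero
   set. *)
have KB : K `&` eball 0 r1 = K.
  apply: (@component_connected _ (zero_set U g w) x).
  - by exists x; split=> //; rewrite /eball/= subr0.
  - by exists (eball 0 r1) => //; exact: open_eball.
  - exists (closed_eball 0 r1); first exact: closed_closed_eball.
    apply/seteqP; split=> y [Ky yr]; split=> //; first exact: ltW.
    move: yr; rewrite /eball /closed_eball/= subr0 le_eqVlt => /predU1P[yr1|//].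
    by have := gS _ yr1; have [_ ->] := KZ _ Ky; rewrite ltxx.
by move=> y; rewrite -/K -KB /eball/= subr0 => -[_ yr]; exact: lt_trans r1r.
Qed.

End nodal_component.

Section field_space.
Context (R : realType) (d : measure_display) (T : measurableType d)
  (P : probability T R) (n : nat).
Variables (U : set 'rV[R]_n) (g : 'rV[R]_n -> T -> R).
Hypothesis Gg : gaussian_field P U g.
Hypothesis Cg : centered_field P U g.

Local Notation Lone := (@Lone R d T P).
Local Notation Ex := (@Ex R d T P).

Definition field_space : set (T -> R) :=
  [set X | exists k (x : 'I_k -> 'rV[R]_n) (c : 'I_k -> R),
     (forall i, U (x i)) /\ X = (fun w => \sum_(i < k) c i * g (x i) w)].

Lemma field_space_point x : U x -> field_space (g x).
Proof.
move=> Ux; exists 1%N, (fun=> x), (fun=> 1); split=> //.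
by apply/funext => w; rewrite big_ord1 mul1r.
Qed.

Lemma field_space_law X : field_space X -> exists m s, has_gaussian_law P X m s.
Proof.
move=> [k [x [c [Ux ->]]]]; have [mX [m [s [s0 lawX]]]] := Gg c Ux.
by exists m, s.
Qed.

Lemma field_point_mean x : U x -> Lone (g x) /\ Ex (g x) = 0.
Proof.
move=> Ux; have [m [s GX]] := field_space_law (field_space_point Ux).
have iX := gaussian_law_Lone GX; split=> //.
by have := Cg Ux; rewrite unlock (EFin_Ex iX) => -[].
Qed.

(** The hypothesis leaves the mean of a linear combination unspecified; [gaussian_mean] and
    linearity of the expectation identify it with 0. *)
Lemma field_gaussian_space : gaussian_space P field_space.
Proof.
split=> [X SX|X Y p q [k [x [c [Ux ->]]]] [l [y [e [Uy ->]]]]]; last first.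
  exists (k + l)%N, (fun i => match fintype.split i with inl j => x j | inr j => y j end),
   (fun i => match fintype.split i with inl j => p * c j | inr j => q * e j end); split.
    by move=> i; case: fintype.split => j.
  apply/funext => w; rewrite big_split_ord/=; congr (_ + _).
    rewrite mulr_sumr; apply: eq_bigr => i _.
    case: splitP => j /= ij; first by rewrite (val_inj ij) mulrA.
    by exfalso; have := ltn_ord i; rewrite ij ltnNge leq_addr.
  rewrite mulr_sumr; apply: eq_bigr => i _.
  case: splitP => j /= ij; last by rewrite (val_inj (addnI ij)) mulrA.
  by exfalso; have := ltn_ord j; rewrite -ij ltnNge leq_addr.
have [m [s GX]] := field_space_law SX; exists s.
suff e0 : Ex X = 0 by have := GX; rewrite -(gaussian_mean GX) e0.
case: SX => k [x [c [Ux ->]]].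
suff : Lone (fun w => \sum_(i < k) c i * g (x i) w) /\
    Ex (fun w => \sum_(i < k) c i * g (x i) w) = 0 by case.
elim: (index_enum _) => [|i r [IH1 IH2]].
  rewrite (_ : (fun w => _) = fun=> 0); last by apply/funext => w; rewrite big_nil.
  by split; [exact: Lone_cst|rewrite Ex_cst].
rewrite (_ : (fun w => _) = (fun w => c i * g (x i) w + \sum_(i <- r) c i * g (x i) w)); last first.
  by apply/funext => w; rewrite big_cons.
have [i1 e1] := field_point_mean (Ux i).
split; first by apply: LoneD => //; exact: LoneZ.
by rewrite ExD ?ExZ ?e1 ?mulr0 ?add0r//; exact: LoneZ.
Qed.

End field_space.

Section log_plus.
Variable R : realType.
Implicit Types t : R.

Lemma ln_plus0 : ln_plus (0 : R) = 0.
Proof. by rewrite /ln_plus ltxx. Qed.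

Lemma ln_plus_ge1 t : 1 <= t -> ln_plus t = ln t.
Proof.
move=> t1; have t0 : 0 < t by apply: lt_le_trans t1.
by rewrite /ln_plus t0; apply/max_idPl; exact: ln_ge0.
Qed.

Lemma ln_plus_le t t' : t <= t' -> 1 <= t' -> ln_plus t <= ln t'.
Proof.
move=> tt t1; have t'0 : 0 < t' by apply: lt_le_trans t1.
rewrite /ln_plus; case: ifPn => [t0|_]; last exact: ln_ge0.
by rewrite ge_max ln_ge0// andbT ler_ln// posrE.
Qed.

Lemma ln2_le1 : ln 2 <= 1 :> R.
Proof.
rewrite -[leRHS]expRK ler_ln ?posrE ?expR_gt0//.
by have := expR_ge1Dx (1 : R); lra.
Qed.

End log_plus.

(** * Increments of the field at distances comparable to 1/lambda *)

Section field_covariance.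
Context (R : realType) (d : measure_display) (T : measurableType d)
  (P : probability T R) (n : nat).
Variables (U : set 'rV[R]_n) (g : 'rV[R]_n -> T -> R) (a b alpha lam : R).
Hypothesis oU : open U.
Hypothesis GS : gaussian_space P (field_space U g).
Hypothesis alpha_gt0 : 0 < alpha.
Hypothesis lam_gt0 : 0 < lam.
Hypothesis a_ge0 : 0 <= a.

Local Notation S := (field_space U g).
Local Notation cov := (cov P).

Hypothesis covE : forall x y, U x -> U y ->
  `|cov (g x) (g y) - ln lam + ln_plus (lam * enorm (x - y))| <= a.
Hypothesis incrE : forall x y, U x -> U y -> lam * enorm (x - y) <= 1 ->
  cov (fun w => g x w - g y w) (fun w => g x w - g y w) <=
  b ^+ 2 * lam `^ alpha * enorm (x - y) `^ alpha.

Lemma enorm0 : enorm (0 : 'rV[R]_n) = 0.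
Proof. by rewrite -(scale0r (0 : 'rV[R]_n)) enormZ normr0 mul0r. Qed.

Lemma enorm_le_coord (x : 'rV[R]_n) (delta : R) : 0 <= delta ->
  (forall i, `|x 0 i| <= delta) -> enorm x <= n%:R * delta.
Proof.
move=> d0 xd; rewrite -(@ler_pXn2r _ 2) ?nnegrE ?enorm_ge0 ?mulr_ge0// enorm_sqr.
apply: (@le_trans _ _ (\sum_(i < n) delta ^+ 2)).
  apply: ler_sum => i _; rewrite -(real_normK (num_real (x 0 i))).
  by rewrite lerXn2r ?nnegrE.
rewrite sumr_const card_ord -[leLHS]mulr_natl exprMn ler_wpM2r ?sqr_ge0//.
by rewrite -natrX ler_nat; case: (n) => // k; rewrite -mulnn leq_pmulr.
Qed.

Lemma enorm_sub_le (x y : 'rV[R]_n) (q : R) : enorm x = q -> enorm y = q ->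
  enorm (x - y) <= 2 * q.
Proof.
move=> xq yq; have q0 : 0 <= q by rewrite -xq enorm_ge0.
rewrite -(@ler_pXn2r _ 2) ?nnegrE ?enorm_ge0 ?mulr_ge0// enorm_sqr.
have -> : (2 * q) ^+ 2 = 2 * enorm x ^+ 2 + 2 * enorm y ^+ 2 by rewrite xq yq; ring.
rewrite !enorm_sqr !mulr_sumr -big_split/=; apply: ler_sum => i _.
rewrite !mxE -subr_ge0; apply: le_trans (sqr_ge0 (x 0 i + y 0 i)) _.
by rewrite le_eqVlt; apply/orP; left; apply/eqP; ring.
Qed.

(** The two variances and twice the covariance contribute [ln lam] with total coefficient 0; the
    errors add up to a + a + 2a. *)
Lemma cov_field_incr x y (D : R) : U x -> U y -> lam * enorm (x - y) <= D -> 1 <= D ->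
  cov (fun w => g x w - g y w) (fun w => g x w - g y w) <= 4 * a + 2 * ln D.
Proof.
move=> Ux Uy xyD D1; have Sx := field_space_point g Ux; have Sy := field_space_point g Uy.
rewrite (cov_sqrB GS Sx Sy).
have := covE Ux Ux; have := covE Uy Uy; have := covE Ux Uy.
rewrite !subrr enorm0 mulr0 ln_plus0 !addr0 !ler_norml.
have := ln_plus_le xyD D1.
move=> h /andP[h1 h2] /andP[h3 h4] /andP[h5 h6]; lra.
Qed.

(** The increment hypothesis covers scaled distances up to 1 only; beyond that the logarithmic
    covariance gives a constant, and [delta] to the power [alpha] is at least 1. The resulting
    constant does not depend on [lam]. *)
Lemma cov_field_incr_le (D : R) : 1 <= D ->
  forall x y (delta : R), U x -> U y -> lam * enorm (x - y) <= delta -> delta <= D ->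
  cov (fun w => g x w - g y w) (fun w => g x w - g y w) <=
  (b ^+ 2 + 4 * a + 2 * ln D) * delta `^ alpha.
Proof.
move=> D1 x y delta Ux Uy xyd dD.
have d0 : 0 <= delta by apply: le_trans xyd; rewrite mulr_ge0 ?enorm_ge0// ltW.
have c0 : 0 <= 4 * a + 2 * ln D by rewrite addr_ge0 ?mulr_ge0// ln_ge0.
have p0 : 0 <= delta `^ alpha by exact: powR_ge0.
have [d1|d1] := leP delta 1.
  apply: le_trans (incrE Ux Uy (le_trans xyd d1)) _.
  rewrite -mulrA -powRM ?enorm_ge0 ?(ltW lam_gt0)//.
  apply: (@le_trans _ _ (b ^+ 2 * delta `^ alpha)).
    rewrite ler_wpM2l ?sqr_ge0// ge0_ler_powR ?nnegrE ?(ltW alpha_gt0)//.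
    by rewrite mulr_ge0 ?enorm_ge0// ltW.
  by rewrite ler_wpM2r//; lra.
apply: (le_trans (cov_field_incr Ux Uy (le_trans xyd dD) D1)).
have p1 : 1 <= delta `^ alpha.
  have e1 : 1 = 1 `^ alpha :> R by rewrite powR1.
  by rewrite [leLHS]e1 ge0_ler_powR ?nnegrE ?(ltW alpha_gt0)// ltW.
apply: (@le_trans _ _ ((b ^+ 2 + 4 * a + 2 * ln D) * 1)).
  by have := sqr_ge0 b; lra.
by rewrite ler_wpM2l//; have := sqr_ge0 b; lra.
Qed.

(** By Cauchy-Schwarz from the increment bound. This makes the regression coefficients, and hence
    the residual field, continuous in space. *)
Lemma cov_field_continuous x Z : U x -> S Z -> 0 < cov Z Z ->
  {for x, continuous (fun y => cov (g y) Z)}.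
Proof.
move=> Ux SZ z0; apply/(cvgrPdist_lt (FF := nbhs_filter x)) => e e0.
pose c := b ^+ 2 * lam `^ alpha * cov Z Z.
have c0 : 0 <= c.
  by apply: mulr_ge0; [apply: mulr_ge0; [exact: sqr_ge0|exact: powR_ge0]|exact: ltW].
(* The first bound makes the increment hypothesis applicable; in the second, [1 + c] also covers
   [c = 0]. *)
pose eta := Num.min lam^-1 ((e ^+ 2 / (1 + c)) `^ alpha^-1).
have ec0 : 0 < e ^+ 2 / (1 + c) by rewrite divr_gt0 ?exprn_gt0//; lra.
have eta0 : 0 < eta by rewrite lt_min invr_gt0 lam_gt0 powR_gt0.
have cx : enorm (x - y) @[y --> x] --> (0 : R).
  rewrite -enorm0 -(subrr x).
  apply: (cvg_comp (fun y => x - y) (@enorm R n)); last exact: enorm_continuous.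
  apply: (@cvgB _ _ _ (nbhs x) (nbhs_filter x)); last exact: cvg_id.
  exact: (@cvg_cst _ _ _ (nbhs x) (nbhs_filter x)).
near=> y.
have Uy : U y by near: y; exact: open_nbhs_nbhs.
have : enorm (x - y) < eta.
  near: y; move/cvgrPdist_lt : cx => /(_ _ eta0); apply: filterS => y.
  by rewrite sub0r normrN ger0_norm ?enorm_ge0.
rewrite lt_min => /andP[xy1 xy2].
have Sx := field_space_point g Ux; have Sy := field_space_point g Uy.
rewrite -(covBl GS Sx Sy SZ) -(@ltr_pXn2r _ 2) ?nnegrE ?(ltW e0)// real_normK ?num_real//.
apply: (le_lt_trans (cov_cauchy_schwarz GS (spaceB GS Sx Sy) SZ z0)).
have l1 : lam * enorm (x - y) <= 1 by rewrite mulrC -ler_pdivlMr// mul1r ltW.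
apply: (@le_lt_trans _ _ (c * (e ^+ 2 / (1 + c)))).
  apply: (@le_trans _ _ (b ^+ 2 * lam `^ alpha * enorm (x - y) `^ alpha * cov Z Z)).
    by rewrite ler_wpM2r ?(ltW z0)//; exact: incrE.
  have -> : b ^+ 2 * lam `^ alpha * enorm (x - y) `^ alpha * cov Z Z =
    c * enorm (x - y) `^ alpha by rewrite /c; ring.
  apply: ler_wpM2l => //.
  have -> : e ^+ 2 / (1 + c) = ((e ^+ 2 / (1 + c)) `^ alpha^-1) `^ alpha.
    by rewrite -powRrM mulVf ?gt_eqF// powRr1// ltW.
  by rewrite ge0_ler_powR ?nnegrE ?enorm_ge0 ?powR_ge0 ?(ltW alpha_gt0)// ltW.
rewrite mulrA ltr_pdivrMr; last by lra.
by have := exprn_gt0 2 e0; nra.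
Unshelve. all: by end_near. Qed.

End field_covariance.

(* With [D = l - a] and [c = 2 * a + 2], the regression term is at most
   [(D - c) ^ 2 / D], about [D - 2 * c], while the points of a sphere have
   covariance at least about [D - c]. *)
Lemma sphere_covariance (R : realType) (a l k00 k0z k0y kzy : R) :
  0 <= a -> a + 2 * (2 * a + 2) ^+ 2 + (4 * a + 2) + 2 <= l ->
  `|k00 - l| <= a -> `|k0z - l + (4 * a + 2)| <= a -> `|k0y - l + (4 * a + 2)| <= a ->
  l - (4 * a + 2) - 1 - a <= kzy ->
  k0z / k00 * k0y - kzy <= - (1 / 2) /\ 0 <= k0y / k00 <= 1.
Proof.
move=> a0 hl; rewrite !ler_norml => /andP[h1 h2] /andP[h3 h4] /andP[h5 h6] h7.
have c2 := sqr_ge0 (2 * a + 2).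
pose c := 2 * a + 2; pose D := l - a.
have D0 : 0 < D by rewrite /D; lra.
have cD : 2 * c ^+ 2 <= D by rewrite /D /c; lra.
have k000 : 0 < k00 by lra.
have D1 : D <= k00 by rewrite /D; lra.
have z0 : 0 <= k0z by lra.
have y0 : 0 <= k0y by lra.
have zN : k0z <= D - c by rewrite /D /c; lra.
have yN : k0y <= D - c by rewrite /D /c; lra.
split; last first.
  by rewrite divr_ge0//= ?(ltW k000)// ler_pdivrMr// mul1r; lra.
(* Since c^2/D <= 1/2. The assumed lower bound on [kzy] equals [D - 2 * c + 1], so the difference is
   at most -1/2. *)
have : k0z / k00 * k0y <= D - 2 * c + 1 / 2.
  rewrite mulrAC ler_pdivrMr//.
  apply: (@le_trans _ _ ((D - c) * (D - c))); first exact: ler_pM.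
  apply: (@le_trans _ _ ((D - 2 * c + 1 / 2) * D)).
    have -> : (D - c) * (D - c) = D * D - 2 * c * D + c ^+ 2 by ring.
    have -> : (D - 2 * c + 1 / 2) * D = D * D - 2 * c * D + D / 2 by ring.
    by lra.
  apply: ler_wpM2l => //.
  have : 0 <= D - c by apply: le_trans zN.
  by rewrite /D /c; move: c2; rewrite -/c; nra.
by rewrite /D /c; lra.
Qed.

Section residual_chaining.
Context (R : realType).

(* With [m] this order, [delta ^ (alpha * m) <= delta ^ (n + 2)] for [delta <= 1],
   the rate that chaining in dimension [n] requires. *)
Definition chain_order (alpha : R) (n : nat) : nat :=
  (Num.truncn (n.+2%:R / alpha)).+1.

(** The bound of [weight_moment] when the variance is at most C (D delta)^alpha, with the power of
    [delta] factored out. *)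
Definition chain_constant (a b alpha D : R) (n : nat) : R :=
  4 * ((chain_order alpha n).*2)`!%:R *
  ((b ^+ 2 + 4 * a + 2 * ln D) * D `^ alpha) ^+ chain_order alpha n.

(** Makes the ratio 4m/M of [chaining] equal to 1/(1 + 4K), with K the chaining constant, so the bad
    set carries at most a quarter of the weight. *)
Definition chain_bound (a b alpha D : R) (n : nat) : R :=
  (chain_order alpha n).*2.*2%:R * (1 + 4 * chain_constant a b alpha D n).

Context (d : measure_display) (T : measurableType d)
  (P : probability T R) (n : nat).
Variables (U : set 'rV[R]_n) (g : 'rV[R]_n -> T -> R) (a b alpha lam L : R).
Hypothesis n_gt0 : (0 < n)%N.
Hypothesis oU : open U.
Hypothesis rU : closed_eball 0 1 `<=` U.
Hypothesis cg : continuous_field U g.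
Hypothesis GS : gaussian_space P (field_space U g).
Hypothesis alpha_gt0 : 0 < alpha.
Hypothesis a_ge0 : 0 <= a.
Hypothesis L_ge4 : 4 <= L.
Hypothesis lam_ge : n%:R * L <= lam.

Local Notation S := (field_space U g).
Local Notation cov := (cov P).
Local Notation D := (n%:R * L).
Local Notation m := (chain_order alpha n).
Local Notation M := (chain_bound a b alpha D n).
Local Notation C := (b ^+ 2 + 4 * a + 2 * ln D).

Hypothesis covE : forall x y, U x -> U y ->
  `|cov (g x) (g y) - ln lam + ln_plus (lam * enorm (x - y))| <= a.
Hypothesis incrE : forall x y, U x -> U y -> lam * enorm (x - y) <= 1 ->
  cov (fun w => g x w - g y w) (fun w => g x w - g y w) <=
  b ^+ 2 * lam `^ alpha * enorm (x - y) `^ alpha.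

Variables A X : T -> R.
Hypotheses (SA : S A) (SX : S X) (AX0 : cov A X = 0).
Hypotheses (vA : 0 < cov A A) (vX : 0 < cov X X).
Variables (e c e' c' : R).

Local Notation res y := (residual P A X (g y)).
Local Notation wt := (weight A X e c e' c').

(** Maps the unit cube to the cube of side L/lam centred at the origin, so that chaining covers a
    full neighbourhood of 0. *)
Let pos (t : 'rV[R]_n) : 'rV[R]_n := (L / lam) *: (t - const_mx (1 / 2)).

Let D_ge4 : 4 <= D.
Proof.
apply: le_trans L_ge4 _; apply: ler_peMl; last by rewrite ler1n.
by apply: le_trans L_ge4.
Qed.

Let lam_gt0 : 0 < lam.
Proof. by apply: lt_le_trans lam_ge; apply: lt_le_trans D_ge4. Qed.

Let C_gt0 : 0 < C.
Proof.
have : 0 < ln D by rewrite ln_gt0//; apply: lt_le_trans D_ge4; lra.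
by have := sqr_ge0 b; have := a_ge0; move: (b ^+ 2) (ln D) => u v; lra.
Qed.

Let M_gt0 : 0 < M.
Proof.
rewrite mulr_gt0 ?ltr0n ?double_gt0// ltr_wpDr// mulr_ge0// mulr_ge0//.
by rewrite exprn_ge0// mulr_ge0 ?powR_ge0// ltW.
Qed.

Let U_pos t : unit_cube t -> U (pos t).
Proof.
move=> tc; have hD := D_ge4; have hl := lam_gt0; have L4 := L_ge4.
apply: rU; rewrite /closed_eball/= subr0 /pos enormZ.
have Ll : 0 < L / lam by rewrite divr_gt0//; lra.
rewrite (gtr0_norm Ll).
have h : enorm (t - const_mx (1 / 2)) <= n%:R * (1 / 2).
  apply: enorm_le_coord => // i; rewrite !mxE.
  by have /andP[t0 t1] := tc i; rewrite ler_norml; apply/andP; split; lra.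
apply: (le_trans (ler_wpM2l (ltW Ll) h)).
rewrite mulrAC ler_pdivrMr// [1 * lam]mul1r; apply: le_trans lam_ge.
have -> : L * (n%:R * (1 / 2)) = n%:R * L / 2 by ring.
by move: (n%:R * L) hD => D ?; lra.
Qed.

Let res_incr x y (delta : R) : unit_cube x -> unit_cube y -> 0 < delta -> delta <= 1 ->
  (forall i, `|x 0 i - y 0 i| <= delta) ->
  Lone P (fun w => wt w * (res (pos x) w - res (pos y) w) ^+ m.*2) /\
  Ex P (fun w => wt w * (res (pos x) w - res (pos y) w) ^+ m.*2) <=
    chain_constant a b alpha D n * Ex P wt * delta ^+ n.+2.
Proof.
move=> xc yc d0 d1 xyd; have hD := D_ge4; have hl := lam_gt0; have L4 := L_ge4.
have Sx := field_space_point g (U_pos xc); have Sy := field_space_point g (U_pos yc).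
have SB := spaceB GS Sx Sy.
have Dd0 : 0 < D * delta by rewrite mulr_gt0//; lra.
pose q := C * (D * delta) `^ alpha.
have q0 : 0 < q by rewrite mulr_gt0 ?powR_gt0.
have covB : cov (fun w => g (pos x) w - g (pos y) w) (fun w => g (pos x) w - g (pos y) w) <= q.
  have D1 : 1 <= D by lra.
  apply: (cov_field_incr_le GS alpha_gt0 lam_gt0 a_ge0 covE incrE D1 (U_pos xc) (U_pos yc)).
    have -> : pos x - pos y = (L / lam) *: (x - y).
      by rewrite /pos -scalerBr opprB addrA subrK.
    rewrite enormZ gtr0_norm ?divr_gt0//; last by lra.
    rewrite mulrA mulrCA divff ?gt_eqF// mulr1 [n%:R * L]mulrC -mulrA.
    apply: ler_wpM2l; first by lra.
    by apply: enorm_le_coord => [|i]; [exact: ltW|rewrite !mxE].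
  by rewrite ler_piMr//; lra.
have h1 : (fun w => res (pos x) w - res (pos y) w) =
    residual P A X (fun w => g (pos x) w - g (pos y) w).
  by apply/funext => w; rewrite (residualB GS).
have SR := space_residual GS SA SX SB.
have oA := residual_orthA GS SA SX AX0 vA SB.
have oX := residual_orthX GS SA SX AX0 vX SB.
have vR := le_trans (cov_residual_le GS SA SX AX0 vA vX SB) covB.
have t0 : 0 < Num.sqrt q by rewrite sqrtr_gt0.
have tq : Num.sqrt q ^+ 2 = q by rewrite sqr_sqrtr// ltW.
rewrite -tq in vR.
have [W1 W2] := weight_moment GS SA SX AX0 e c e' c' m SR oA oX t0 vR.
have h2 : (fun w => wt w * (res (pos x) w - res (pos y) w) ^+ m.*2) =
   (fun w => wt w * residual P A X (fun w => g (pos x) w - g (pos y) w) w ^+ m.*2).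
  by apply/funext => w; rewrite -h1.
rewrite h2; split=> //; apply: le_trans W2 _.
have W0 : 0 <= Ex P wt by apply: Ex_ge0 => w; exact: weight_ge0.
rewrite [leRHS]mulrAC; apply: ler_wpM2r => //; rewrite /chain_constant -[leRHS]mulrA.
apply: ler_wpM2l => //.
rewrite -mul2n exprM tq /q (powRM _ (le_trans _ D_ge4) (ltW d0))// mulrA exprMn.
apply: ler_wpM2l; first by rewrite exprn_ge0// mulr_ge0 ?powR_ge0// ltW.
rewrite -(powR_mulrn _ (powR_ge0 delta alpha)) -powRrM -(powR_mulrn _ (ltW d0)).
rewrite ger_powR ?d0//.
rewrite mulrC -ler_pdivrMr//; apply: ltW; exact: truncnS_gt.
Qed.

Let cont_res w x : unit_cube x -> {for x, continuous (fun y => res (pos y) w)}.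
Proof.
move=> xc; have Ux := U_pos xc.
have cpos : {for x, continuous pos}.
  apply: (@continuous_comp _ _ _ (fun t : 'rV[R]_n => t - const_mx (1 / 2))
    (fun t => (L / lam) *: t)); last exact: scaler_continuous.
  apply: (@cvgB _ _ _ (nbhs x) (nbhs_filter x)); first exact: cvg_id.
  exact: (@cvg_cst _ _ _ (nbhs x) (nbhs_filter x)).
have cc Z : S Z -> 0 < cov Z Z -> {for x, continuous (fun y => cov (g (pos y)) Z)}.
  move=> SZ Z0; apply: (@continuous_comp _ _ _ pos (fun y => cov (g y) Z)) => //.
  exact: (@cov_field_continuous _ _ _ _ _ _ _ _ _ _ oU GS alpha_gt0 lam_gt0 incrE _ _ Ux SZ Z0).
have cgx : {for x, continuous (fun y => g (pos y) w)}.
  apply: (@continuous_comp _ _ _ pos (fun y => g y w)) => //.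
  exact: (@continuous_field_at _ _ _ _ _ _ oU cg w _ Ux).
rewrite /residual.
apply: (@cvgB _ _ _ (nbhs x) (nbhs_filter x)).
  apply: (@cvgB _ _ _ (nbhs x) (nbhs_filter x)) => //.
  apply: (@cvgM _ _ (nbhs x) (nbhs_filter x)); last exact: (@cvg_cst _ _ _ (nbhs x) (nbhs_filter x)).
  apply: (@cvgM _ _ (nbhs x) (nbhs_filter x)); last exact: (@cvg_cst _ _ _ (nbhs x) (nbhs_filter x)).
  exact: cc SA vA.
apply: (@cvgM _ _ (nbhs x) (nbhs_filter x)); last exact: (@cvg_cst _ _ _ (nbhs x) (nbhs_filter x)).
apply: (@cvgM _ _ (nbhs x) (nbhs_filter x)); last exact: (@cvg_cst _ _ _ (nbhs x) (nbhs_filter x)).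
exact: cc SX vX.
Qed.

Lemma residual_small : exists Bad : set T,
  [/\ measurable Bad, Ex P (fun w => wt w * \1_Bad w) <= Ex P wt / 4 &
   forall w y, ~ Bad w -> enorm y <= L / 4 / lam ->
     `|res y w - res 0 w| <= 2 * M].
Proof.
have hD := D_ge4; have hl := lam_gt0; have L4 := L_ge4.
have W0 : 0 <= Ex P wt by apply: Ex_ge0 => w; exact: weight_ge0.
have K0 : 0 <= chain_constant a b alpha D n.
  by rewrite mulr_ge0// exprn_ge0// mulr_ge0 ?powR_ge0// ltW.
have KW : 0 <= chain_constant a b alpha D n * Ex P wt by exact: mulr_ge0.
have mwt := measurable_weight GS SA SX e c e' c'.
have wt01 w : 0 <= wt w <= 1 by rewrite weight_ge0 weight_le1.
have mres x : unit_cube x -> measurable_fun setT (res (pos x)).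
  move=> xc; apply: (space_measurable GS).
  by apply: (space_residual GS SA SX); apply: field_space_point; exact: U_pos.
have [Bad [mBad EBad hBad]] := chaining (ltn0Sn _) KW mwt wt01 mres res_incr cont_res M_gt0.
exists Bad; split => //.
  apply: le_trans EBad _; rewrite mulrAC [leRHS]mulrC; apply: ler_wpM2r => //.
  rewrite /chain_bound; set K := chain_constant _ _ _ _ _ in K0 *.
  have m0 : 0 < m.*2.*2%:R :> R by rewrite ltr0n !double_gt0.
  have -> : m.*2.*2%:R / (m.*2.*2%:R * (1 + 4 * K)) = (1 + 4 * K)^-1.
    by rewrite invfM mulrA divff ?mul1r// gt_eqF.
  have q1 : 0 <= (1 + 4 * K)^-1 <= 1.
    by rewrite invr_ge0 invf_le1; [apply/andP; split|]; lra.
  have [q0 q2] := andP q1.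
  apply: (@le_trans _ _ (K * (1 + 4 * K)^-1)).
    apply: ler_wpM2l => //; rewrite -[leRHS]expr1; by apply: ler_wiXn2l; rewrite ?doubleS.
  by rewrite ler_pdivrMr; lra.
move=> w y nB yL.
pose pre (y : 'rV[R]_n) : 'rV[R]_n := (lam / L) *: y + const_mx (1 / 2).
have L0 : 0 < L by lra.
have prek z : pos (pre z) = z.
  rewrite /pos /pre addrK scalerA -[RHS]scale1r; congr (_ *: _).
  by field; rewrite !gt_eqF.
have prec z : enorm z <= L / 4 / lam -> forall i, 0 <= pre z 0 i < 1.
  move=> zL i; have zi := le_trans (coord_le_enorm z i) zL; rewrite !mxE.
  have : `|lam / L * z 0 i| <= 1 / 4.
    rewrite normrM gtr0_norm ?divr_gt0//.
    apply: (@le_trans _ _ (lam / L * (L / 4 / lam))).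
      by apply: ler_wpM2l => //; rewrite divr_ge0// ltW.
    by rewrite le_eqVlt; apply/orP; left; apply/eqP; field; rewrite !gt_eqF.
  by rewrite ler_norml => /andP[]; lra.
have z0 : enorm (0 : 'rV[R]_n) <= L / 4 / lam.
  by rewrite enorm0 divr_ge0 ?(ltW lam_gt0)//; lra.
(* Chaining compares with a corner of the cube, not with its centre, so [y] and [0] are both
   compared with that corner; hence [2 * M]. *)
have := hBad w (pre y) nB (prec _ yL).
have := hBad w (pre 0) nB (prec _ z0).
rewrite !prek !ler_norml => /andP[? ?] /andP[? ?]; apply/andP; split; lra.
Qed.

End residual_chaining.

(** * Constants and the lower bound at one scale *)

Section one_scale.
Context (R : realType).

(** Between 0 and the sphere of radius [nodal_radius a / lam] the covariance drops by 4a + 2 up to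
    an error [a], the drop that [sphere_covariance] requires. *)
Definition nodal_radius (a : R) : R := expR (4 * a + 2).

(** The side 4 times the radius makes the ball of [residual_small], of radius L/4/lam, reach exactly
    the sphere. *)
Definition residual_bound (a b alpha : R) (n : nat) : R :=
  chain_bound a b alpha (n%:R * (4 * nodal_radius a)) n.

Definition variance_bound (a : R) : R := 4 * a + 2 * (4 * a + 2).

(* The value of [X] for which the regression of [f y] on [X] pulls [f] on the
   sphere down to [-1], whatever the residual field does within its bound. *)
Definition pull_level (a b alpha : R) (n : nat) : R :=
  1 + 2 * variance_bound a * (2 * residual_bound a b alpha n + 4).

(** A quarter of the product of the two lower bounds of [gaussian_bump_window]. The standard
    deviation of [A] is at most 2 sqrt(ln lambda), whence 48 = 24 * 2, and that of [X] at most
    [1 + variance_bound a]. *)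
Definition nodal_constant (a b alpha : R) (n : nat) : R :=
  let s := pull_level a b alpha n in
  bump_scale 2 * bump_peak 2 / 48 *
  (bump_scale s * bump_peak s / (24 * (1 + variance_bound a))) / 4.

Definition nodal_threshold (a : R) : R := a + 2 * (2 * a + 2) ^+ 2 + (4 * a + 2) + 2.

Lemma bump_scale_gt0 c : 0 < bump_scale c :> R.
Proof. by have /andP[h _] := bump_peak_itv c; rewrite /bump_scale; lra. Qed.

Lemma nodal_constant_gt0 a b alpha n : 0 <= a -> 0 < nodal_constant a b alpha n.
Proof.
move=> a0; have /andP[h1 _] := @bump_peak_itv R 2.
have /andP[h2 _] := bump_peak_itv (pull_level a b alpha n).
rewrite divr_gt0// mulr_gt0// divr_gt0// ?mulr_gt0 ?bump_scale_gt0//.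
by rewrite /variance_bound; lra.
Qed.

Context (d : measure_display) (T : measurableType d)
  (P : probability T R) (n : nat).
Variables (U : set 'rV[R]_n) (g : 'rV[R]_n -> T -> R) (a b alpha lam : R).
Hypothesis n_gt0 : (0 < n)%N.
Hypothesis oU : open U.
Hypothesis rU : closed_eball 0 1 `<=` U.
Hypothesis Gg : gaussian_field P U g.
Hypothesis Cg : centered_field P U g.
Hypothesis cg : continuous_field U g.
Hypothesis alpha_gt0 : 0 < alpha.
Hypothesis a_ge0 : 0 <= a.
Hypothesis lam_ge_exp : expR (nodal_threshold a) <= lam.
Hypothesis lam_ge : n%:R * (4 * nodal_radius a) <= lam.

Local Notation S := (field_space U g).
Local Notation cov := (cov P).
Local Notation r := (4 * a + 2).
Local Notation rad := (nodal_radius a).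
Local Notation V := (variance_bound a).
Local Notation M := (residual_bound a b alpha n).
Local Notation s := (pull_level a b alpha n).

Hypothesis covE : forall x y, U x -> U y ->
  `|cov (g x) (g y) - ln lam + ln_plus (lam * enorm (x - y))| <= a.
Hypothesis incrE : forall x y, U x -> U y -> lam * enorm (x - y) <= 1 ->
  cov (fun w => g x w - g y w) (fun w => g x w - g y w) <=
  b ^+ 2 * lam `^ alpha * enorm (x - y) `^ alpha.

Let GS : gaussian_space P S := field_gaussian_space Gg Cg.

Let rad_ge1 : 1 <= rad.
Proof. by rewrite /nodal_radius -[leLHS]expR0 ler_expR; have := a_ge0; lra. Qed.

Let lam_ge4 : 4 * rad <= lam.
Proof.
apply: le_trans lam_ge; apply: ler_peMl; last by rewrite ler1n.
by have := rad_ge1; lra.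
Qed.

Let lam_gt0 : 0 < lam.
Proof. by have := rad_ge1; have := lam_ge4; lra. Qed.

Let ln_lam_ge : nodal_threshold a <= ln lam.
Proof. by rewrite -[leLHS]expRK ler_ln ?posrE ?expR_gt0. Qed.

Let in_ball y q : enorm y <= q / lam -> q <= lam -> U y.
Proof.
move=> yq ql; apply: rU; rewrite /closed_eball/= subr0; apply: (le_trans yq).
by rewrite ler_pdivrMr// mul1r.
Qed.

Let U0 : U 0.
Proof.
apply: (@in_ball _ 1); first by rewrite enorm0 divr_ge0// ltW.
by have := rad_ge1; have := lam_ge4; lra.
Qed.

Let U_sphere y : enorm y = rad / lam -> U y.
Proof.
move=> yr; apply: (@in_ball _ rad); first by rewrite yr.
by have := rad_ge1; have := lam_ge4; lra.
Qed.

Let z : 'rV[R]_n := (rad / lam) *: delta_mx 0 (Ordinal n_gt0).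

Let z_sphere : enorm z = rad / lam.
Proof. by apply: enorm_delta; rewrite divr_ge0 ?expR_ge0// ltW. Qed.

Let Uz : U z := U_sphere z_sphere.

Let A := g 0.
Let SA : S A := field_space_point g U0.
Let Sz : S (g z) := field_space_point g Uz.

Let p : R := cov (g z) A / cov A A.
Let X w : R := p * A w - g z w.

Let SX : S X. Proof. by apply: (spaceB GS) => //; apply: (spaceZ GS). Qed.

Let cov00 : `|cov A A - ln lam| <= a.
Proof. by have := covE U0 U0; rewrite subr0 enorm0 mulr0 ln_plus0 addr0. Qed.

Let cov_sphere0 y : enorm y = rad / lam -> `|cov (g y) A - ln lam + r| <= a.
Proof.
move=> yr; have := covE (U_sphere yr) U0.
have -> : lam * enorm (y - 0) = rad by rewrite subr0 yr mulrC divfK ?gt_eqF.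
by rewrite ln_plus_ge1// /nodal_radius expRK.
Qed.

Let cov_sphere y : enorm y = rad / lam -> ln lam - r - 1 - a <= cov (g z) (g y).
Proof.
move=> yr; have := covE Uz (U_sphere yr).
have h : lam * enorm (z - y) <= 2 * rad.
  apply: le_trans (ler_wpM2l (ltW lam_gt0) (enorm_sub_le z_sphere yr)) _.
  by rewrite mulrCA [lam * _]mulrC divfK ?gt_eqF.
have h1 : ln_plus (lam * enorm (z - y)) <= ln (2 * rad).
  by apply: ln_plus_le => //; have := rad_ge1; lra.
have : ln (2 * rad) <= 1 + r.
  by rewrite lnM ?posrE ?expR_gt0// /nodal_radius expRK lerD2r ln2_le1.
by rewrite ler_norml => h2 /andP[h3 h4]; lra.
Qed.

Let arith y : enorm y = rad / lam ->
  p * cov (g y) A - cov (g z) (g y) <= - (1 / 2) /\ 0 <= cov (g y) A / cov A A <= 1.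
Proof.
move=> yr; exact: (sphere_covariance a_ge0 ln_lam_ge cov00 (cov_sphere0 z_sphere)
  (cov_sphere0 yr) (cov_sphere yr)).
Qed.

Let vA : 1 <= cov A A.
Proof.
have := cov00; have := ln_lam_ge; rewrite /nodal_threshold ler_norml => h /andP[h1 _].
by have := a_ge0; have := sqr_ge0 (2 * a + 2); lra.
Qed.

Let vA0 : 0 < cov A A. Proof. exact: lt_le_trans vA. Qed.

Let AX0 : cov A X = 0.
Proof.
rewrite covC (covBl GS (spaceZ GS p SA) Sz SA) (covZl GS p SA SA).
by rewrite /p divfK ?gt_eqF// subrr.
Qed.

Let covX y : U y -> cov (g y) X = p * cov (g y) A - cov (g z) (g y).
Proof.
move=> Uy; have Sy := field_space_point g Uy.
rewrite covC (covBl GS (spaceZ GS p SA) Sz Sy) (covZl GS p SA Sy).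
by rewrite (covC P A).
Qed.

Let covXX : cov X X = cov (g z) (g z) - p * cov (g z) A.
Proof.
rewrite {1}/X (covBl GS (spaceZ GS p SA) Sz SX) (covZl GS p SA SX) AX0 mulr0 sub0r.
by rewrite (covX Uz) opprB.
Qed.

Let vX : 1 / 2 <= cov X X.
Proof. by have [h _] := arith z_sphere; rewrite covXX; lra. Qed.

Let vX0 : 0 < cov X X. Proof. by apply: lt_le_trans vX. Qed.

(** The regression coefficient [p] minimises the variance of [g z - p * A]; the coefficient 1 gives
    the increment between [z] and 0, whose variance does not grow with [lam]. *)
Let vX_le : cov X X <= V.
Proof.
have h1 : lam * enorm (z - 0) <= rad by rewrite subr0 z_sphere mulrC divfK ?gt_eqF.
have := cov_field_incr GS covE Uz U0 h1 rad_ge1.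
rewrite (cov_sqrB GS Sz SA) covXX {1}/nodal_radius expRK => h.
apply: le_trans h; rewrite -subr_ge0.
have -> : cov (g z) (g z) - 2 * cov (g z) A + cov A A - (cov (g z) (g z) - p * cov (g z) A) =
  (p - 1) ^+ 2 * cov A A.
  by rewrite /p; field; rewrite gt_eqF.
by rewrite mulr_ge0 ?sqr_ge0// ltW.
Qed.

Let M_ge0 : 0 <= M.
Proof.
rewrite mulr_ge0// addr_ge0// mulr_ge0// mulr_ge0// exprn_ge0// mulr_ge0 ?powR_ge0//.
rewrite !addr_ge0 ?sqr_ge0 ?mulr_ge0// ln_ge0//.
have h : 4 * rad <= n%:R * (4 * rad).
  apply: ler_peMl; last by rewrite ler1n.
  by have := rad_ge1; lra.
by apply: le_trans h; have := rad_ge1; lra.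
Qed.

Let event_sub Bad :
  (forall w y, ~ Bad w -> enorm y <= 4 * rad / 4 / lam ->
     `|residual P A X (g y) w - residual P A X (g 0) w| <= 2 * M) ->
  ([set w | `|A w - 2| <= 1] `&` [set w | `|X w - s| <= 1]) `\` Bad `<=`
  component_event U g (2 * rad / lam).
Proof.
move=> hBad w [[/= Aw Xw] nB]; have r1 := rad_ge1; have l0 := lam_gt0.
have V0 : 0 < V by rewrite /variance_bound; have := a_ge0; lra.
move: Aw Xw; rewrite !ler_norml => /andP[A1 A2] /andP[X1 X2].
apply: (@component_event_sphere _ _ _ _ _ _ oU cg _ (rad / lam)) => //.
- by rewrite divr_gt0//; lra.
- by rewrite ltr_pM2r ?invr_gt0//; lra.
- move=> y; rewrite /closed_eball/= subr0 => h; apply: in_ball h _.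
  by have := lam_ge4; lra.
- by rewrite -/A; lra.
move=> y yr; have Uy := U_sphere yr.
have yr' : enorm y <= 4 * rad / 4 / lam.
  by rewrite yr le_eqVlt; apply/orP; left; apply/eqP; congr (_ / _); field.
have := hBad w y nB yr'; rewrite -/A (residual_self AX0 vA0) subr0 ler_norml.
move=> /andP[_]; rewrite /residual (covX Uy).
have [h1 /andP[h2 h3]] := arith yr.
move: h2 h3; set q := cov (g y) A / cov A A => h2 h3.
set u := p * cov (g y) A - cov (g z) (g y) in h1 *.
have qA : q * A w <= 3.
  apply: (@le_trans _ _ (1 * A w)); last by lra.
  by apply: ler_wpM2r => //; lra.
have s1 : 2 * V * (2 * M + 4) <= X w by move: X1; rewrite /pull_level; lra.
have uX : u / cov X X * X w <= - (2 * M + 4).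
  have u0 : u / cov X X <= - (2 * V)^-1.
    rewrite ler_pdivrMr//; apply: le_trans h1 _; rewrite mulNr lerN2.
    by rewrite ler_pdivrMl ?mulr_gt0//; have := vX_le; lra.
  apply: (@le_trans _ _ (- (2 * V)^-1 * X w)).
    apply: ler_wpM2r => //; apply: le_trans s1.
    have h : 0 <= 2 * M + 4 by have := M_ge0; lra.
    by apply: mulr_ge0 => //; apply: mulr_ge0 => //; exact: ltW.
  by rewrite mulNr lerN2 ler_pdivlMl ?mulr_gt0.
(* The terms in [A] and the residual give at most 3 + 2M and the term in [X] at most -(2M + 4), so
   the field is at most -1. *)
by move=> h; lra.
Qed.

Let mg x : U x -> measurable_fun setT (g x).
Proof. by move=> Ux; apply: (space_measurable GS); exact: field_space_point. Qed.

Let measurable_event : measurable (component_event U g (2 * rad / lam)).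
Proof.
apply: (measurable_component_event oU mg cg).
move=> y; rewrite /closed_eball/= subr0 => h; apply: in_ball h _.
by have := lam_ge4; have := rad_ge1; lra.
Qed.

Lemma component_probability : measurable (component_event U g (2 * rad / lam)) /\
  ((nodal_constant a b alpha n * ln lam `^ (- 2^-1))%:E <=
    P (component_event U g (2 * rad / lam)))%E.
Proof.
split=> //; have r1 := rad_ge1.
have [sA GA] : exists s, centered_gaussian P A s by have [+ _] := GS; exact.
have [sX GX] : exists s, centered_gaussian P X s by have [+ _] := GS; exact.
have [_ sA0 _] := GA; have [_ sX0 _] := GX.
have eA : sA ^+ 2 = cov A A.
  by rewrite -(gaussian_sqr GA); congr Ex; apply/funext => w; rewrite expr2.
have eX : sX ^+ 2 = cov X X.
  by rewrite -(gaussian_sqr GX); congr Ex; apply/funext => w; rewrite expr2.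
have sA1 : 0 < sA.
  by rewrite lt_neqAle sA0 andbT eq_sym -sqrf_eq0 eA gt_eqF.
have sX1 : 0 < sX.
  by rewrite lt_neqAle sX0 andbT eq_sym -sqrf_eq0 eX gt_eqF.
have hA2 : 1 / 2 <= sA ^+ 2 by rewrite eA; have := vA; lra.
have hX2 : 1 / 2 <= sX ^+ 2 by rewrite eX.
have [A1 A2] := gaussian_bump_window 2 GA sA1 hA2.
have [X1 X2] := gaussian_bump_window s GX sX1 hX2.
have L4 : 4 <= 4 * rad by lra.
have [Bad [mBad EBad hBad]] := residual_small n_gt0 oU rU cg GS alpha_gt0 a_ge0 L4
  lam_ge covE incrE SA SX AX0 vA0 vX0 (bump_scale 2) 2 (bump_scale s) s.
have := weight_lower_bound GS SA SX AX0 (bump_scale_gt0 2) (bump_scale_gt0 s) A1 X1 mBad EBad.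
rewrite (Ex_weight GS SA SX AX0) => low.
have sub := event_sub hBad.
apply: (@le_trans _ _ (P (([set w | (`|A w - 2| <= 1)%R] `&`
    [set w | (`|X w - s| <= 1)%R]) `\` Bad))); last first.
  apply: le_measure => //; rewrite inE//.
  apply: measurableD => //; apply: measurableI; apply: measurable_window.
    exact: (space_measurable GS SA).
  exact: (space_measurable GS SX).
apply: le_trans low; rewrite lee_fin.
have ln1 : 1 <= ln lam.
  by have := ln_lam_ge; rewrite /nodal_threshold; have := a_ge0; have := sqr_ge0 (2 * a + 2); lra.
have ln0 : 0 < ln lam by lra.
have -> : ln lam `^ (- 2^-1) = (Num.sqrt (ln lam))^-1.
  by rewrite powRN powR12_sqrt// ltW.
set sl := Num.sqrt (ln lam).
have sl0 : 0 < sl by rewrite sqrtr_gt0.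
have sl2 : sl ^+ 2 = ln lam by rewrite sqr_sqrtr// ltW.
(* The variance of [A] is at most [ln lam + a], and the threshold gives [a <= ln lam]. *)
have sAl : sA <= 2 * sl.
  rewrite -(@ler_pXn2r _ 2) ?nnegrE ?mulr_ge0 ?(ltW sl0)// exprMn sl2 eA.
  have := cov00; rewrite ler_norml => /andP[_ h].
  by have := ln_lam_ge; rewrite /nodal_threshold; have := a_ge0; have := sqr_ge0 (2 * a + 2); lra.
have V0 : 0 < V by rewrite /variance_bound; have := a_ge0; lra.
have sXV : sX <= 1 + V.
  have := vX_le; rewrite -eX => h; nra.
have /andP[p1 _] := @bump_peak_itv R 2; have /andP[p2 _] := bump_peak_itv s.
have b1 := @bump_scale_gt0 2; have b2 := bump_scale_gt0 s.
have pb1 : 0 < bump_scale 2 * bump_peak 2 :> R by rewrite mulr_gt0.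
have pb2 : 0 < bump_scale s * bump_peak s by rewrite mulr_gt0.
have hA : bump_scale 2 * bump_peak 2 / 48 / sl <=
    Ex P (fun w => bump ((bump_scale 2)^-1 * (A w - 2)) ^+ 2).
  apply: le_trans A2; rewrite -mulrA; apply: ler_wpM2l; first exact: ltW.
  rewrite -invfM lef_pV2 ?posrE ?mulr_gt0//; lra.
have hX : bump_scale s * bump_peak s / (24 * (1 + V)) <=
    Ex P (fun w => bump ((bump_scale s)^-1 * (X w - s)) ^+ 2).
  apply: le_trans X2; apply: ler_wpM2l; first exact: ltW.
  rewrite lef_pV2 ?posrE ?mulr_gt0//; lra.
apply: (@le_trans _ _ (bump_scale 2 * bump_peak 2 / 48 / sl *
   (bump_scale s * bump_peak s / (24 * (1 + V))) / 4)).
  rewrite /nodal_constant le_eqVlt; apply/orP; left; apply/eqP.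
  by move: (bump_scale s * _ / _) (bump_scale 2 * _ / _) => u v; ring.
apply: ler_wpM2r => //; apply: ler_pM => //; apply: divr_ge0; try exact: ltW.
  by apply: divr_ge0; [exact: ltW|].
by apply: mulr_ge0 => //; lra.
Qed.

End one_scale.

(* Since [C^lambda] is an event, its measurability is part of the conclusion
   (the library's measures are arbitrary on non-measurable sets). At lambda = 1
   the library gives [ln 1 `^ (- 2^-1) = 0]; as lambda0 can always be enlarged,
   this does not affect the meaning. *)
Theorem theorem1p6 (R : realType) (n : nat) (hn : (1 <= n)%N)
    (a b alpha : R) (halpha : 0 < alpha <= 2) :
  exists rho kappa lambda0 : R,
    [/\ 0 < rho, 0 < kappa, 1 <= lambda0 &
     forall (U : set 'rV[R]_n) (d : measure_display) (T : measurableType d)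
       (P : probability T R) (f : R -> 'rV[R]_n -> T -> R),
       open U ->
       closed_eball 0 1 `<=` U ->
       (forall lambda : R, 1 <= lambda ->
          [/\ gaussian_field P U (f lambda),
              centered_field P U (f lambda) &
              continuous_field U (f lambda)]) ->
       (forall (x y : 'rV[R]_n) (lambda : R), U x -> U y -> 1 <= lambda ->
          (`| 'E_P[(fun w => f lambda x w * f lambda y w)%R]
              - (ln lambda)%:E
              + (ln_plus (lambda * enorm (x - y)))%:E | <= a%:E)%E) ->
       (forall (x y : 'rV[R]_n) (lambda : R), U x -> U y -> 1 <= lambda ->
          lambda * enorm (x - y) <= 1 ->
          ('E_P[(fun w => (f lambda x w - f lambda y w) ^+ 2)%R]
             <= (b ^+ 2 * lambda `^ alpha * enorm (x - y) `^ alpha)%:E)%E) ->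
       forall lambda : R, lambda0 <= lambda ->
         measurable (component_event U (f lambda) (rho / lambda)) /\
         ((kappa * ln lambda `^ (- 2^-1))%:E
            <= P (component_event U (f lambda) (rho / lambda)))%E].

Proof.
have /andP[alpha0 _] := halpha.
(* The statement puts no sign on [a], while the estimates take it nonnegative; the covariance
   hypothesis persists with [|a|]. *)
pose a1 := `|a|; have a0 : 0 <= a1 by exact: normr_ge0.
have e1 : 1 <= expR (nodal_threshold a1).
  rewrite -[leLHS]expR0 ler_expR /nodal_threshold.
  by have := sqr_ge0 (2 * a1 + 2); lra.
have r0 : 0 < nodal_radius a1 by exact: expR_gt0.
(* The sphere used has half this radius after scaling. The threshold is a sum so that it dominates
   both the logarithmic condition and the one placing the chaining cube inside the unit ball. *)
exists (2 * nodal_radius a1), (nodal_constant a1 b alpha n),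
  (expR (nodal_threshold a1) + n%:R * (4 * nodal_radius a1)).
have N0 : 0 <= n%:R * (4 * nodal_radius a1) by rewrite mulr_ge0// mulr_ge0// ltW.
split=> //.
- by rewrite mulr_gt0.
- exact: nodal_constant_gt0.
- by apply: le_trans e1 _; rewrite lerDl.
move=> U d T P f oU rU fE covE incrE lam lam_ge.
have lam1 : 1 <= lam.
  by apply: le_trans lam_ge; apply: le_trans e1 _; rewrite lerDl.
have [Gf Cf cf] := fE lam lam1.
have GS := field_gaussian_space Gf Cf.
apply: component_probability => //.
- by apply: le_trans lam_ge; rewrite lerDl.
- by apply: le_trans lam_ge; rewrite lerDr expR_ge0.
- move=> x y Ux Uy; have Sx := field_space_point (f lam) Ux.
  have Sy := field_space_point (f lam) Uy.
  have := covE x y lam Ux Uy lam1.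
  rewrite unlock (EFin_Ex (space_LoneM GS Sx Sy)) -EFinB -EFinD lee_fin => h.
  by apply: le_trans h _; exact: ler_norm.
move=> x y Ux Uy xy; have Sx := field_space_point (f lam) Ux.
have Sy := field_space_point (f lam) Uy; have SB := spaceB GS Sx Sy.
have := incrE x y lam Ux Uy lam1 xy.
have -> : (fun w => (f lam x w - f lam y w) ^+ 2)%R =
  (fun w => (f lam x w - f lam y w) * (f lam x w - f lam y w))%R.
  by apply/funext => w; rewrite expr2.
by rewrite unlock (EFin_Ex (space_LoneM GS SB SB)) lee_fin.
Qed.
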